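(* Assume $f$ is in Case 2 and let $r>0$ be sufficiently small. Suppose $\delta<T_{s-1}$. If $\delta<d$, then $G_z=G_z^{\alpha}$ and $G_f=0$ on $A_0$. If $\delta=d$, then $G_z=-\infty$ and $G_f=G_p$ on $A_0$. If $\delta>d\ge1$, then $G_z=\alpha G_p$ on $A_0\setminus E_w$ and $G_z=-\infty$ on $E_w$. If $d=0$, then $G_z=\alpha G_p$ on $A_0$. In particular, if $\delta>d$, then $G_f^{\alpha}=\alpha G_p$ on $A_0$. Suppose instead $T_{s-1}=\delta>d\ge2$. Then $G_z=\alpha G_p$ on $A_f\setminus E_w$ and $G_z=-\infty$ on $E_w$; hence $G_f^{\alpha}=\alpha G_p$ on $A_f$. Moreover, if in addition $n_{s-1}>0$, then $G_z=\alpha G_p$ on $A_0\setminus E_w$ and $-\infty$ on $E_w$; hence $G_f^{\alpha}=\alpha G_p$ on $A_0$.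
   Context: Let $f(z,w)=(p(z),q(z,w))$ be a holomorphic skew product defined on $\mathbb{C}^2$ or on $\{|z|<R\}\times\mathbb{C}$, where $R$ is so large that the attracting basin $A_p$ of $p$ at $0$ is relatively compact in $\{|z|<R\}$. Assume $p(z)=az^{\delta}+O(z^{\delta+1})$, $a\neq0$, $\delta\ge2$, and $q(z,w)=\sum_{i,j\ge0}b_{ij}z^iw^j$ with $b_{00}=b_{01}=0$. The Newton polygon $N(q)$ is the convex hull of $\bigcup_{b_{ij}\ne0}\{(x,y):x\ge i,\ y\ge j\}$, with vertices $(n_1,m_1),\dots,(n_s,m_s)$, $n_1<\dots<n_s$, $m_1>\dots>m_s$, $s>1$; $T_{s-1}$ is the $y$-intercept of the line through $(n_{s-1},m_{s-1})$ and $(n_s,m_s)$. Case 2 means $\delta\le T_{s-1}$; set $(\gamma,d)=(n_s,m_s)$, $l_1=(n_s-n_{s-1})/(m_{s-1}-m_s)$, and $\alpha=\gamma/(\delta-d)$ when $\delta\ne d$. Let $U=\{|z|<r,\ |w|<r|z|^{l_1}\}$ and $A_f=\bigcup_{n\ge0}f^{-n}(U)$. $A_0$ is the attracting basin of the origin; $E_w=\bigcup_{n\ge0}f^{-n}(\{w=0\})$. With $(z_n,w_n)=f^n(z,w)$ and $\lambda=\max\{\delta,d\}$: $G_p(z)=\lim_n\delta^{-n}\log|p^n(z)|$, $G_z^{\alpha}(w)=\lim_n d^{-n}\log(|w_n|/|z_n|^{\alpha})$, $G_z(w)=\lim_n\lambda^{-n}\log|w_n|$, $G_f(z,w)=\lim_n\lambda^{-n}\log\max\{|z_n|,|w_n|\}$,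 $G_f^{\alpha}(z,w)=\lim_n\lambda^{-n}\log\max\{|z_n|^{\alpha},|w_n|\}$. An equality of such a function on a set includes existence of the limit there.
   Formalization: In the case δ<d, the claims G_z=G_z^α and G_f=0 are proved on A_0 minus the fibres with p^n(z)=0 for some n: there G_f=-∞ (e.g. at the origin) and G_z^α involves 0^α with α<0. ''On E_w'' is read within A_0 (respectively A_f). *)

(* Defs.v *)
From Stdlib Require Import Reals List.
From Coquelicot Require Import Coquelicot.
Open Scope R_scope.

Definition logb (x : R) : Rbar :=
  if Rlt_dec 0 x then Finite (ln x) else m_infty.

(* x^a for x >= 0 and a > 0, with 0^a = 0 *)
Definition powR0 (x a : R) : R :=
  if Req_EM_T x 0 then 0 else Rpower x a.

Definition scaleb (c : R) (x : Rbar) : Rbar := Rbar_mult (Finite c) x.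

Definition Rbar_seq_lim (u : nat -> Rbar) (l : Rbar) : Prop :=
  match l with
  | Finite L => forall eps, 0 < eps -> exists N, forall n, (N <= n)%nat ->
                  exists x, u n = Finite x /\ Rabs (x - L) < eps
  | p_infty => forall M, exists N, forall n, (N <= n)%nat -> Rbar_lt (Finite M) (u n)
  | m_infty => forall M, exists N, forall n, (N <= n)%nat -> Rbar_lt (u n) (Finite M)
  end.

Definition Cdiff (g : C -> C) (z : C) : Prop := ex_derive (K := C_AbsRing) (V := C_NormedModule) g z.

Definition holo1 (Dz : C -> Prop) (g : C -> C) : Prop :=
  forall z, Dz z -> Cdiff g z.

(* holomorphic in two variables on D (open): continuous and holomorphic in each
   variable separately (equivalent to holomorphy by Osgood's lemma) *)
Definition holo2 (D : C -> C -> Prop) (g : C -> C -> C) : Prop :=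
  forall z w, D z w ->
    (forall eps, 0 < eps -> exists del, 0 < del /\ forall z' w',
        Cmod (z' - z) < del -> Cmod (w' - w) < del ->
        Cmod (g z' w' - g z w) < eps) /\
    Cdiff (fun z' => g z' w) z /\ Cdiff (fun w' => g z w') w.

Definition taylor2_at0 (g : C -> C -> C) (b : nat -> nat -> C) : Prop :=
  exists eps, 0 < eps /\ forall z w, Cmod z < eps -> Cmod w < eps ->
    (exists S : nat -> R,
        (forall i, is_series (fun j => Cmod (b i j) * Cmod z ^ i * Cmod w ^ j) (S i)) /\
        ex_series S) /\
    (exists T : nat -> C,
        (forall i, is_series (V := C_NormedModule) (fun j => Cmult (Cmult (b i j) (Cpow z i)) (Cpow w j)) (T i)) /\
        is_series (V := C_NormedModule) T (g z w)).

Definition pt := (R * R)%type.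

Definition conv_hull (S : pt -> Prop) (x : pt) : Prop :=
  exists l : list (R * pt)%type,
    List.Forall (fun c => 0 <= fst c /\ S (snd c)) l /\
    List.fold_right (fun c acc => fst c + acc) 0 l = 1 /\
    fst x = List.fold_right (fun c acc => fst c * fst (snd c) + acc) 0 l /\
    snd x = List.fold_right (fun c acc => fst c * snd (snd c) + acc) 0 l.

Definition newton_polygon (b : nat -> nat -> C) : pt -> Prop :=
  conv_hull (fun x => exists i j, b i j <> 0%C /\ INR i <= fst x /\ INR j <= snd x).

Definition extreme_pt (N : pt -> Prop) (x : pt) : Prop :=
  N x /\ forall a c t, N a -> N c -> 0 < t < 1 ->
    fst x = t * fst a + (1 - t) * fst c ->
    snd x = t * snd a + (1 - t) * snd c -> a = c.

Definition NP_vertices (b : nat -> nat -> C) (s : nat) (nv mv : nat -> nat) : Prop :=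
  (1 < s)%nat /\
  (forall k, (1 <= k)%nat -> (k < s)%nat -> (nv k < nv (S k))%nat /\ (mv (S k) < mv k)%nat) /\
  (forall x, extreme_pt (newton_polygon b) x <->
     exists k, (1 <= k <= s)%nat /\ x = (INR (nv k), INR (mv k))).

Definition y_intercept (n1 m1 n2 m2 : R) : R :=
  m2 - (m1 - m2) / (n2 - n1) * (0 - n2).

Definition skew (p : C -> C) (q : C -> C -> C) (x : C * C) : C * C :=
  (p (fst x), q (fst x) (snd x)).

Definition iterf (p : C -> C) (q : C -> C -> C) (n : nat) (x : C * C) : C * C :=
  Nat.iter n (skew p q) x.

Definition preim (D : C * C -> Prop) (p : C -> C) (q : C -> C -> C)
    (n : nat) (S : C * C -> Prop) (x : C * C) : Prop :=
  (forall k, (k <= n)%nat -> D (iterf p q k x)) /\ S (iterf p q n x).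

Definition basin0 (D : C * C -> Prop) (p : C -> C) (q : C -> C -> C) (x : C * C) : Prop :=
  (forall n, D (iterf p q n x)) /\
  is_lim_seq (fun n => Cmod (fst (iterf p q n x)) + Cmod (snd (iterf p q n x))) 0.

Definition basin_p (Dz : C -> Prop) (p : C -> C) (z : C) : Prop :=
  (forall n, Dz (Nat.iter n p z)) /\ is_lim_seq (fun n => Cmod (Nat.iter n p z)) 0.

Definition Gp_is (p : C -> C) (delta : nat) (z : C) (l : Rbar) : Prop :=
  Rbar_seq_lim (fun n => scaleb (/ INR delta ^ n) (logb (Cmod (Nat.iter n p z)))) l.

Definition Gza_is (p : C -> C) (q : C -> C -> C) (d : nat) (alpha : R) (x : C * C) (l : Rbar) : Prop :=
  Rbar_seq_lim (fun n => scaleb (/ INR d ^ n)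
     (logb (Cmod (snd (iterf p q n x)) / powR0 (Cmod (fst (iterf p q n x))) alpha))) l.

Definition Gz_is (p : C -> C) (q : C -> C -> C) (lam : nat) (x : C * C) (l : Rbar) : Prop :=
  Rbar_seq_lim (fun n => scaleb (/ INR lam ^ n) (logb (Cmod (snd (iterf p q n x))))) l.

Definition Gf_is (p : C -> C) (q : C -> C -> C) (lam : nat) (x : C * C) (l : Rbar) : Prop :=
  Rbar_seq_lim (fun n => scaleb (/ INR lam ^ n)
     (logb (Rmax (Cmod (fst (iterf p q n x))) (Cmod (snd (iterf p q n x)))))) l.

Definition Gfa_is (p : C -> C) (q : C -> C -> C) (lam : nat) (alpha : R) (x : C * C) (l : Rbar) : Prop :=
  Rbar_seq_lim (fun n => scaleb (/ INR lam ^ n)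
     (logb (Rmax (powR0 (Cmod (fst (iterf p q n x))) alpha) (Cmod (snd (iterf p q n x)))))) l.

(* Main.v *)
(* In the wedge |w| < r |z|^l1 the monomial b z^gamma w^d dominates q, because every other exponent
   (i, j) satisfies i + l1 j >= gamma + l1 d and j >= d.  There log |w_n| obeys, up to a bounded
   error, the linear recurrence Y' = d Y + gamma X with X = log |z_n| ~ L delta^n, and all the
   limits are read off from it.  Outside the wedge |q| <= K |w|^T.  If delta < T this makes |w_n|
   decay much faster than |z_n|^l1, so that every orbit of the basin with z_n <> 0 enters the
   wedge.  If delta = T and n_(s-1) > 0, the monomials of the last edge are divisible by z; for an
   orbit that stays outside, log (|w_n| / |z_n|^l1) is then o(delta^n), and alpha = l1.
   That w = 0 is invariant in the whole domain, not only near the origin, is the identity theorem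
   for q(., 0); it is obtained from Goursat's lemma in log-polar coordinates. *)

Require Import Defs.
From Stdlib Require Import List Wf_nat Compare_dec Reals Lra Lia Classical IndefiniteDescription.
From Coquelicot Require Import Coquelicot.
Open Scope R_scope.

(** * Goursat's lemma for closed one-forms *)

(** Two obstacles shape the proof. The Taylor series has infinitely many monomials, so domination by
    one of them cannot be read off from the vertices alone: every estimate of q is reduced to
    comparing single monomials with their values at a fixed radius rho, where the series of moduli
    has a finite sum. And for delta = T outside the wedge, |q| <= K |w|^T only gives c' <= delta c +
    C for c = log (|w| / |z|^l1), which does not make c negligible against delta^n. When every
    monomial of the last edge carries a factor z, the bound improves by |z| / |w|^(1/l1) = exp (- c
    / l1), and on the pure powers of w, which lie above the edge, by a factor |w|. Since log |w_n|
    and log |z_n| are both of order delta^n there, each gain is at most exp (- kap c) for some kap >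
    0 as long as c >= 0, and the multiplier drops to delta - kap. Zeros have no finite logarithm, so
    each of z_n and w_n is first shown to be eventually zero or eventually nonzero. *)

Definition frechet (f : R -> R -> R) (x y A B : R) : Prop :=
  forall eps, 0 < eps -> exists del, 0 < del /\ forall x' y',
    Rabs (x' - x) < del -> Rabs (y' - y) < del ->
    Rabs (f x' y' - f x y - A * (x' - x) - B * (y' - y))
      <= eps * (Rabs (x' - x) + Rabs (y' - y)).

(** The circulation of P dx + Q dy, anticlockwise, with opposite sides paired in one integral so
    that constant parts cancel pointwise. *)
Definition boundary_int (P Q : R -> R -> R) (a b c d : R) : R :=
  RInt (fun x => P x c - P x d) a b + RInt (fun y => Q b y - Q a y) c d.

Lemma frechet_continuous_l f x y A B :
  frechet f x y A B -> continuous (fun t => f t y) x.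
Proof.
  intros H. apply continuity_pt_filterlim.
  intros eps Heps.
  destruct (H 1 Rlt_0_1) as [del [Hd Hf]].
  exists (Rmin del (eps / (2 + Rabs A))).
  assert (HA := Rabs_pos A).
  split.
  { apply Rmin_glb_lt; [lra|]. apply Rdiv_lt_0_compat; lra. }
  intros t [_ Ht]. unfold dist, R_met, R_dist in *. simpl in *. unfold Rdist in *.
  assert (Ht1 := Rlt_le_trans _ _ _ Ht (Rmin_l _ _)).
  assert (Ht2 := Rlt_le_trans _ _ _ Ht (Rmin_r _ _)).
  specialize (Hf t y Ht1). rewrite Rminus_diag, Rabs_R0 in Hf.
  specialize (Hf Hd).
  apply (Rmult_lt_compat_r (2 + Rabs A)) in Ht2; [|lra].
  unfold Rdiv in Ht2. rewrite Rmult_assoc, Rinv_l in Ht2 by lra.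
  replace (f t y - f x y) with ((f t y - f x y - A * (t - x) - B * 0) + A * (t - x)) by ring.
  eapply Rle_lt_trans; [apply Rabs_triang|]. rewrite Rabs_mult.
  assert (Hp := Rabs_pos (t - x)). nra.
Qed.

Lemma frechet_swap f x y A B :
  frechet f x y A B -> frechet (fun u v => f v u) y x B A.
Proof.
  intros H eps Heps. destruct (H eps Heps) as [del [Hd Hf]].
  exists del; split; [exact Hd|]. intros u v Hu Hv.
  specialize (Hf v u Hv Hu).
  replace (f v u - f x y - B * (u - y) - A * (v - x)) with
    (f v u - f x y - A * (v - x) - B * (u - y)) by ring. lra.
Qed.

Section Goursat.
Variables (P Q Px Py Qy : R -> R -> R) (a0 b0 c0 d0 : R).
Hypothesis HP : forall x y, a0 <= x <= b0 -> c0 <= y <= d0 ->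
  frechet P x y (Px x y) (Py x y).
Hypothesis HQ : forall x y, a0 <= x <= b0 -> c0 <= y <= d0 ->
  frechet Q x y (Py x y) (Qy x y).

Let sub a b c d := a0 <= a /\ a <= b /\ b <= b0 /\ c0 <= c /\ c <= d /\ d <= d0.

Lemma ex_RInt_horizontal a b y : a0 <= a -> a <= b -> b <= b0 -> c0 <= y <= d0 ->
  ex_RInt (fun x => P x y) a b.
Proof.
  intros. apply (ex_RInt_continuous (V := R_CompleteNormedModule)). rewrite Rmin_left, Rmax_right by lra.
  intros z Hz. eapply frechet_continuous_l, HP; lra.
Qed.

Lemma ex_RInt_vertical c d x : c0 <= c -> c <= d -> d <= d0 -> a0 <= x <= b0 ->
  ex_RInt (fun y => Q x y) c d.
Proof.
  intros. apply (ex_RInt_continuous (V := R_CompleteNormedModule)). rewrite Rmin_left, Rmax_right by lra.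
  intros z Hz. eapply frechet_continuous_l with (f := fun u v => Q v u), frechet_swap, HQ; lra.
Qed.

Lemma boundary_int_expand a b c d : sub a b c d ->
  boundary_int P Q a b c d =
  RInt (fun x => P x c) a b - RInt (fun x => P x d) a b
  + (RInt (fun y => Q b y) c d - RInt (fun y => Q a y) c d).
Proof.
  intros (H1 & H2 & H3 & H4 & H5 & H6). unfold boundary_int.
  f_equal.
  - apply (RInt_minus (fun x => P x c) (fun x => P x d)); apply ex_RInt_horizontal; lra.
  - apply (RInt_minus (fun y => Q b y) (fun y => Q a y)); apply ex_RInt_vertical; lra.
Qed.

Lemma boundary_int_split a b c d m n : sub a b c d -> a <= m <= b -> c <= n <= d ->
  boundary_int P Q a b c d =
  boundary_int P Q a m c n + boundary_int P Q m b c n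
  + boundary_int P Q a m n d + boundary_int P Q m b n d.
Proof.
  intros (H1 & H2 & H3 & H4 & H5 & H6) Hm Hn.
  assert (CH : forall y, c0 <= y <= d0 ->
    RInt (fun x => P x y) a b = RInt (fun x => P x y) a m + RInt (fun x => P x y) m b).
  { intros y Hy. symmetry. apply (RInt_Chasles (fun x => P x y));
    apply ex_RInt_horizontal; lra. }
  assert (CV : forall x, a0 <= x <= b0 ->
    RInt (fun y => Q x y) c d = RInt (fun y => Q x y) c n + RInt (fun y => Q x y) n d).
  { intros y Hy. symmetry. apply (RInt_Chasles (fun x => Q y x));
    apply ex_RInt_vertical; lra. }
  rewrite !boundary_int_expand by (unfold sub; lra).
  rewrite (CH c), (CH d), (CV a), (CV b) by lra. ring.
Qed.


(** Closedness is encoded by the shared coefficient [Py], at once the y-derivative of P and the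
    x-derivative of Q: the affine part of the form at (u, v) then has zero circulation. Only the
    remainders count, each at most eps times the half perimeter. *)
Lemma boundary_int_small a b c d u v eps :
  0 < eps -> sub a b c d -> a <= u <= b -> c <= v <= d ->
  (forall x y, a <= x <= b -> c <= y <= d ->
    Rabs (P x y - P u v - Px u v * (x - u) - Py u v * (y - v))
      <= eps * (Rabs (x - u) + Rabs (y - v))) ->
  (forall x y, a <= x <= b -> c <= y <= d ->
    Rabs (Q x y - Q u v - Py u v * (x - u) - Qy u v * (y - v))
      <= eps * (Rabs (x - u) + Rabs (y - v))) ->
  Rabs (boundary_int P Q a b c d) <= 2 * eps * ((b - a) + (d - c)) ^ 2.
Proof.
  intros He (H1 & H2 & H3 & H4 & H5 & H6) Hu Hv HPe HQe.
  set (h := (b - a) + (d - c)).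
  assert (HPb : forall x y, a <= x <= b -> c <= y <= d ->
    Rabs (P x y - P u v - Px u v * (x - u) - Py u v * (y - v)) <= eps * h).
  { intros x y Hx Hy. eapply Rle_trans; [apply HPe; lra|].
    apply Rmult_le_compat_l; [lra|]. unfold h.
    apply Rplus_le_compat; apply Rabs_le; lra. }
  assert (HQb : forall x y, a <= x <= b -> c <= y <= d ->
    Rabs (Q x y - Q u v - Py u v * (x - u) - Qy u v * (y - v)) <= eps * h).
  { intros x y Hx Hy. eapply Rle_trans; [apply HQe; lra|].
    apply Rmult_le_compat_l; [lra|]. unfold h.
    apply Rplus_le_compat; apply Rabs_le; lra. }
  set (B := Py u v) in *.
  (* The shifts B (d - c) here and - B (b - a) in [E2] remove the affine parts. After integration
     they are B times the area with opposite signs and cancel in the sum. *)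
  assert (E1 : Rabs (RInt (fun x => P x c - P x d + B * (d - c)) a b) <= (b - a) * (2 * eps * h)).
  { apply abs_RInt_le_const; [lra| |].
    - apply (ex_RInt_plus (V := R_CompleteNormedModule) (fun x => P x c - P x d) (fun _ => B * (d - c))).
      + apply (ex_RInt_minus (V := R_CompleteNormedModule) (fun x => P x c) (fun x => P x d));
          apply ex_RInt_horizontal; lra.
      + apply ex_RInt_const.
    - intros x Hx.
      assert (G1 := HPb x c ltac:(lra) ltac:(lra)).
      assert (G2 := HPb x d ltac:(lra) ltac:(lra)).
      apply Rabs_le_between in G1, G2. apply Rabs_le_between. lra. }
  assert (E2 : Rabs (RInt (fun y => Q b y - Q a y - B * (b - a)) c d) <= (d - c) * (2 * eps * h)).
  { apply abs_RInt_le_const; [lra| |].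
    - apply (ex_RInt_minus (V := R_CompleteNormedModule) (fun y => Q b y - Q a y) (fun _ => B * (b - a))).
      + apply (ex_RInt_minus (V := R_CompleteNormedModule) (fun y => Q b y) (fun y => Q a y));
          apply ex_RInt_vertical; lra.
      + apply ex_RInt_const.
    - intros y Hy.
      assert (G1 := HQb a y ltac:(lra) ltac:(lra)).
      assert (G2 := HQb b y ltac:(lra) ltac:(lra)).
      apply Rabs_le_between in G1, G2. apply Rabs_le_between. lra. }
  assert (F1 : RInt (fun x => P x c - P x d + B * (d - c)) a b =
    RInt (fun x => P x c - P x d) a b + (b - a) * (B * (d - c))).
  { rewrite <- (RInt_const (V := R_CompleteNormedModule) a b (B * (d - c))) at 1.
    apply (RInt_plus (V := R_CompleteNormedModule) (fun x => P x c - P x d) (fun _ => B * (d - c))).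
    - apply (ex_RInt_minus (V := R_CompleteNormedModule) (fun x => P x c) (fun x => P x d));
          apply ex_RInt_horizontal; lra.
    - apply ex_RInt_const. }
  assert (F2 : RInt (fun y => Q b y - Q a y - B * (b - a)) c d =
    RInt (fun y => Q b y - Q a y) c d - (d - c) * (B * (b - a))).
  { rewrite <- (RInt_const (V := R_CompleteNormedModule) c d (B * (b - a))) at 1.
    apply (RInt_minus (V := R_CompleteNormedModule) (fun y => Q b y - Q a y) (fun _ => B * (b - a))).
    - apply (ex_RInt_minus (V := R_CompleteNormedModule) (fun y => Q b y) (fun y => Q a y));
          apply ex_RInt_vertical; lra.
    - apply ex_RInt_const. }
  rewrite F1 in E1. rewrite F2 in E2. unfold boundary_int.
  apply Rabs_le_between in E1, E2. apply Rabs_le_between.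
  assert (E3 : 2 * eps * h ^ 2 = (b - a) * (2 * eps * h) + (d - c) * (2 * eps * h))
    by (unfold h; ring).
  rewrite E3. lra.
Qed.

(** With differentiability at points only, Green's formula is replaced by quadrisection. The bound
    is quadratic in the half perimeter, so if a rectangle violates it, one of its four quarters does
    too; the nested rectangles shrink to a point where differentiability is contradicted. *)
Lemma goursat_bound eps : a0 <= b0 -> c0 <= d0 -> 0 < eps ->
  Rabs (boundary_int P Q a0 b0 c0 d0) <= eps * ((b0 - a0) + (d0 - c0)) ^ 2.
Proof.
  intros Hab Hcd He. apply Rnot_lt_le. intros Hbad.
  set (W := b0 - a0) in *. set (H := d0 - c0) in *.
  set (good := fun (n : nat) (x : R * R) =>
    sub (fst x) (fst x + W / 2 ^ n) (snd x) (snd x + H / 2 ^ n) /\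
    eps * ((W + H) / 2 ^ n) ^ 2 <
      Rabs (boundary_int P Q (fst x) (fst x + W / 2 ^ n) (snd x) (snd x + H / 2 ^ n))).
  assert (HW : 0 <= W) by (unfold W; lra). assert (HH : 0 <= H) by (unfold H; lra).
  assert (P2 : forall n, 0 < 2 ^ n) by (intros; apply pow_lt; lra).
  assert (WS : forall X n, X / 2 ^ n = 2 * (X / 2 ^ S n)).
  { intros X n. simpl. field. specialize (P2 n). lra. }
  assert (Wpos : forall X n, 0 <= X -> 0 <= X / 2 ^ n).
  { intros X n HX. apply Rmult_le_pos; [exact HX|]. left. apply Rinv_0_lt_compat, P2. }
  (* [good] marks rectangles that violate the bound. The implication under the existential makes the
     relation total, as [functional_choice] demands; (0, 0) is a junk value for the other
     rectangles. *)
  assert (step : forall nx : nat * (R * R), exists y : R * R, good (fst nx) (snd nx) ->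
    good (S (fst nx)) y /\
    (fst (snd nx) <= fst y /\ fst y + W / 2 ^ S (fst nx) <= fst (snd nx) + W / 2 ^ fst nx) /\
    (snd (snd nx) <= snd y /\ snd y + H / 2 ^ S (fst nx) <= snd (snd nx) + H / 2 ^ fst nx)).
  { intros [n [x y]]. simpl fst; simpl snd.
    destruct (classic (good n (x, y))) as [Hg|Hg]; [|exists (0, 0); intros Hc; contradiction].
    destruct Hg as [(H1 & H2 & H3 & H4 & H5 & H6) Hg]. cbn [fst snd] in *.
    assert (HWn := Wpos W (S n) HW). assert (HHn := Wpos H (S n) HH).
    rewrite (WS (W + H) n), (WS W n), (WS H n) in *.
    set (w := W / 2 ^ S n) in *. set (h := H / 2 ^ S n) in *.
    set (e := (W + H) / 2 ^ S n) in *.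
    rewrite (boundary_int_split x (x + 2 * w) y (y + 2 * h) (x + w) (y + h)) in Hg
      by (unfold sub; lra).
    apply NNPP. intros Hno.
    assert (K : forall x' y', x <= x' <= x + w -> y <= y' <= y + h ->
      Rabs (boundary_int P Q x' (x' + w) y' (y' + h)) <= eps * e ^ 2).
    { intros x' y' Hx' Hy'. apply Rnot_lt_le. intros Hlt. apply Hno.
      exists (x', y'). intros _. unfold good. cbn [fst snd].
      fold w h e. unfold sub. split; [split; [lra|exact Hlt]|repeat split; lra]. }
    assert (K1 := K x y ltac:(lra) ltac:(lra)).
    assert (K2 := K (x + w) y ltac:(lra) ltac:(lra)).
    assert (K3 := K x (y + h) ltac:(lra) ltac:(lra)).
    assert (K4 := K (x + w) (y + h) ltac:(lra) ltac:(lra)).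
    replace (x + w + w) with (x + 2 * w) in * by ring.
    replace (y + h + h) with (y + 2 * h) in * by ring.
    apply (Rlt_irrefl (eps * (2 * e) ^ 2)).
    eapply Rlt_le_trans; [exact Hg|].
    apply Rabs_le_between in K1, K2, K3, K4. apply Rabs_le_between.
    replace ((2 * e) ^ 2) with (4 * e ^ 2) by ring. lra. }
  apply functional_choice in step. destruct step as [F HF].
  set (x := fix x n := match n with O => (a0, c0) | S m => F (m, x m) end).
  assert (Hx : forall n, good n (x n)).
  { induction n.
    - unfold good, sub; simpl. replace (W / 1) with W by field. replace (H / 1) with H by field.
      replace ((W + H) / 1) with (W + H) by field.
      replace (a0 + W) with b0 by (unfold W; ring). replace (c0 + H) with d0 by (unfold H; ring).
      simpl in Hbad. repeat split; lra.
    - apply (HF (n, x n)). exact IHn. }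
  assert (Hx1 : forall n, fst (x n) <= fst (x (S n)) /\
    fst (x (S n)) + W / 2 ^ S n <= fst (x n) + W / 2 ^ n).
  { intros n. apply (HF (n, x n)). apply Hx. }
  assert (Hx2 : forall n, snd (x n) <= snd (x (S n)) /\
    snd (x (S n)) + H / 2 ^ S n <= snd (x n) + H / 2 ^ n).
  { intros n. apply (HF (n, x n)). apply Hx. }
  assert (Lim : forall (u : nat -> R) X, 0 <= X ->
    (forall n, u n <= u (S n) /\ u (S n) + X / 2 ^ S n <= u n + X / 2 ^ n) ->
    exists l, forall n, u n <= l <= u n + X / 2 ^ n).
  { intros u X HX Hu.
    assert (Dec : forall n m, u n <= u (n + m)%nat /\ u (n + m)%nat + X / 2 ^ (n + m) <= u n + X / 2 ^ n).
    { intros n m. induction m.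
      - rewrite Nat.add_0_r. lra.
      - rewrite Nat.add_succ_r. specialize (Hu (n + m)%nat). lra. }
    destruct (ex_finite_lim_seq_incr u (u O + X)) as [l Hl].
    - intros n. apply Hu.
    - intros n. specialize (Dec O n). simpl in Dec. assert (Z := Wpos X n HX). lra.
    - exists l. intros n. split.
      + apply (is_lim_seq_incr_compare u); [exact Hl|apply Hu].
      + apply (is_lim_seq_le_loc u (fun _ => u n + X / 2 ^ n) l (u n + X / 2 ^ n));
          [|exact Hl|apply is_lim_seq_const].
        exists n. intros m Hm. specialize (Dec n (m - n)%nat).
        replace (n + (m - n))%nat with m in Dec by lia. assert (Z := Wpos X m HX). lra. }
  destruct (Lim (fun n => fst (x n)) W HW Hx1) as [u Hu].
  destruct (Lim (fun n => snd (x n)) H HH Hx2) as [v Hv].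
  assert (U0 := Hu O). assert (V0 := Hv O). simpl in U0, V0.
  assert (Hu0 : a0 <= u <= b0) by (unfold W in U0; lra).
  assert (Hv0 : c0 <= v <= d0) by (unfold H in V0; lra).
  (* [boundary_int_small] doubles the tolerance, hence eps / 2. *)
  destruct (HP u v Hu0 Hv0 (eps / 2) ltac:(lra)) as [d1 [Hd1 HP1]].
  destruct (HQ u v Hu0 Hv0 (eps / 2) ltac:(lra)) as [d2 [Hd2 HQ1]].
  assert (Hd : 0 < Rmin d1 d2) by (apply Rmin_glb_lt; lra).
  destruct (pow_lt_1_zero (/ 2) ltac:(rewrite Rabs_right; lra) (Rmin d1 d2 / (W + H + 1)))
    as [n Hn].
  { apply Rdiv_lt_0_compat; lra. }
  specialize (Hn n (Nat.le_refl n)).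
  rewrite pow_inv, Rabs_right in Hn by (apply Rle_ge; left; apply Rinv_0_lt_compat, P2).
  assert (Hsm : forall X, 0 <= X <= W + H -> X / 2 ^ n < Rmin d1 d2).
  { intros X HX. apply Rle_lt_trans with ((W + H + 1) * / 2 ^ n).
    - unfold Rdiv. apply Rmult_le_compat_r; [left; apply Rinv_0_lt_compat, P2|lra].
    - apply (Rmult_lt_compat_l (W + H + 1)) in Hn; [|lra].
      eapply Rlt_le_trans; [exact Hn|]. right. field. lra. }
  assert (SW := Hsm W ltac:(lra)). assert (SH := Hsm H ltac:(lra)).
  destruct (Hx n) as [Hs Hg].
  assert (M1 := Rmin_l d1 d2). assert (M2 := Rmin_r d1 d2).
  assert (Un := Hu n). assert (Vn := Hv n). cbv beta in Un, Vn.
  apply (Rlt_not_le _ _ Hg).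
  eapply Rle_trans.
  - apply (boundary_int_small _ _ _ _ u v (eps / 2)); try lra; try assumption.
    + intros x' y' Hx' Hy'. apply HP1; apply Rabs_def1; lra.
    + intros x' y' Hx' Hy'. apply HQ1; apply Rabs_def1; lra.
  - right. field. specialize (P2 n). lra.
Qed.

Lemma goursat : a0 <= b0 -> c0 <= d0 -> boundary_int P Q a0 b0 c0 d0 = 0.
Proof.
  intros Hab Hcd.
  set (h := ((b0 - a0) + (d0 - c0)) ^ 2).
  assert (Hh : 0 <= h) by apply pow2_ge_0.
  apply Rabs_eq_0, Rle_antisym; [|apply Rabs_pos].
  apply le_epsilon. intros eps He.
  eapply Rle_trans; [apply (goursat_bound (eps / (h + 1)) Hab Hcd)|].
  - apply Rdiv_lt_0_compat; lra.
  - fold h. apply Rle_trans with (eps / (h + 1) * (h + 1)).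
    + apply Rmult_le_compat_l; [|lra]. left. apply Rdiv_lt_0_compat; lra.
    + right. field. lra.
Qed.
End Goursat.

(** * The identity theorem *)

Definition cderiv (g : C -> C) (z D : C) : Prop :=
  forall eps, 0 < eps -> exists del, 0 < del /\ forall w, Cmod (w - z) < del ->
    Cmod (g w - g z - D * (w - z)) <= eps * Cmod (w - z).

Lemma Cdiff_cderiv g z : Cdiff g z -> exists D, cderiv g z D.
Proof.
  intros [D [_ HD]]. exists D. intros eps Heps.
  destruct (HD z (fun P HP => HP) (mkposreal eps Heps)) as [del Hdel].
  exists del. split; [apply cond_pos|]. intros w Hw.
  specialize (Hdel w Hw).
  replace (g w - g z - D * (w - z))%C with
    (minus (minus (g w) (g z)) (scal (V := C_NormedModule) (minus w z) D)); [exact Hdel|].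
  change (((g w + - g z) + - ((w + - z) * D))%C = (g w - g z - D * (w - z))%C). ring.
Qed.

(** The product and chain rules are used over [AbsRing_NormedModule], whereas [Cdiff] is phrased
    over [C_NormedModule]; the epsilon-delta form mediates between the two. *)
Lemma cderiv_is_derive g z D :
  cderiv g z D <-> is_derive (V := AbsRing_NormedModule C_AbsRing) g z D.
Proof.
  split.
  - intros H. split; [apply is_linear_scal_l|].
    intros y Hy. apply (is_filter_lim_locally_unique (V := AbsRing_NormedModule C_AbsRing)) in Hy. subst y.
    intros [eps Heps]. destruct (H eps Heps) as [del [Hd Hw]].
    exists (mkposreal del Hd). intros w Hb. specialize (Hw w Hb).
    replace (g w - g z - D * (w - z))%C with
      (minus (minus (g w) (g z)) (scal (V := AbsRing_NormedModule C_AbsRing) (minus w z) D)) in Hw;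
      [exact Hw|].
    change (((g w + - g z) + - ((w + - z) * D))%C = (g w - g z - D * (w - z))%C). ring.
  - intros [_ HD] eps Heps.
    destruct (HD z (fun P HP => HP) (mkposreal eps Heps)) as [del Hdel].
    exists del. split; [apply cond_pos|]. intros w Hw.
    specialize (Hdel w Hw).
    replace (g w - g z - D * (w - z))%C with
      (minus (minus (g w) (g z)) (scal (V := AbsRing_NormedModule C_AbsRing) (minus w z) D));
      [exact Hdel|].
    change (((g w + - g z) + - ((w + - z) * D))%C = (g w - g z - D * (w - z))%C). ring.
Qed.

Lemma cderiv_mult f g z Df Dg : cderiv f z Df -> cderiv g z Dg ->
  cderiv (fun w => f w * g w)%C z (Df * g z + f z * Dg)%C.
Proof.
  rewrite !cderiv_is_derive. intros Hf Hg.
  apply (is_derive_mult (K := C_AbsRing) f g z Df Dg Hf Hg). intros; apply Cmult_comm.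
Qed.

Lemma cderiv_comp f g z Df Dg : cderiv f (g z) Df -> cderiv g z Dg ->
  cderiv (fun w => f (g w)) z (Df * Dg)%C.
Proof.
  rewrite !cderiv_is_derive. intros Hf Hg.
  replace (Df * Dg)%C with (scal (V := AbsRing_NormedModule C_AbsRing) Dg Df) by apply Cmult_comm.
  apply (is_derive_comp (K := C_AbsRing) (V := AbsRing_NormedModule C_AbsRing) f g z Df Dg Hf Hg).
Qed.

Lemma cderiv_affine a b z : cderiv (fun w => a * w + b)%C z a.
Proof.
  intros eps He. exists 1. split; [lra|]. intros w _.
  replace (a * w + b - (a * z + b) - a * (w - z))%C with (RtoC 0) by ring.
  rewrite Cmod_0. apply Rmult_le_pos; [lra|apply Cmod_ge_0].
Qed.

Lemma cderiv_locally_zero (g : C -> C) (z : C) r : 0 < r -> (forall w : C, Cmod (w - z) < r -> g w = 0%C) ->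
  cderiv g z 0%C.
Proof.
  intros Hr H eps He. exists r. split; [exact Hr|]. intros w Hw.
  rewrite (H w Hw), (H z).
  - replace (0 - 0 - 0 * (w - z))%C with (RtoC 0) by ring.
    rewrite Cmod_0. apply Rmult_le_pos; [lra|apply Cmod_ge_0].
  - replace (z - z)%C with (RtoC 0) by ring. rewrite Cmod_0. exact Hr.
Qed.

Lemma Cmod_triangle_inv x y : Cmod x - Cmod y <= Cmod (x - y).
Proof.
  assert (H := Cmod_triangle (x - y) y).
  replace (x - y + y)%C with x in H by ring. lra.
Qed.

Lemma cderiv_inv (z : C) : z <> 0%C -> cderiv Cinv z (- (/ z * / z))%C.
Proof.
  intros Hz eps He. assert (Hm := proj1 (Cmod_gt_0 z) Hz).
  exists (Rmin (Cmod z / 2) (eps * Cmod z ^ 3 / 2)). split.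
  { apply Rmin_glb_lt; [lra|]. apply Rdiv_lt_0_compat; [|lra].
    apply Rmult_lt_0_compat; [lra|]. apply pow_lt; lra. }
  intros w Hw.
  assert (W1 := Rlt_le_trans _ _ _ Hw (Rmin_l _ _)).
  assert (W2 := Rlt_le_trans _ _ _ Hw (Rmin_r _ _)).
  assert (Hwm : Cmod z / 2 <= Cmod w).
  { assert (T := Cmod_triangle_inv z w).
    replace (z - w)%C with (- (w - z))%C in T by ring. rewrite Cmod_opp in T. lra. }
  assert (Hw0 : w <> 0%C) by (apply Cmod_gt_0; lra).
  replace (/ w - / z - - (/ z * / z) * (w - z))%C with ((w - z) * (w - z) * / (z * z * w))%C
    by (field; split; assumption).
  rewrite !Cmod_mult, Cmod_inv, !Cmod_mult by (repeat apply Cmult_neq_0; assumption).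
  assert (Hp := Cmod_ge_0 (w - z)).
  rewrite Rmult_assoc, (Rmult_comm eps). apply Rmult_le_compat_l; [exact Hp|].
  apply Rle_trans with (Cmod (w - z) * / (Cmod z * Cmod z * (Cmod z / 2))).
  - apply Rmult_le_compat_l; [exact Hp|]. apply Rinv_le_contravar.
    + repeat apply Rmult_lt_0_compat; lra.
    + apply Rmult_le_compat_l; [|lra]. nra.
  - apply Rle_trans with (eps * Cmod z ^ 3 / 2 * / (Cmod z * Cmod z * (Cmod z / 2))).
    + apply Rmult_le_compat_r; [|lra]. left. apply Rinv_0_lt_compat.
      repeat apply Rmult_lt_0_compat; lra.
    + right. field. lra.
Qed.

Lemma cderiv_pow (g : C -> C) (z D : C) (k : nat) : cderiv g z D -> exists D', cderiv (fun w => Cpow (g w) k) z D'.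
Proof.
  intros H. induction k as [|k [D' IH]].
  - exists 0%C. simpl.
    intros eps He. exists 1. split; [lra|]. intros w _.
    replace (1 - 1 - 0 * (w - z))%C with (RtoC 0) by ring.
    rewrite Cmod_0. apply Rmult_le_pos; [lra|apply Cmod_ge_0].
  - eexists. exact (cderiv_mult _ _ _ _ _ H IH).
Qed.

(** * The complex exponential and means over circles *)

Definition cexp (w : C) : C := (exp (fst w) * cos (snd w), exp (fst w) * sin (snd w)).

Lemma cexp_plus u v : cexp (u + v) = (cexp u * cexp v)%C.
Proof.
  unfold cexp, Cplus, Cmult; simpl. rewrite exp_plus, cos_plus, sin_plus.
  f_equal; ring.
Qed.

Lemma Cmod_cexp w : Cmod (cexp w) = exp (fst w).
Proof.
  unfold Cmod, cexp, fst, snd. destruct w as [x y].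
  assert (H := sin2_cos2 y). unfold Rsqr in H.
  replace ((exp x * cos y) ^ 2 + (exp x * sin y) ^ 2) with (exp x ^ 2).
  - apply sqrt_pow2. left. apply exp_pos.
  - transitivity (exp x ^ 2 * (sin y * sin y + cos y * cos y)); [rewrite H; ring|ring].
Qed.

Lemma derivable_pt_lim_bound f x l eps : derivable_pt_lim f x l -> 0 < eps ->
  exists del, 0 < del /\ forall h, Rabs h < del -> Rabs (f (x + h) - f x - l * h) <= eps * Rabs h.
Proof.
  intros H He. destruct (H eps He) as [del Hd]. exists del. split; [apply cond_pos|].
  intros h Hh. destruct (Req_dec h 0) as [->|Hn].
  - rewrite Rplus_0_r. replace (f x - f x - l * 0) with 0 by ring. rewrite Rabs_R0. lra.
  - specialize (Hd h Hn Hh).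
    replace (f (x + h) - f x - l * h) with (((f (x + h) - f x) / h - l) * h) by (field; exact Hn).
    rewrite Rabs_mult. apply Rmult_le_compat_r; [apply Rabs_pos|lra].
Qed.

Lemma Rabs_Re_le_Cmod (x : C) : Rabs (fst x) <= Cmod x.
Proof. eapply Rle_trans; [apply Rmax_l|apply Rmax_Cmod]. Qed.

Lemma Rabs_Im_le_Cmod (x : C) : Rabs (snd x) <= Cmod x.
Proof. eapply Rle_trans; [apply Rmax_r|apply Rmax_Cmod]. Qed.

Lemma Cmod_le_Rabs (x : C) : Cmod x <= Rabs (fst x) + Rabs (snd x).
Proof.
  destruct x as [x y]; simpl.
  replace (x, y) with (RtoC x + Ci * RtoC y)%C
    by (unfold Cplus, Cmult, RtoC, Ci; simpl; f_equal; ring).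
  eapply Rle_trans; [apply Cmod_triangle|].
  rewrite Cmod_mult, Cmod_Ci, !Cmod_R. lra.
Qed.

Lemma cderiv_cexp_0 : cderiv cexp 0 1.
Proof.
  (* The two components of the remainder will be at most 4 and 5 times eps |w|, so 12 leaves room;
     the bound eps <= 1 is what gives |exp x| <= 3. *)
  intros eps0 He0. set (eps := Rmin 1 (eps0 / 12)).
  assert (He : 0 < eps) by (apply Rmin_glb_lt; lra).
  assert (He1 : eps <= 1) by apply Rmin_l.
  assert (He2 : eps <= eps0 / 12) by apply Rmin_r.
  destruct (derivable_pt_lim_bound exp 0 _ eps (derivable_pt_lim_exp 0) He) as [d1 [Hd1 E1]].
  destruct (derivable_pt_lim_bound sin 0 _ eps (derivable_pt_lim_sin 0) He) as [d2 [Hd2 E2]].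
  destruct (derivable_pt_lim_bound cos 0 _ eps (derivable_pt_lim_cos 0) He) as [d3 [Hd3 E3]].
  exists (Rmin (Rmin d1 d2) (Rmin d3 eps)). split.
  { repeat apply Rmin_glb_lt; lra. }
  intros w Hw. replace (w - 0)%C with w in * by ring.
  assert (B1 := Rlt_le_trans _ _ _ Hw (Rmin_l _ _)).
  assert (B2 := Rlt_le_trans _ _ _ Hw (Rmin_r _ _)).
  assert (C1 := Rlt_le_trans _ _ _ B1 (Rmin_l _ _)).
  assert (C2 := Rlt_le_trans _ _ _ B1 (Rmin_r _ _)).
  assert (C3 := Rlt_le_trans _ _ _ B2 (Rmin_l _ _)).
  assert (C4 := Rlt_le_trans _ _ _ B2 (Rmin_r _ _)).
  assert (X := Rabs_Re_le_Cmod w). assert (Y := Rabs_Im_le_Cmod w).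
  set (m := Cmod w) in *. destruct w as [x y]. simpl in X, Y.
  assert (Hem : forall r, r <= m -> eps * r <= eps * m) by (intros; apply Rmult_le_compat_l; lra).
  assert (HX := Hem _ X). assert (HY := Hem _ Y).
  specialize (E1 x ltac:(lra)). specialize (E2 y ltac:(lra)). specialize (E3 y ltac:(lra)).
  rewrite Rplus_0_l, ?exp_0, ?sin_0, ?cos_0 in E1. rewrite Rplus_0_l, ?sin_0, ?cos_0 in E2.
  rewrite Rplus_0_l, ?sin_0, ?cos_0 in E3.
  assert (Xp := Rabs_pos x). assert (Yp := Rabs_pos y).
  assert (Hex : Rabs (exp x) <= 3).
  { replace (exp x) with ((exp x - 1 - 1 * x) + (1 + x)) by ring.
    eapply Rle_trans; [apply Rabs_triang|].
    assert (T := Rabs_triang 1 x). rewrite Rabs_R1 in T.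
    assert (eps * Rabs x <= 1 * Rabs x) by (apply Rmult_le_compat_r; lra). lra. }
  assert (Hex1 : Rabs (exp x - 1) <= 2 * m).
  { replace (exp x - 1) with ((exp x - 1 - 1 * x) + x) by ring.
    eapply Rle_trans; [apply Rabs_triang|].
    assert (eps * Rabs x <= 1 * Rabs x) by (apply Rmult_le_compat_r; lra). lra. }
  unfold cexp; simpl. rewrite exp_0, cos_0, sin_0.
  eapply Rle_trans; [apply Cmod_le_Rabs|]. simpl.
  assert (A1 : Rabs (exp x * cos y - 1 - x) <= 4 * (eps * m)).
  { replace (exp x * cos y - 1 - x) with ((exp x - 1 - 1 * x) + exp x * (cos y - 1 - - 0 * y)) by ring.
    eapply Rle_trans; [apply Rabs_triang|]. rewrite Rabs_mult.
    assert (Rabs (exp x) * Rabs (cos y - 1 - - 0 * y) <= 3 * (eps * m)).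
    { apply Rmult_le_compat; try apply Rabs_pos; [exact Hex|]. lra. }
    lra. }
  assert (A2 : Rabs (exp x * sin y - y) <= 5 * (eps * m)).
  { replace (exp x * sin y - y) with (exp x * (sin y - 0 - 1 * y) + (exp x - 1) * y) by ring.
    eapply Rle_trans; [apply Rabs_triang|]. rewrite !Rabs_mult.
    assert (Rabs (exp x) * Rabs (sin y - 0 - 1 * y) <= 3 * (eps * m)).
    { apply Rmult_le_compat; try apply Rabs_pos; [exact Hex|]. lra. }
    assert (Rabs (exp x - 1) * Rabs y <= 2 * (eps * m)).
    { apply Rle_trans with (2 * eps * m); [|lra]. apply Rmult_le_compat; try apply Rabs_pos; lra. }
    lra. }
  assert (Hm : 0 <= m) by apply Cmod_ge_0.
  match goal with |- Rabs ?a + Rabs ?b <= _ =>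
    replace a with (exp x * cos y - 1 - x) by ring;
    replace b with (exp x * sin y - y) by ring end.
  nra.
Qed.

Lemma cderiv_cexp z : cderiv cexp z (cexp z).
Proof.
  intros eps He. assert (Hp := exp_pos (fst z)).
  destruct (cderiv_cexp_0 (eps / exp (fst z))) as [del [Hd H]].
  { apply Rdiv_lt_0_compat; lra. }
  exists del. split; [exact Hd|]. intros w Hw.
  specialize (H (w - z)%C). replace (w - z - 0)%C with (w - z)%C in H by ring.
  specialize (H Hw).
  replace (cexp w) with (cexp z * cexp (w - z))%C by (rewrite <- cexp_plus; f_equal; ring).
  replace (cexp 0) with (RtoC 1) in H
    by (unfold cexp, RtoC; simpl; rewrite exp_0, cos_0, sin_0; f_equal; ring).
  replace (cexp z * cexp (w - z) - cexp z - cexp z * (w - z))%C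
    with (cexp z * (cexp (w - z) - 1 - 1 * (w - z)))%C by ring.
  rewrite Cmod_mult, Cmod_cexp.
  apply (Rmult_le_compat_l (exp (fst z))) in H; [|lra].
  eapply Rle_trans; [exact H|]. right. field. lra.
Qed.

(** The Cauchy-Riemann equations: the y-derivative of Im K equals the x-derivative of Re K, so that
    Im K dx + Re K dy is a closed form to which [goursat] applies. *)
Lemma cderiv_frechet K x y D : cderiv K (x, y) D ->
  frechet (fun s t => fst (K (s, t))) x y (fst D) (- snd D) /\
  frechet (fun s t => snd (K (s, t))) x y (snd D) (fst D).
Proof.
  intros H.
  assert (G : forall eps, 0 < eps -> exists del, 0 < del /\ forall x' y',
    Rabs (x' - x) < del -> Rabs (y' - y) < del ->
    Cmod (K (x', y') - K (x, y) - D * ((x', y') - (x, y)))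
      <= eps * (Rabs (x' - x) + Rabs (y' - y))).
  { intros eps He. destruct (H eps He) as [del [Hd Hw]].
    exists (del / 2). split; [lra|]. intros x' y' Hx Hy.
    assert (Hm : Cmod ((x', y') - (x, y)) <= Rabs (x' - x) + Rabs (y' - y))
      by apply (Cmod_le_Rabs ((x', y') - (x, y))%C).
    eapply Rle_trans; [apply Hw; lra|]. apply Rmult_le_compat_l; lra. }
  split; intros eps He; destruct (G eps He) as [del [Hd Hw]]; exists del; (split; [exact Hd|]);
    intros x' y' Hx Hy; (eapply Rle_trans; [|apply (Hw x' y' Hx Hy)]).
  - eapply Rle_trans; [|apply Rabs_Re_le_Cmod]. right. f_equal.
    destruct D; simpl. ring.
  - eapply Rle_trans; [|apply Rabs_Im_le_Cmod]. right. f_equal.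
    destruct D; simpl. ring.
Qed.

Lemma cderiv_continuous_0 H D eta : cderiv H 0 D -> 0 < eta ->
  exists del, 0 < del /\ forall w, Cmod w < del -> Cmod (H w - H 0) < eta.
Proof.
  intros HD He. destruct (HD 1 Rlt_0_1) as [del [Hd Hw]].
  assert (Dp := Cmod_ge_0 D).
  exists (Rmin del (eta / (2 + Cmod D))). split.
  { apply Rmin_glb_lt; [lra|]. apply Rdiv_lt_0_compat; lra. }
  intros w Hm.
  assert (M1 := Rlt_le_trans _ _ _ Hm (Rmin_l _ _)).
  assert (M2 := Rlt_le_trans _ _ _ Hm (Rmin_r _ _)).
  specialize (Hw w). replace (w - 0)%C with w in Hw by ring. specialize (Hw M1).
  replace (H w - H 0)%C with ((H w - H 0 - D * w) + D * w)%C by ring.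
  eapply Rle_lt_trans; [apply Cmod_triangle|]. rewrite Cmod_mult.
  apply (Rmult_lt_compat_r (2 + Cmod D)) in M2; [|lra].
  unfold Rdiv in M2. rewrite Rmult_assoc, Rinv_l in M2 by lra.
  assert (Wp := Cmod_ge_0 w). nra.
Qed.

(* Goursat for the pull-back of H to log-polar coordinates: by periodicity the mean of Re H
   over circles does not depend on the radius, and it tends to Re (H 0). *)
Lemma Re_center_le H M :
  (forall z, Cmod z <= 1 -> exists D, cderiv H z D) ->
  (forall t, 0 <= t <= 2 * PI -> fst (H (cexp (0, t))) <= M) ->
  fst (H 0%C) <= M.
Proof.
  intros HD HM. apply Rnot_lt_le. intros Hlt.
  assert (PIp := PI_RGT_0).
  set (eta := (fst (H 0%C) - M) / 2). assert (Heta : 0 < eta) by (unfold eta; lra).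
  destruct (HD 0%C) as [D0 HD0]; [rewrite Cmod_0; lra|].
  destruct (cderiv_continuous_0 H D0 eta HD0 Heta) as [del [Hdel Hc]].
  (* Logarithm of the inner radius, where H is within eta of its value at 0; the minimum keeps it at
     most 0, the logarithm of the outer radius. *)
  set (s0 := Rmin 0 (ln (del / 2))).
  assert (Hs0 : s0 <= 0) by apply Rmin_l.
  assert (Hes : exp s0 < del).
  { apply Rle_lt_trans with (exp (ln (del / 2))).
    - destruct (Rmin_r 0 (ln (del / 2))) as [h|h]; [left; apply exp_increasing, h|].
      unfold s0; rewrite h; right; reflexivity.
    - rewrite exp_ln; lra. }
  assert (Hder : forall w : C, exists D, fst w <= 0 -> cderiv (fun v => H (cexp v)) w D).
  { intros w. destruct (Rle_dec (fst w) 0) as [Hw|Hw]; [|exists 0%C; intros; contradiction].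
    destruct (HD (cexp w)) as [D HDw].
    - rewrite Cmod_cexp, <- exp_0. destruct Hw as [Hw| ->]; [left; apply exp_increasing, Hw|right; reflexivity].
    - exists (D * cexp w)%C. intros _. apply cderiv_comp; [exact HDw|apply cderiv_cexp]. }
  apply functional_choice in Hder. destruct Hder as [D Hder].
  set (K := fun v => H (cexp v)) in Hder.
  assert (HP : forall x y, s0 <= x <= 0 -> 0 <= y <= 2 * PI ->
    frechet (fun s t => snd (K (s, t))) x y (snd (D (x, y))) (fst (D (x, y)))).
  { intros x y Hx Hy. apply cderiv_frechet, Hder. simpl; lra. }
  assert (HQ : forall x y, s0 <= x <= 0 -> 0 <= y <= 2 * PI ->
    frechet (fun s t => fst (K (s, t))) x y (fst (D (x, y))) (- snd (D (x, y)))).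
  { intros x y Hx Hy. apply cderiv_frechet, Hder. simpl; lra. }
  assert (G := goursat _ _ (fun x y => snd (D (x, y))) (fun x y => fst (D (x, y)))
    (fun x y => - snd (D (x, y))) s0 0 0 (2 * PI) HP HQ Hs0 ltac:(lra)).
  unfold boundary_int in G.
  assert (Hper : forall x, K (x, 2 * PI) = K (x, 0)).
  { intros x. unfold K, cexp; simpl. rewrite cos_2PI, sin_2PI, cos_0, sin_0. reflexivity. }
  assert (Z : RInt (fun x => snd (K (x, 0)) - snd (K (x, 2 * PI))) s0 0 = 0).
  { rewrite (RInt_ext _ (fun _ => 0)); [|intros x _; rewrite Hper; apply Rminus_diag].
    rewrite RInt_const. apply Rmult_0_r. }
  rewrite Z, Rplus_0_l in G.
  assert (Hex : forall x, s0 <= x <= 0 -> ex_RInt (fun y => fst (K (x, y))) 0 (2 * PI)).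
  { intros x Hx. apply (ex_RInt_vertical (fun s t => fst (K (s, t))) (fun x y => fst (D (x, y)))
      (fun x y => - snd (D (x, y))) s0 0 0 (2 * PI) HQ); lra. }
  (* By [G] the left integral is zero, yet Re H <= M on the outer circle and Re H > M + eta on the
     inner one, so its integrand is below - eta. *)
  assert (L : RInt (fun y => fst (K (0, y)) - fst (K (s0, y))) 0 (2 * PI) <= RInt (fun _ => - eta) 0 (2 * PI)).
  { apply RInt_le; [lra| |apply ex_RInt_const|].
    - apply (ex_RInt_minus (V := R_CompleteNormedModule) (fun y => fst (K (0, y))) (fun y => fst (K (s0, y))));
      apply Hex; lra.
    - intros y Hy. assert (B1 := HM y ltac:(lra)). fold (K (0, y)) in B1.
      assert (B2 := Hc (cexp (s0, y))). rewrite Cmod_cexp in B2. specialize (B2 Hes).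
      assert (B3 := Rabs_Re_le_Cmod (H (cexp (s0, y)) - H 0)%C).
      fold (K (s0, y)) in B2, B3.
      assert (B4 : Rabs (fst (K (s0, y)) - fst (H 0%C)) < eta) by (eapply Rle_lt_trans; [exact B3|exact B2]).
      apply Rabs_def2 in B4. unfold eta in *. lra. }
  rewrite G, RInt_const in L. unfold scal in L; simpl in L; unfold mult in L; simpl in L.
  nra.
Qed.

(** Multiplying H by the unimodular constant that turns H 0 into its modulus reduces the claim to
    real parts. *)
Lemma Cmod_center_le H M :
  (forall z, Cmod z <= 1 -> exists D, cderiv H z D) ->
  (forall t, 0 <= t <= 2 * PI -> Cmod (H (cexp (0, t))) <= M) ->
  Cmod (H 0%C) <= M.
Proof.
  intros HD HM.
  assert (Mp : 0 <= M).
  { eapply Rle_trans; [apply Cmod_ge_0|apply (HM 0)]. assert (P := PI_RGT_0); lra. }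
  destruct (Ceq_dec (H 0%C) 0) as [E|E]; [rewrite E, Cmod_0; exact Mp|].
  assert (Hm := proj1 (Cmod_gt_0 _) E).
  set (c := (Cconj (H 0%C) / RtoC (Cmod (H 0%C)))%C).
  assert (Hmc : RtoC (Cmod (H 0%C)) <> 0%C) by (intros X; apply RtoC_inj in X; lra).
  assert (Hc : Cmod c = 1).
  { unfold c. rewrite Cmod_div, Cmod_conj, Cmod_R, Rabs_right by (try assumption; lra). field. lra. }
  assert (Hc0 : (c * H 0 = RtoC (Cmod (H 0)))%C).
  { unfold c. replace (Cconj (H 0%C) / Cmod (H 0%C) * H 0%C)%C with ((H 0 * Cconj (H 0)) / Cmod (H 0))%C
      by (field; exact Hmc).
    rewrite <- Cmod2_conj, RtoC_pow. field. exact Hmc. }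
  replace (Cmod (H 0%C)) with (fst (c * H 0)%C) by (rewrite Hc0; reflexivity).
  apply (Re_center_le (fun z => c * H z)%C).
  - intros z Hz. destruct (HD z Hz) as [D HDz]. exists (c * D)%C.
    assert (A := cderiv_comp (fun w => c * w + 0)%C H z c D (cderiv_affine c 0 (H z)) HDz).
    intros eps He. destruct (A eps He) as [del [Hd Hw]]. exists del. split; [exact Hd|].
    intros w Hwz. specialize (Hw w Hwz).
    replace (c * H w - c * H z)%C with (c * H w + 0 - (c * H z + 0))%C by ring. exact Hw.
  - intros t Ht. eapply Rle_trans; [apply Rle_abs|].
    eapply Rle_trans; [apply Rabs_Re_le_Cmod|]. rewrite Cmod_mult, Hc, Rmult_1_l. apply HM, Ht.
Qed.

Lemma cderiv_bounded_circle H : (forall z, Cmod z <= 1 -> exists D, cderiv H z D) ->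
  exists M, forall t, 0 <= t <= 2 * PI -> Cmod (H (cexp (0, t))) <= M.
Proof.
  intros HD. assert (PIp := PI_RGT_0).
  assert (HK : forall t, exists D, cderiv (fun v => H (cexp v)) (0, t) D).
  { intros t. destruct (HD (cexp (0, t))) as [D HDw].
    - rewrite Cmod_cexp; simpl; rewrite exp_0; lra.
    - exists (D * cexp (0, t))%C. apply cderiv_comp; [exact HDw|apply cderiv_cexp]. }
  destruct (continuity_ab_maj (fun t => Rabs (fst (H (cexp (0, t))))) 0 (2 * PI)) as [m1 [Hm1 _]];
    [lra| |].
  { intros t _. destruct (HK t) as [D HDt].
    apply (continuity_pt_comp (fun t => fst (H (cexp (0, t)))) Rabs); [|apply Rcontinuity_abs].
    apply continuity_pt_filterlim.
    exact (frechet_continuous_l _ _ _ _ _ (frechet_swap _ _ _ _ _ (proj1 (cderiv_frechet _ _ _ _ HDt)))). }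
  destruct (continuity_ab_maj (fun t => Rabs (snd (H (cexp (0, t))))) 0 (2 * PI)) as [m2 [Hm2 _]];
    [lra| |].
  { intros t _. destruct (HK t) as [D HDt].
    apply (continuity_pt_comp (fun t => snd (H (cexp (0, t)))) Rabs); [|apply Rcontinuity_abs].
    apply continuity_pt_filterlim.
    exact (frechet_continuous_l _ _ _ _ _ (frechet_swap _ _ _ _ _ (proj2 (cderiv_frechet _ _ _ _ HDt)))). }
  eexists. intros t Ht. eapply Rle_trans; [apply Cmod_le_Rabs|].
  apply Rplus_le_compat; [apply Hm1, Ht|apply Hm2, Ht].
Qed.

(* The disc automorphism sends 0 to z0 and the unit circle to the circle of radius rho, so the
   bound at the centre applied to f(z)/z^k gives |f(z0)| <= M (|z0|/rho)^k for every k. *)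
Lemma identity_theorem f (Dz : R -> Prop) eps :
  (forall x y, x <= y -> Dz y -> Dz x) -> (forall x, Dz x -> exists y, x < y /\ Dz y) ->
  (forall z, Dz (Cmod z) -> Cdiff f z) -> 0 < eps -> (forall z, Cmod z < eps -> f z = 0%C) ->
  forall z0, Dz (Cmod z0) -> f z0 = 0%C.
Proof.
  intros Hdown Hopen Hf Heps Hf0 z0 Hz0.
  destruct (Ceq_dec z0 0) as [E|E].
  { apply Hf0. rewrite E, Cmod_0. exact Heps. }
  assert (Hm := proj1 (Cmod_gt_0 _) E).
  destruct (Hopen _ Hz0) as [rho [Hrho HDrho]].
  set (t := Cmod z0 / rho).
  assert (Ht : 0 < t < 1).
  { unfold t. split; [apply Rdiv_lt_0_compat; lra|]. apply (Rmult_lt_reg_r rho); [lra|].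
    unfold Rdiv. rewrite Rmult_assoc, Rinv_l by lra. lra. }
  assert (HtC : RtoC t <> 0%C) by (intros X; apply RtoC_inj in X; lra).
  (* With t = |z0| / rho the prefactor z0 / t has modulus rho. The factor 1 in [1 * z + t] gives the
     shape of [cderiv_affine]. *)
  set (phi := fun z => ((z0 / t) * ((1 * z + t) * / (t * z + 1)))%C).
  assert (Hden : forall z, Cmod z <= 1 -> (t * z + 1)%C <> 0%C).
  { intros z Hz X. assert (Y : Cmod (t * z) = 1).
    { replace (t * z)%C with (- (1))%C; [apply Cmod_m1|].
      replace (t * z)%C with ((t * z + 1) - 1)%C by ring. rewrite X. ring. }
    rewrite Cmod_mult, Cmod_R, Rabs_right in Y by lra. nra. }
  assert (Hphi0 : phi 0%C = z0).
  { unfold phi. field. exact HtC. }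
  assert (Hz0t : Cmod (z0 / t) = rho).
  { rewrite Cmod_div, Cmod_R, Rabs_right by (try assumption; lra). unfold t. field. lra. }
  (* This identity yields both |phi| <= rho on the closed disc and |phi| = rho on the unit
     circle. *)
  assert (Hsq : forall z, Cmod (t * z + 1) ^ 2 - Cmod (1 * z + t) ^ 2 = (1 - t ^ 2) * (1 - Cmod z ^ 2)).
  { intros [x y]. rewrite !Cmod2_alt. unfold Re, Im; simpl. ring. }
  assert (Hphi : forall z, Cmod z <= 1 -> Cmod (phi z) = rho * (Cmod (1 * z + t) / Cmod (t * z + 1))).
  { intros z Hz. unfold phi. rewrite Cmod_mult, Hz0t. f_equal.
    rewrite Cmod_mult, Cmod_inv by (apply Hden, Hz). reflexivity. }
  assert (Hphile : forall z, Cmod z <= 1 -> Cmod (phi z) <= rho).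
  { intros z Hz. rewrite (Hphi z Hz). assert (X := proj1 (Cmod_gt_0 _) (Hden z Hz)).
    specialize (Hsq z). assert (Y := Cmod_ge_0 (1 * z + t)). assert (Z := Cmod_ge_0 z).
    apply Rle_trans with (rho * 1); [|lra]. apply Rmult_le_compat_l; [lra|].
    apply (Rmult_le_reg_r (Cmod (t * z + 1))); [exact X|].
    unfold Rdiv. rewrite Rmult_assoc, Rinv_l by lra.
    assert (0 <= (1 - t ^ 2) * (1 - Cmod z ^ 2)) by (apply Rmult_le_pos; nra). nra. }
  assert (Hphieq : forall z, Cmod z = 1 -> Cmod (phi z) = rho).
  { intros z Hz. rewrite (Hphi z) by lra. assert (X := proj1 (Cmod_gt_0 _) (Hden z ltac:(lra))).
    specialize (Hsq z). assert (Y := Cmod_ge_0 (1 * z + t)). rewrite Hz in Hsq.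
    assert (W : Cmod (1 * z + t) = Cmod (t * z + 1)) by nra.
    rewrite W. field. lra. }
  assert (Dphi : forall z, Cmod z <= 1 -> exists D, cderiv phi z D).
  { intros z Hz. eexists. unfold phi.
    apply (cderiv_mult (fun _ => z0 / t)%C (fun z => (1 * z + t) * / (t * z + 1))%C z 0%C).
    - intros e He. exists 1. split; [lra|]. intros w _.
      replace (z0 / t - z0 / t - 0 * (w - z))%C with (RtoC 0) by ring.
      rewrite Cmod_0. apply Rmult_le_pos; [lra|apply Cmod_ge_0].
    - apply cderiv_mult; [apply cderiv_affine|].
      apply (cderiv_comp Cinv (fun z => t * z + 1)%C); [apply cderiv_inv, Hden, Hz|apply cderiv_affine]. }
  (* Near 0 the product vanishes identically because f does, so neither the pole of z^-k nor the
     default value of the inverse at 0 matters. *)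
  assert (Df : forall k z, Dz (Cmod z) -> exists D, cderiv (fun w => f w * Cpow (/ w) k)%C z D).
  { intros k z Hz. destruct (Rlt_dec (Cmod z) eps) as [Hs|Hs].
    - exists 0%C. apply (cderiv_locally_zero _ _ (eps - Cmod z)); [lra|].
      intros w Hw. rewrite Hf0; [ring|]. assert (T := Cmod_triangle_inv w z). lra.
    - assert (Hz1 : z <> 0%C) by (apply Cmod_gt_0; lra).
      destruct (Cdiff_cderiv _ _ (Hf z Hz)) as [D1 HD1].
      destruct (cderiv_pow Cinv z _ k (cderiv_inv z Hz1)) as [D2 HD2].
      eexists. exact (cderiv_mult _ _ _ _ _ HD1 HD2). }
  assert (DH : forall k z, Cmod z <= 1 -> exists D, cderiv (fun w => f (phi w) * Cpow (/ phi w) k)%C z D).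
  { intros k z Hz. destruct (Dphi z Hz) as [D1 HD1].
    destruct (Df k (phi z)) as [D2 HD2]; [apply (Hdown _ rho); [apply Hphile, Hz|exact HDrho]|].
    eexists. exact (cderiv_comp (fun w => f w * Cpow (/ w) k)%C phi z D2 D1 HD2 HD1). }
  (* M is taken for k = 0. As |phi| = rho on the unit circle, dividing by phi^k multiplies the bound
     by exactly rho^-k, so one M serves all k. *)
  destruct (cderiv_bounded_circle (fun w => f (phi w) * Cpow (/ phi w) 0)%C (DH O)) as [M HM].
  assert (Hrho0 : 0 < rho) by lra.
  assert (B : forall k, Cmod (f z0) <= M * t ^ k).
  { intros k.
    assert (X := Cmod_center_le (fun w => f (phi w) * Cpow (/ phi w) k)%C (M * / rho ^ k) (DH k)).
    cbv beta in X. rewrite Hphi0 in X.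
    rewrite Cmod_mult, Cmod_pow, Cmod_inv in X by exact E.
    assert (Y : Cmod (f z0) * (/ Cmod z0) ^ k <= M * / rho ^ k).
    { apply X. intros s Hs. specialize (HM s Hs). simpl in HM. rewrite Cmult_1_r in HM.
      assert (P : Cmod (cexp (0, s)) = 1) by (rewrite Cmod_cexp; apply exp_0).
      assert (Q := Hphieq _ P).
      assert (Q0 : phi (cexp (0, s)) <> 0%C) by (apply Cmod_gt_0; lra).
      rewrite Cmod_mult, Cmod_pow, Cmod_inv, Q, pow_inv by exact Q0.
      apply Rmult_le_compat_r; [|exact HM]. left. apply Rinv_0_lt_compat, pow_lt, Hrho0. }
    assert (Zk : 0 < Cmod z0 ^ k) by (apply pow_lt; lra).
    assert (Rk : 0 < rho ^ k) by (apply pow_lt; lra).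
    apply (Rmult_le_compat_r (Cmod z0 ^ k)) in Y; [|lra].
    rewrite pow_inv, Rmult_assoc, Rinv_l, Rmult_1_r in Y by lra.
    eapply Rle_trans; [exact Y|]. right. unfold t, Rdiv. rewrite Rpow_mult_distr, pow_inv. ring. }
  apply Cmod_eq_0, Rle_antisym; [|apply Cmod_ge_0].
  assert (L : is_lim_seq (fun k => M * t ^ k) 0).
  { replace (Finite 0) with (Rbar_mult (Finite M) (Finite 0)) by (simpl; f_equal; ring).
    apply is_lim_seq_scal_l, is_lim_seq_geom. rewrite Rabs_right; lra. }
  apply (is_lim_seq_le (fun _ => Cmod (f z0)) (fun k => M * t ^ k) (Cmod (f z0)) 0 B);
    [apply is_lim_seq_const|exact L].
Qed.

(** * The last edge of the Newton polygon *)

Lemma nat_least (P : nat -> Prop) : (exists n, P n) -> exists n, P n /\ forall m, P m -> (n <= m)%nat.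
Proof.
  intros [n Hn]. revert Hn. induction n as [n IH] using lt_wf_ind. intros Hn.
  destruct (classic (exists m, (m < n)%nat /\ P m)) as [[m [Hm Pm]]|H].
  - exact (IH m Hm Pm).
  - exists n. split; [exact Hn|]. intros m Pm.
    destruct (Nat.le_gt_cases n m) as [h|h]; [exact h|]. exfalso. apply H. exists m. auto.
Qed.

(** Each row i may contain infinitely many j, but f decreases along a row, so the least j represents
    it and only the m rows compete. Ties go to the smallest i, which later singles out a vertex
    among the points of an edge. *)
Lemma finite_argmax (A : nat -> nat -> Prop) (f : nat -> nat -> R) m :
  (forall i j j', A i j -> A i j' -> (j <= j')%nat -> f i j' <= f i j) ->
  (exists i j, (i < m)%nat /\ A i j) ->
  exists i0 j0, (i0 < m)%nat /\ A i0 j0 /\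
    forall i j, (i < m)%nat -> A i j -> f i j <= f i0 j0 /\ (f i j = f i0 j0 -> (i0 <= i)%nat).
Proof.
  intros Hmono. induction m as [|m IH]; [intros (i & j & H & _); lia|].
  intros Hex.
  destruct (classic (exists j, A m j)) as [Hm|Hm].
  - apply nat_least in Hm. destruct Hm as [jm [Ajm Hjm]].
    destruct (classic (exists i j, (i < m)%nat /\ A i j)) as [H'|H'].
    + destruct (IH H') as (i0 & j0 & Hi0 & A0 & Hmax).
      destruct (Rle_dec (f m jm) (f i0 j0)) as [Hle|Hgt].
      * exists i0, j0. split; [lia|]. split; [exact A0|]. intros i j Hi Hij.
        destruct (Nat.eq_dec i m) as [->|Hne].
        -- split; [|lia]. eapply Rle_trans; [|exact Hle]. apply Hmono; auto.
        -- apply Hmax; [lia|exact Hij].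
      * exists m, jm. split; [lia|]. split; [exact Ajm|]. intros i j Hi Hij.
        destruct (Nat.eq_dec i m) as [->|Hne].
        -- split; [|lia]. apply Hmono; auto.
        -- destruct (Hmax i j) as [Hf _]; [lia|exact Hij|]. split; [lra|]. lra.
    + exists m, jm. split; [lia|]. split; [exact Ajm|]. intros i j Hi Hij.
      destruct (Nat.eq_dec i m) as [->|Hne].
      * split; [|lia]. apply Hmono; auto.
      * exfalso. apply H'. exists i, j. split; [lia|exact Hij].
  - destruct IH as (i0 & j0 & Hi0 & A0 & Hmax).
    + destruct Hex as (i & j & Hi & Hij). exists i, j. split; [|exact Hij].
      destruct (Nat.eq_dec i m) as [->|]; [exfalso; apply Hm; eauto|lia].
    + exists i0, j0. split; [lia|]. split; [exact A0|]. intros i j Hi Hij.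
      apply Hmax; [|exact Hij].
      destruct (Nat.eq_dec i m) as [->|]; [exfalso; apply Hm; eauto|lia].
Qed.

Definition convex_cone (P : R -> R -> Prop) : Prop :=
  P 0 0 /\ (forall x y x' y', P x y -> P x' y' -> P (x + x') (y + y')) /\
  (forall t x y, 0 < t -> P x y -> P (t * x) (t * y)).

(** Because the weights sum to 1, x - e is the sum of the t (p - e). Terms of weight 0 are dropped,
    as scaling is asked only for t > 0. *)
Lemma conv_hull_cone (S : pt -> Prop) (P : R -> R -> Prop) (e : pt) :
  convex_cone P -> (forall p, S p -> P (fst p - fst e) (snd p - snd e)) ->
  forall x, conv_hull S x -> P (fst x - fst e) (snd x - snd e).
Proof.
  intros (P0 & Padd & Pscal) HS x (l & Hl & Hsum & Hx & Hy).
  assert (G : P (List.fold_right (fun c acc => fst c * fst (snd c) + acc) 0 l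
                 - List.fold_right (fun c acc => fst c + acc) 0 l * fst e)
                (List.fold_right (fun c acc => fst c * snd (snd c) + acc) 0 l
                 - List.fold_right (fun c acc => fst c + acc) 0 l * snd e)).
  { clear Hsum Hx Hy. induction Hl as [|[t p] l [Ht Hp] Hl IH]; simpl in *.
    - replace (0 - 0 * fst e) with 0 by ring. replace (0 - 0 * snd e) with 0 by ring. exact P0.
    - destruct Ht as [Ht|<-].
      + assert (Q := Padd _ _ _ _ (Pscal t _ _ Ht (HS p Hp)) IH).
        match type of Q with P ?a ?b => match goal with |- P ?c ?d =>
          replace c with a by ring; replace d with b by ring end end. exact Q.
      + match type of IH with P ?a ?b => match goal with |- P ?c ?d =>
          replace c with a by ring; replace d with b by ring end end. exact IH. }
  rewrite <- Hx, <- Hy, Hsum, !Rmult_1_l in G. exact G.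
Qed.

Lemma conv_hull_incl (S : pt -> Prop) x : S x -> conv_hull S x.
Proof.
  intros H. exists ((1, x) :: nil). simpl. repeat split; try lra.
  constructor; [simpl; split; [lra|exact H]|constructor].
Qed.

Section Newton.
Variable b : nat -> nat -> C.

Lemma newton_polygon_intro i j x y : b i j <> 0%C -> INR i <= x -> INR j <= y ->
  newton_polygon b (x, y).
Proof. intros. apply conv_hull_incl. exists i, j. auto. Qed.

Lemma newton_polygon_cone (P : R -> R -> Prop) i0 j0 :
  convex_cone P -> (forall x y, 0 <= x -> 0 <= y -> P x y) ->
  (forall i j, b i j <> 0%C -> P (INR i - i0) (INR j - j0)) ->
  forall x y, newton_polygon b (x, y) -> P (x - i0) (y - j0).
Proof.
  intros HP Hq HS x y H.
  apply (conv_hull_cone _ P (i0, j0) HP) in H; [exact H|].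
  intros [x' y'] (i & j & Hb & Hi & Hj). simpl in *.
  replace (x' - i0) with ((INR i - i0) + (x' - INR i)) by ring.
  replace (y' - j0) with ((INR j - j0) + (y' - INR j)) by ring.
  apply HP; [apply HS, Hb|apply Hq; lra].
Qed.

(** If e is inside a segment from a to c, then t (a - e) and (1 - t) (c - e) are opposite elements
    of the cone, and a pointed cone leaves only zero. *)
Lemma extreme_of_cone (P : R -> R -> Prop) i0 j0 :
  convex_cone P -> (forall x y, P x y -> P (- x) (- y) -> x = 0 /\ y = 0) ->
  (forall x y, 0 <= x -> 0 <= y -> P x y) ->
  b i0 j0 <> 0%C ->
  (forall i j, b i j <> 0%C -> P (INR i - INR i0) (INR j - INR j0)) ->
  extreme_pt (newton_polygon b) (INR i0, INR j0).
Proof.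
  intros HP Hpt Hq H0 HS. assert (HN := newton_polygon_cone P _ _ HP Hq HS).
  destruct HP as (_ & _ & Hscal).
  split; [apply (newton_polygon_intro i0 j0); auto; lra|].
  intros [ax ay] [cx cy] t Ha Hc Ht Ex Ey. simpl in *.
  assert (Pa := Hscal t _ _ ltac:(lra) (HN _ _ Ha)).
  assert (Pc := Hscal (1 - t) _ _ ltac:(lra) (HN _ _ Hc)).
  destruct (Hpt (t * (ax - INR i0)) (t * (ay - INR j0)) Pa) as [Zx Zy].
  { replace (- (t * (ax - INR i0))) with ((1 - t) * (cx - INR i0)) by lra.
    replace (- (t * (ay - INR j0))) with ((1 - t) * (cy - INR j0)) by lra. exact Pc. }
  apply Rmult_integral in Zx, Zy.
  assert (ax = INR i0) by lra. assert (ay = INR j0) by lra. subst ax ay.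
  assert (Wx : (1 - t) * (cx - INR i0) = 0) by lra.
  assert (Wy : (1 - t) * (cy - INR j0) = 0) by lra.
  apply Rmult_integral in Wx, Wy. f_equal; lra.
Qed.

Variables (s : nat) (nv mv : nat -> nat).
Hypothesis HNP : NP_vertices b s nv mv.

Let g := nv s.
Let d := mv s.
Let g' := nv (s - 1)%nat.
Let d' := mv (s - 1)%nat.
Let l1 := (INR g - INR g') / (INR d' - INR d).

Lemma vertices_monotone k k' : (1 <= k)%nat -> (k < k')%nat -> (k' <= s)%nat ->
  (nv k < nv k')%nat /\ (mv k' < mv k)%nat.
Proof.
  destruct HNP as (_ & Hmon & _). intros H1 H2 H3. induction k' as [|k' IH]; [lia|].
  destruct (Nat.eq_dec k k') as [<-|Hne]; [apply Hmon; lia|].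
  assert (A := IH ltac:(lia) ltac:(lia)). assert (B := Hmon k' ltac:(lia) ltac:(lia)). lia.
Qed.

Lemma last_vertices_lt : (g' < g)%nat /\ (d < d')%nat.
Proof. destruct HNP as (Hs & _ & _). apply vertices_monotone; lia. Qed.

Lemma vertex_extreme k : (1 <= k <= s)%nat ->
  extreme_pt (newton_polygon b) (INR (nv k), INR (mv k)).
Proof. intros Hk. destruct HNP as (_ & _ & Hext). apply Hext. exists k. auto. Qed.

Lemma extreme_vertex i j : extreme_pt (newton_polygon b) (INR i, INR j) ->
  exists k, (1 <= k <= s)%nat /\ nv k = i /\ mv k = j.
Proof.
  intros H. destruct HNP as (_ & _ & Hext). apply Hext in H.
  destruct H as (k & Hk & E). exists k. split; [exact Hk|].
  injection E as E1 E2. apply INR_eq in E1, E2. auto.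
Qed.

(** The exponent with least j, and then least i, is extreme for a lexicographic cone, hence is
    vertex k for some k. If k < s, its height would exceed m_s, although it is the least height of
    the whole polygon. *)
Lemma last_vertex : b g d <> 0%C /\
  forall i j, b i j <> 0%C -> (d <= j)%nat /\ (j = d -> (g <= i)%nat).
Proof.
  assert (Hs : (1 < s)%nat) by apply HNP.
  assert (HS : exists j i, b i j <> 0%C).
  { destruct (vertex_extreme s ltac:(lia)) as [(l & Hl & Hsum & _) _].
    destruct Hl as [|c l [_ (i & j & Hb & _)] _]; [simpl in Hsum; lra|eauto]. }
  apply nat_least in HS. destruct HS as [d1 [Hd1 Hmin]].
  apply nat_least in Hd1. destruct Hd1 as [g1 [Hg1 Hmin1]].
  assert (Hall : forall i j, b i j <> 0%C -> (d1 <= j)%nat /\ (j = d1 -> (g1 <= i)%nat)).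
  { intros i j Hb. split; [apply Hmin; eauto|]. intros ->. apply Hmin1, Hb. }
  assert (Hext : extreme_pt (newton_polygon b) (INR g1, INR d1)).
  { apply (extreme_of_cone (fun x y => 0 < y \/ (y = 0 /\ 0 <= x))); auto.
    - split; [right; lra|]. split; [intros; lra|]. intros t x y Ht [Hy|[-> Hx]].
      + left. apply Rmult_lt_0_compat; lra.
      + right. split; [ring|]. apply Rmult_le_pos; lra.
    - intros x y H1 H2. lra.
    - intros x y Hx Hy. lra.
    - intros i j Hb. destruct (Hall i j Hb) as [H1 H2].
      destruct (Nat.eq_dec j d1) as [->|Hne].
      + right. split; [ring|]. assert (T := le_INR _ _ (H2 eq_refl)). lra.
      + left. assert (T := lt_INR d1 j ltac:(lia)). lra. }
  destruct (extreme_vertex _ _ Hext) as (k & Hk & E1 & E2).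
  assert (Hy : 0 <= INR (mv s) - INR d1).
  { apply (newton_polygon_cone (fun x y => 0 <= y) 0 (INR d1)) with (x := INR (nv s)).
    - repeat split; intros; try lra. apply Rmult_le_pos; lra.
    - auto.
    - intros i j Hb. assert (T := le_INR _ _ (proj1 (Hall i j Hb))). lra.
    - apply vertex_extreme. lia. }
  destruct (Nat.eq_dec k s) as [->|Hne].
  - unfold g, d. rewrite E1, E2. auto.
  - destruct (vertices_monotone k s) as [_ Hlt]; try lia.
    apply lt_INR in Hlt. rewrite E2 in Hlt. lra.
Qed.

Lemma last_slope_pos : 0 < l1.
Proof.
  destruct last_vertices_lt as [H1 H2]. apply lt_INR in H1, H2.
  apply Rdiv_lt_0_compat; lra.
Qed.

(* The minimiser of x + l y with smallest x, for l the largest slope towards the last vertex, is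
   extreme, hence a vertex; vertex s-1 cannot lie strictly between it and the last vertex. *)
Lemma last_edge i j : b i j <> 0%C ->
  INR g + l1 * INR d <= INR i + l1 * INR j /\
  (INR i + l1 * INR j = INR g + l1 * INR d -> (g' <= i)%nat).
Proof.
  assert (Hs : (1 < s)%nat) by apply HNP.
  destruct last_vertices_lt as [Hg' Hd'].
  destruct last_vertex as [Hgd Hmin].
  set (f := fun i j : nat => (INR g - INR i) / (INR j - INR d)).
  assert (Hj : forall i j, b i j <> 0%C -> (i < g)%nat -> INR d < INR j).
  { intros i0 j0 Hb Hi. destruct (Hmin _ _ Hb) as [H1 H2]. apply lt_INR.
    destruct (Nat.eq_dec j0 d); [specialize (H2 e)|]; lia. }
  destruct (finite_argmax (fun i j => b i j <> 0%C /\ (i < g)%nat) f g) as (i0 & j0 & Hi0 & [Hb0 _] & Hmax).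
  { intros i1 j1 j2 [B1 L1] [B2 L2] Hle. unfold f.
    assert (X := Hj _ _ B1 L1). apply le_INR in Hle. apply lt_INR in L1.
    apply Rmult_le_compat_l; [lra|]. apply Rinv_le_contravar; lra. }
  (* Without exponents i < g the polygon would lie in x >= g, against vertex s - 1. *)
  { apply NNPP. intros Hno. apply lt_INR in Hg'.
    assert (0 <= INR g' - INR g); [|lra].
    apply (newton_polygon_cone (fun x y => 0 <= x) (INR g) 0) with (y := INR d').
    - repeat split; intros; try lra. apply Rmult_le_pos; lra.
    - auto.
    - intros i1 j1 Hb. apply Rnot_lt_le. intros Hlt. apply Hno. exists i1, j1.
      assert (i1 < g)%nat by (apply INR_lt; lra). auto.
    - apply vertex_extreme. lia. }
  set (l := f i0 j0). assert (Hjd := Hj _ _ Hb0 Hi0).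
  assert (Hi0R := lt_INR _ _ Hi0).
  assert (Hl : 0 < l) by (apply Rdiv_lt_0_compat; lra).
  assert (Hl0 : l * (INR j0 - INR d) = INR g - INR i0) by (unfold l, f; field; lra).
  assert (Hall : forall i j, b i j <> 0%C -> INR g + l * INR d <= INR i + l * INR j /\
    (INR i + l * INR j = INR g + l * INR d -> (i0 <= i)%nat)).
  { intros i1 j1 Hb. destruct (Nat.lt_ge_cases i1 g) as [Hi|Hi].
    - destruct (Hmax i1 j1 Hi (conj Hb Hi)) as [M1 M2]. fold l in M1, M2.
      assert (X := Hj _ _ Hb Hi).
      assert (E : f i1 j1 * (INR j1 - INR d) = INR g - INR i1) by (unfold f; field; lra).
      split.
      + apply (Rmult_le_compat_r (INR j1 - INR d)) in M1; lra.
      + intros Eq. apply M2. apply (Rmult_eq_reg_r (INR j1 - INR d)); lra.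
    - assert (X := le_INR _ _ (proj1 (Hmin _ _ Hb))). split; [|lia].
      apply le_INR in Hi. apply (Rmult_le_compat_l l) in X; lra. }
  assert (Hext : extreme_pt (newton_polygon b) (INR i0, INR j0)).
  { apply (extreme_of_cone (fun x y => 0 < x + l * y \/ (x + l * y = 0 /\ 0 <= x))); auto.
    - split; [right; lra|]. split; [intros; lra|]. intros t x y Ht H.
      replace (t * x + l * (t * y)) with (t * (x + l * y)) by ring. destruct H as [Hy|[-> Hx]].
      + left. apply Rmult_lt_0_compat; lra.
      + right. split; [ring|]. apply Rmult_le_pos; lra.
    - intros x y H1 H2. assert (x = 0) by lra. split; [exact H|]. subst x.
      assert (E : l * y = 0) by lra. apply Rmult_integral in E. lra.
    - intros x y Hx Hy. assert (T := Rmult_le_pos l y ltac:(lra) Hy). lra.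
    - intros i1 j1 Hb. destruct (Hall _ _ Hb) as [M1 M2].
      destruct (Req_dec (INR i1 + l * INR j1) (INR g + l * INR d)) as [E|E].
      + right. assert (T := le_INR _ _ (M2 E)). lra.
      + left. lra. }
  destruct (extreme_vertex _ _ Hext) as (k & Hk & E1 & E2).
  assert (Hks : k = (s - 1)%nat).
  { destruct (Nat.eq_dec k (s - 1)) as [e|Hne]; [exact e|]. exfalso.
    destruct (Nat.eq_dec k s) as [->|Hne']; [unfold g in Hi0; lia|].
    destruct (vertices_monotone k (s - 1)) as [K1 _]; try lia.
    rewrite E1 in K1. fold g' in K1. apply lt_INR in K1, Hg'.
    destruct (vertex_extreme (s - 1) ltac:(lia)) as [HvN Hv]. fold g' d' in HvN, Hv.
    assert (Hvl : 0 <= (INR g' - INR g) + l * (INR d' - INR d)).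
    { apply (newton_polygon_cone (fun x y => 0 <= x + l * y) (INR g) (INR d)) with (x := INR g').
      - split; [lra|]. split; [intros; lra|]. intros t x y Ht H.
        replace (t * x + l * (t * y)) with (t * (x + l * y)) by ring. apply Rmult_le_pos; lra.
      - intros x y Hx Hy. assert (T := Rmult_le_pos l y ltac:(lra) Hy). lra.
      - intros i1 j1 Hb. destruct (Hall _ _ Hb) as [M1 M2]. lra.
      - exact HvN. }
    (* t places g' between i0 and g, and h >= 0 is the height of vertex s - 1 over the segment from
       (i0, j0) to (g, d). Both ends raised by h stay in the polygon, so this vertex would be inside
       a segment. *)
    set (t := (INR g - INR g') / (INR g - INR i0)).
    assert (Ht : t * (INR g - INR i0) = INR g - INR g') by (unfold t; field; lra).
    assert (Ht0 : 0 < t) by (apply Rdiv_lt_0_compat; lra).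
    assert (Ht1 : t < 1) by (apply (Rmult_lt_reg_r (INR g - INR i0)); lra).
    set (h := INR d' - (t * INR j0 + (1 - t) * INR d)).
    assert (Hh : 0 <= h).
    { apply (Rmult_le_reg_l l); [exact Hl|]. unfold h.
      replace (l * (INR d' - (t * INR j0 + (1 - t) * INR d)))
        with (l * (INR d' - INR d) - t * (l * (INR j0 - INR d))) by ring.
      rewrite Hl0. lra. }
    assert (E := Hv (INR i0, INR j0 + h) (INR g, INR d + h) t).
    simpl in E. assert (E' : (INR i0, INR j0 + h) = (INR g, INR d + h)).
    { apply E; try lra.
      - apply (newton_polygon_intro i0 j0); auto; lra.
      - apply (newton_polygon_intro g d); auto; lra.
      - unfold h. ring. }
    injection E' as E3 _. lra. }
  subst k. fold g' in E1. fold d' in E2.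
  assert (El : l = l1) by (unfold l, l1, f; rewrite E1, E2; reflexivity).
  intros Hb. rewrite <- El, E1. apply Hall, Hb.
Qed.

(** The intercept enters the estimates only through this common value of x + l1 y on the last edge:
    delta < T means l1 delta < g + l1 d. *)
Lemma intercept_eq : l1 * y_intercept (INR g') (INR d') (INR g) (INR d) = INR g + l1 * INR d.
Proof.
  destruct last_vertices_lt as [H1 H2]. apply lt_INR in H1, H2.
  unfold l1, y_intercept. field. lra.
Qed.
End Newton.

(** * Estimates of q inside and outside the wedge *)

Lemma Cmod_series_le (a : nat -> C) (c : nat -> R) la lc :
  is_series (V := C_NormedModule) a la -> is_series c lc ->
  (forall n, Cmod (a n) <= c n) -> Cmod la <= lc.
Proof.
  intros Ha Hc H.
  assert (La : is_lim_seq (fun n => Cmod (sum_n a n)) (Cmod la)).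
  { exact (filterlim_comp _ _ _ (sum_n a) (norm (V := C_NormedModule)) _ _ _ Ha (filterlim_norm la)). }
  apply (is_lim_seq_le (fun n => Cmod (sum_n a n)) (sum_n c) (Cmod la) lc); [|exact La|exact Hc].
  intros n. eapply Rle_trans; [apply (norm_sum_n_m (V := C_NormedModule))|].
  apply sum_n_m_le. exact H.
Qed.

Lemma is_series_single (x : C) k :
  is_series (V := C_NormedModule) (fun n => if Nat.eq_dec n k then x else RtoC 0) x.
Proof.
  apply filterlim_ext_loc with (fun _ : nat => x); [|apply filterlim_const].
  assert (E : forall n, sum_n (G := C_NormedModule) (fun n => if Nat.eq_dec n k then x else RtoC 0) n =
    if le_lt_dec k n then x else RtoC 0).
  { induction n as [|n IH].
    - rewrite sum_O. destruct (Nat.eq_dec 0 k), (le_lt_dec k 0); try reflexivity; lia.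
    - rewrite sum_Sn, IH.
      destruct (le_lt_dec k n), (Nat.eq_dec (S n) k), (le_lt_dec k (S n)); try lia;
        apply injective_projections; apply Rplus_0_l || apply Rplus_0_r. }
  exists k. intros n Hn. rewrite E. destruct (le_lt_dec k n); [reflexivity|lia].
Qed.

Lemma Cmod_series_minus_term_le (a : nat -> C) (c : nat -> R) la lc k :
  is_series (V := C_NormedModule) a la -> is_series c lc ->
  (forall n, n <> k -> Cmod (a n) <= c n) -> 0 <= c k -> Cmod (la - a k) <= lc.
Proof.
  intros Ha Hc H Hk.
  apply (Cmod_series_le (fun n => a n - (if Nat.eq_dec n k then a k else RtoC 0))%C c); [|exact Hc|].
  - exact (is_series_minus (V := C_NormedModule) _ _ _ _ Ha (is_series_single (a k) k)).
  - intros n. destruct (Nat.eq_dec n k) as [->|Hne].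
    + replace (a k - a k)%C with (RtoC 0) by ring. rewrite Cmod_0. exact Hk.
    + replace (a n - 0)%C with (a n) by ring. apply H, Hne.
Qed.

(** The sum of moduli at (rho, rho) is finite, so a monomialwise comparison with factor kappa sums
    up to a bound on q minus one chosen term. Choosing a term with zero coefficient bounds q itself,
    and kappa = 0 proves vanishing. *)
Lemma taylor_bound q b : taylor2_at0 q b -> exists rho M, 0 < rho < 1 /\ 0 <= M /\
  forall z w g d kappa, 0 <= kappa -> Cmod z <= rho -> Cmod w <= rho ->
    (forall i j, b i j <> 0%C -> (i, j) <> (g, d) ->
      Cmod z ^ i * Cmod w ^ j <= kappa * rho ^ (i + j)) ->
    Cmod (q z w - b g d * Cpow z g * Cpow w d) <= kappa * M.
Proof.
  intros (eps & Heps & H). set (rho := Rmin (1 / 2) (eps / 2)).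
  assert (Hr : 0 < rho) by (apply Rmin_glb_lt; lra).
  assert (Hr1 : rho <= 1 / 2) by apply Rmin_l.
  assert (Hre : rho <= eps / 2) by apply Rmin_r.
  assert (Hrm : Cmod (RtoC rho) = rho) by (rewrite Cmod_R; apply Rabs_right; lra).
  destruct (H (RtoC rho) (RtoC rho)) as [(S & HS & [M HM]) _]; [rewrite Hrm; lra..|].
  rewrite Hrm in HS.
  assert (HS0 : forall i, 0 <= S i).
  { intros i. apply (Rle_trans _ (Cmod 0)); [apply Cmod_ge_0|].
    apply (Cmod_series_le (fun _ => RtoC 0) (fun j => Cmod (b i j) * rho ^ i * rho ^ j)); [|apply HS|].
    - apply filterlim_ext with (fun _ : nat => RtoC 0); [|apply filterlim_const].
      intros n. symmetry. induction n; [apply sum_O|]. rewrite sum_Sn, IHn.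
      apply injective_projections; apply Rplus_0_l.
    - intros n. rewrite Cmod_0. repeat apply Rmult_le_pos; try apply Cmod_ge_0; left; apply pow_lt, Hr. }
  assert (HSM : forall i, S i <= M).
  { intros i.
    replace (S i) with (Cmod (S i)) by (rewrite Cmod_R; apply Rabs_right, Rle_ge, HS0).
    apply (Cmod_series_le (fun n => if Nat.eq_dec n i then RtoC (S i) else RtoC 0) S);
      [apply is_series_single|exact HM|].
    intros n. destruct (Nat.eq_dec n i) as [->|].
    - rewrite Cmod_R. right. apply Rabs_right, Rle_ge, HS0.
    - rewrite Cmod_0. apply HS0. }
  assert (HM0 : 0 <= M) by (eapply Rle_trans; [apply (HS0 O)|apply HSM]).
  (* Row g without its chosen term and the sum of the other rows cost kappa M each. *)
  exists rho, (2 * M). split; [lra|]. split; [lra|].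
  intros z w g d kappa Hk Hz Hw Hb.
  destruct (H z w) as [_ (T & HT & HTq)]; [lra..|].
  assert (Hterm : forall i j, (i, j) <> (g, d) ->
    Cmod (b i j * Cpow z i * Cpow w j) <= kappa * (Cmod (b i j) * rho ^ i * rho ^ j)).
  { intros i j Hij. rewrite !Cmod_mult, !Cmod_pow.
    destruct (Ceq_dec (b i j) 0) as [E|E]; [rewrite E, Cmod_0; lra|].
    specialize (Hb i j E Hij). rewrite pow_add in Hb.
    rewrite Rmult_assoc. replace (kappa * (Cmod (b i j) * rho ^ i * rho ^ j))
      with (Cmod (b i j) * (kappa * (rho ^ i * rho ^ j))) by ring.
    apply Rmult_le_compat_l; [apply Cmod_ge_0|exact Hb]. }
  assert (Hks : forall i, is_series (fun j => kappa * (Cmod (b i j) * rho ^ i * rho ^ j)) (kappa * S i)).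
  { intros i. apply (is_series_scal_l (V := R_NormedModule) kappa), HS. }
  assert (HkM : is_series (fun i => kappa * S i) (kappa * M)).
  { apply (is_series_scal_l (V := R_NormedModule) kappa), HM. }
  assert (A1 : Cmod (T g - b g d * Cpow z g * Cpow w d) <= kappa * S g).
  { apply (Cmod_series_minus_term_le (fun j => b g j * Cpow z g * Cpow w j)%C _ _ _ d (HT g) (Hks g)).
    - intros n Hn. apply Hterm. congruence.
    - repeat apply Rmult_le_pos; try apply Cmod_ge_0; try lra; left; apply pow_lt, Hr. }
  assert (A2 : Cmod (q z w - T g) <= kappa * M).
  { apply (Cmod_series_minus_term_le T _ _ _ g HTq HkM).
    - intros n Hn. apply (Cmod_series_le _ _ _ _ (HT n) (Hks n)).
      intros j. apply Hterm. congruence.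
    - apply Rmult_le_pos; [lra|apply HS0]. }
  replace (q z w - b g d * Cpow z g * Cpow w d)%C
    with ((q z w - T g) + (T g - b g d * Cpow z g * Cpow w d))%C by ring.
  eapply Rle_trans; [apply Cmod_triangle|].
  assert (kappa * S g <= kappa * M) by (apply Rmult_le_compat_l; [lra|apply HSM]). lra.
Qed.

Lemma Rpower_mult_pow x l n : 0 < x -> Rpower x l ^ n = Rpower x (l * INR n).
Proof.
  intros Hx. rewrite <- Rpower_pow by (apply exp_pos). apply Rpower_mult.
Qed.

Lemma Rpower_le_lt1 x a b : 0 < x <= 1 -> b <= a -> Rpower x a <= Rpower x b.
Proof.
  intros Hx Hab. unfold Rpower.
  assert (ln x <= 0).
  { rewrite <- ln_1. destruct (proj2 Hx) as [H|H]; [left; apply ln_increasing; lra|rewrite H; lra]. }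
  destruct (Req_dec (a * ln x) (b * ln x)) as [E|E]; [rewrite E; lra|].
  left. apply exp_increasing. assert (a * ln x <= b * ln x) by nra. lra.
Qed.

Lemma pow_le_lt1 x m n : 0 <= x <= 1 -> (n <= m)%nat -> x ^ m <= x ^ n.
Proof.
  intros Hx Hnm. replace m with (n + (m - n))%nat by lia. rewrite pow_add.
  assert (0 <= x ^ n) by (apply pow_le; lra).
  assert (x ^ (m - n) <= 1) by (rewrite <- (pow1 (m - n)); apply pow_incr; lra). nra.
Qed.

Section Estimates.
Variables (q : C -> C -> C) (b : nat -> nat -> C) (g d : nat) (l1 : R).
Hypothesis Hqb : taylor2_at0 q b.
Hypothesis Hl1 : 0 < l1.
Hypothesis Hd : forall i j, b i j <> 0%C -> (d <= j)%nat.
Hypothesis Hedge : forall i j, b i j <> 0%C -> INR g + l1 * INR d <= INR i + l1 * INR j.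

(** In the wedge every other monomial is smaller than z^g w^d by a factor of order r: for i >= g it
    has a further factor z or w, and for i < g its surplus of w pays for the missing z. K does not
    depend on r, so a small r makes the error a fraction of the leading term. *)
Lemma dominant_term : exists K rho, 0 < K /\ 0 < rho < 1 /\
  forall r (z w : C), 0 < r <= rho -> z <> 0%C -> Cmod z <= r -> Cmod w <= r * Rpower (Cmod z) l1 ->
    Cmod (q z w - b g d * Cpow z g * Cpow w d) <= K * r * (Cmod z ^ g * Cmod w ^ d).
Proof.
  destruct (taylor_bound q b Hqb) as (rho & M & Hrho & HM & HT).
  assert (Pr : forall n, 0 < rho ^ n) by (intros; apply pow_lt; lra).
  assert (Hdom : forall r (z w : C) i j, 0 < r <= rho -> z <> 0%C -> Cmod z <= r ->
    Cmod w <= r * Rpower (Cmod z) l1 -> b i j <> 0%C -> (i, j) <> (g, d) ->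
    Cmod z ^ i * Cmod w ^ j <= r / rho ^ (g + d + 1) * (Cmod z ^ g * Cmod w ^ d) * rho ^ (i + j)).
  { intros r z w i j Hr Hz0 Hz Hw Hb Hij.
    assert (Hzp := proj1 (Cmod_gt_0 z) Hz0). assert (Hwp := Cmod_ge_0 w).
    assert (HL : 0 < Rpower (Cmod z) l1) by apply exp_pos.
    assert (HL1 : Rpower (Cmod z) l1 <= 1).
    { rewrite <- (Rpower_O (Cmod z)) by exact Hzp. apply Rpower_le_lt1; lra. }
    assert (Hwr : Cmod w <= r) by nra.
    assert (Hj := Hd i j Hb). assert (He := Hedge i j Hb).
    set (m := (j - d)%nat). assert (Ej : j = (d + m)%nat) by (unfold m; lia).
    (* One factor r is kept and the others are enlarged to rho; this is the origin of the gain r /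
       rho. *)
    assert (Hrr : forall n, (1 <= n)%nat -> r ^ n <= r / rho * rho ^ n).
    { intros n Hn. destruct n as [|n]; [lia|]. simpl.
      replace (r / rho * (rho * rho ^ n)) with (r * rho ^ n) by (field; lra).
      apply Rmult_le_compat_l; [lra|]. apply pow_incr; lra. }
    assert (Hrp : 0 < r / rho) by (apply Rdiv_lt_0_compat; lra).
    assert (Hwd : 0 <= Cmod w ^ d) by (apply pow_le; lra).
    assert (Core : Cmod z ^ i * Cmod w ^ m <= r / rho * Cmod z ^ g * (rho ^ (i + j) / rho ^ (g + d))).
    { destruct (Nat.le_gt_cases g i) as [Hi|Hi].
      - replace i with (g + (i - g))%nat at 1 by lia.
        replace (i + j)%nat with ((i - g + m) + (g + d))%nat by lia.
        rewrite !(pow_add _ _ (g + d)), !(pow_add _ g (i - g)).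
        replace (rho ^ (i - g + m) * rho ^ (g + d) / rho ^ (g + d)) with (rho ^ (i - g + m))
          by (field; specialize (Pr (g + d)%nat); lra).
        apply Rle_trans with (Cmod z ^ g * r ^ (i - g + m)).
        + rewrite Rmult_assoc. apply Rmult_le_compat_l; [apply pow_le; lra|].
          rewrite pow_add. apply Rmult_le_compat; try (apply pow_le; lra); apply pow_incr; lra.
        + replace (r / rho * Cmod z ^ g * rho ^ (i - g + m)) with
            (Cmod z ^ g * (r / rho * rho ^ (i - g + m))) by ring.
          apply Rmult_le_compat_l; [apply pow_le; lra|]. apply Hrr.
          destruct (Nat.eq_dec m 0); [|lia]. destruct (Nat.eq_dec i g); [|lia].
          exfalso. apply Hij. f_equal; lia.
      (* For i < g the edge inequality forces j > d. Each of the m surplus factors w contributes r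
         |z|^l1, and the same inequality covers the g - i missing powers of z. *)
      - assert (Hm : (1 <= m)%nat).
        { destruct (Nat.eq_dec m 0) as [e|]; [|lia]. exfalso.
          rewrite e, Nat.add_0_r in Ej. subst j. apply lt_INR in Hi. lra. }
        apply Rle_trans with (r ^ m * Cmod z ^ g).
        + apply Rle_trans with (Cmod z ^ i * (r * Rpower (Cmod z) l1) ^ m).
          * apply Rmult_le_compat_l; [apply pow_le; lra|]. apply pow_incr; lra.
          * rewrite Rpow_mult_distr, Rpower_mult_pow by exact Hzp.
            rewrite <- (Rpower_pow i), <- (Rpower_pow g) by exact Hzp.
            replace (Rpower (Cmod z) (INR i) * (r ^ m * Rpower (Cmod z) (l1 * INR m))) with
              (r ^ m * (Rpower (Cmod z) (INR i) * Rpower (Cmod z) (l1 * INR m))) by ring.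
            rewrite <- Rpower_plus. apply Rmult_le_compat_l; [apply pow_le; lra|].
            apply Rpower_le_lt1; [lra|]. rewrite Ej, plus_INR in He. lra.
        + replace (r / rho * Cmod z ^ g * (rho ^ (i + j) / rho ^ (g + d))) with
            ((r / rho * (rho ^ (i + j) / rho ^ (g + d))) * Cmod z ^ g) by ring.
          apply Rmult_le_compat_r; [apply pow_le; lra|].
          eapply Rle_trans; [apply (Hrr m Hm)|]. apply Rmult_le_compat_l; [lra|].
          apply (Rmult_le_reg_r (rho ^ (g + d))); [apply Pr|].
          unfold Rdiv. rewrite Rmult_assoc, Rinv_l, Rmult_1_r by (specialize (Pr (g + d)%nat); lra).
          rewrite <- pow_add. apply pow_le_lt1; [lra|lia]. }
    rewrite Ej at 1. rewrite pow_add.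
    apply Rle_trans with (Cmod w ^ d * (Cmod z ^ i * Cmod w ^ m)); [right; ring|].
    eapply Rle_trans; [apply Rmult_le_compat_l; [exact Hwd|exact Core]|].
    right. rewrite !pow_add. simpl. field. assert (Pg := Pr g). assert (Pd := Pr d).
    repeat split; lra. }
  exists ((M + 1) / rho ^ (g + d + 1)), rho.
  split; [apply Rdiv_lt_0_compat; [lra|apply Pr]|]. split; [exact Hrho|].
  intros r z w Hr Hz0 Hz Hw.
  assert (Hzp := proj1 (Cmod_gt_0 z) Hz0).
  assert (HL1 : Rpower (Cmod z) l1 <= 1).
  { rewrite <- (Rpower_O (Cmod z)) by exact Hzp. apply Rpower_le_lt1; lra. }
  assert (HP : 0 <= Cmod z ^ g * Cmod w ^ d) by (apply Rmult_le_pos; apply pow_le, Cmod_ge_0).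
  assert (HI : 0 < / rho ^ (g + d + 1)) by apply Rinv_0_lt_compat, Pr.
  assert (Hk : 0 <= r / rho ^ (g + d + 1) * (Cmod z ^ g * Cmod w ^ d)).
  { apply Rmult_le_pos; [|exact HP]. apply Rmult_le_pos; lra. }
  eapply Rle_trans; [apply (HT z w g d _ Hk)|].
  - lra.
  - assert (Rpower (Cmod z) l1 > 0) by apply exp_pos. nra.
  - intros i j Hb Hij. apply (Hdom r z w i j); assumption.
  - unfold Rdiv in *. replace ((M + 1) * / rho ^ (g + d + 1) * r * (Cmod z ^ g * Cmod w ^ d))
      with (r * / rho ^ (g + d + 1) * (Cmod z ^ g * Cmod w ^ d) * (M + 1)) by ring.
    apply Rmult_le_compat_l; lra.
Qed.

(** [taylor_bound] with kappa = 0: at the origin all nonconstant monomials vanish. *)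
Lemma q_origin : b 0%nat 0%nat = 0%C -> q 0%C 0%C = 0%C.
Proof.
  intros H0. destruct (taylor_bound q b Hqb) as (rho & M & Hrho & HM & HT).
  apply Cmod_eq_0, Rle_antisym; [|apply Cmod_ge_0].
  replace (q 0%C 0%C) with (q 0 0 - b 0%nat 0%nat * Cpow 0 0 * Cpow 0 0)%C
    by (rewrite H0; ring).
  apply Rle_trans with (0 * M); [|lra].
  apply HT; rewrite ?Cmod_0; try lra.
  intros i j _ Hij. destruct i as [|i]; [destruct j as [|j]; [congruence|]|]; simpl; lra.
Qed.

Lemma q_axis_zero : (1 <= d)%nat -> exists eps, 0 < eps /\ forall z : C, Cmod z < eps -> q z 0%C = 0%C.
Proof.
  clear l1 Hl1 Hedge. intros Hd1.
  destruct (taylor_bound q b Hqb) as (rho & M & Hrho & HM & HT).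
  exists rho. split; [lra|]. intros z Hz.
  apply Cmod_eq_0, Rle_antisym; [|apply Cmod_ge_0].
  replace (q z 0%C) with (q z 0 - b g d * Cpow z g * Cpow 0 d)%C
    by (destruct d; [lia|]; rewrite Cpow_S; ring).
  apply Rle_trans with (0 * M); [|lra].
  apply HT; rewrite ?Cmod_0; try lra.
  intros i j Hb Hij. specialize (Hd i j Hb). destruct j as [|j]; [lia|]. simpl. lra.
Qed.

Hypothesis Hb00 : b 0%nat 0%nat = 0%C.

(** The weight of the last vertex when w has weight 1 and z has weight 1 / l1, which equals the
    intercept of the last edge. *)
Let T := INR g / l1 + INR d.

(** Outside the wedge z is at most K |w|^(1/l1), which turns the monomial into a power of |w| with
    exponent at least T. Comparing y with w0 >= y keeps the weights rho^(i + j) that [taylor_bound]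
    asks for. *)
Lemma weighted_monomial x y K w0 rho i j :
  0 <= x -> 0 < y <= w0 -> w0 <= rho -> rho < 1 -> 0 < K -> K * Rpower w0 (/ l1) <= rho ->
  x <= K * Rpower y (/ l1) -> b i j <> 0%C ->
  x ^ i * y ^ j <= Rpower y T / Rpower w0 T * rho ^ (i + j).
Proof.
  intros Hx Hy Hw0 Hrho HK HKw HxK Hb.
  assert (Hw0p : 0 < w0) by lra.
  assert (HT : T <= / l1 * INR i + INR j).
  { assert (He := Hedge i j Hb). unfold T.
    apply (Rmult_le_reg_l l1); [exact Hl1|].
    replace (l1 * (INR g / l1 + INR d)) with (INR g + l1 * INR d) by (field; lra).
    replace (l1 * (/ l1 * INR i + INR j)) with (INR i + l1 * INR j) by (field; lra). exact He. }
  assert (Hmon : forall a, 0 < a -> (Rpower a (/ l1)) ^ i * a ^ j = Rpower a (/ l1 * INR i + INR j)).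
  { intros a Ha. rewrite Rpower_plus, Rpower_pow, Rpower_mult_pow by exact Ha. reflexivity. }
  assert (Hratio : Rpower y (/ l1 * INR i + INR j) / Rpower y T
    <= Rpower w0 (/ l1 * INR i + INR j) / Rpower w0 T).
  { unfold Rdiv. rewrite <- !Rpower_Ropp, <- !Rpower_plus.
    apply Rle_Rpower_l; lra. }
  assert (Py : 0 < Rpower y T) by apply exp_pos.
  assert (Pw : 0 < Rpower w0 T) by apply exp_pos.
  apply Rle_trans with ((K * Rpower y (/ l1)) ^ i * y ^ j).
  { apply Rmult_le_compat_r; [apply pow_le; lra|]. apply pow_incr. lra. }
  rewrite Rpow_mult_distr, Rmult_assoc, Hmon by lra.
  apply Rle_trans with (K ^ i * (Rpower y T * (Rpower w0 (/ l1 * INR i + INR j) / Rpower w0 T))).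
  { apply Rmult_le_compat_l; [apply pow_le; lra|].
    apply (Rmult_le_compat_l (Rpower y T)) in Hratio; [|lra].
    eapply Rle_trans; [|exact Hratio]. right. field. lra. }
  rewrite <- Hmon by lra.
  replace (K ^ i * (Rpower y T * (Rpower w0 (/ l1) ^ i * w0 ^ j / Rpower w0 T)))
    with (Rpower y T / Rpower w0 T * ((K * Rpower w0 (/ l1)) ^ i * w0 ^ j))
    by (rewrite Rpow_mult_distr; field; lra).
  apply Rmult_le_compat_l; [apply Rmult_le_pos; [lra|left; apply Rinv_0_lt_compat, Pw]|].
  rewrite pow_add. assert (Rpower w0 (/ l1) > 0) by apply exp_pos.
  apply Rmult_le_compat; try (apply pow_le); try apply pow_incr; try split; try lra; apply Rmult_le_pos; lra.
Qed.

Lemma root_bound r x y : 0 < r -> 0 <= x -> 0 < y -> r * powR0 x l1 <= y ->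
  x <= Rpower (/ r) (/ l1) * Rpower y (/ l1).
Proof.
  intros Hr Hx Hy H. assert (Hi := Rinv_0_lt_compat _ Hr).
  unfold powR0 in H. destruct (Req_EM_T x 0) as [->|Hx0].
  - left. apply Rmult_lt_0_compat; apply exp_pos.
  - rewrite Rpower_mult_distr by assumption.
    replace x with (Rpower (Rpower x l1) (/ l1))
      by (rewrite Rpower_mult, Rinv_r, Rpower_1; lra).
    apply Rle_Rpower_l; [left; apply Rinv_0_lt_compat, Hl1|]. split; [apply exp_pos|].
    apply (Rmult_le_reg_l r); [exact Hr|].
    replace (r * (/ r * y)) with y by (field; lra). exact H.
Qed.

Lemma small_radius K rho : 0 < K -> 0 < rho -> exists w0, 0 < w0 <= rho /\ K * Rpower w0 (/ l1) <= rho.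
Proof.
  intros HK Hrho. assert (Hq : 0 < rho / K) by (apply Rdiv_lt_0_compat; lra).
  exists (Rmin rho (Rpower (rho / K) l1)).
  assert (H0 : 0 < Rmin rho (Rpower (rho / K) l1)) by (apply Rmin_glb_lt; [lra|apply exp_pos]).
  split; [split; [exact H0|apply Rmin_l]|].
  apply Rle_trans with (K * Rpower (Rpower (rho / K) l1) (/ l1));
    [|rewrite Rpower_mult, Rinv_r, Rpower_1 by lra; right; field; lra].
  apply Rmult_le_compat_l; [lra|]. apply Rle_Rpower_l; [left; apply Rinv_0_lt_compat, Hl1|].
  split; [exact H0|apply Rmin_r].
Qed.

(** [powR0] lets z = 0 into the estimate, as orbits on the fibre z = 0 require. *)
Lemma outer_bound r : 0 < r -> exists K eps, 0 < K /\ 0 < eps < 1 /\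
  forall z w : C, w <> 0%C -> Cmod w < eps -> r * powR0 (Cmod z) l1 <= Cmod w ->
    Cmod (q z w) <= K * Rpower (Cmod w) T.
Proof.
  intros Hr. destruct (taylor_bound q b Hqb) as (rho & M & Hrho & HM & HT).
  set (K := Rpower (/ r) (/ l1)). assert (HK : 0 < K) by apply exp_pos.
  destruct (small_radius K rho HK ltac:(lra)) as (w0 & Hw0 & HKw).
  assert (Pw : 0 < Rpower w0 T) by apply exp_pos.
  exists ((M + 1) / Rpower w0 T), w0. split; [apply Rdiv_lt_0_compat; lra|]. split; [lra|].
  intros z w Hw Hws Hzw. assert (Hwp := proj1 (Cmod_gt_0 w) Hw).
  assert (Hz := root_bound r (Cmod z) (Cmod w) Hr (Cmod_ge_0 z) Hwp Hzw). fold K in Hz.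
  assert (Pyw : 0 < Rpower (Cmod w) T) by apply exp_pos.
  assert (Hk : 0 <= Rpower (Cmod w) T / Rpower w0 T) by (left; apply Rdiv_lt_0_compat; lra).
  (* The subtracted term has coefficient b_00 = 0, so the bound is one on q itself. *)
  replace (q z w) with (q z w - b 0%nat 0%nat * Cpow z 0 * Cpow w 0)%C by (rewrite Hb00; ring).
  eapply Rle_trans; [apply (HT z w 0%nat 0%nat _ Hk)|].
  - eapply Rle_trans; [exact Hz|]. eapply Rle_trans; [|exact HKw].
    apply Rmult_le_compat_l; [lra|]. apply Rle_Rpower_l; [left; apply Rinv_0_lt_compat, Hl1|lra].
  - lra.
  - intros i j Hb _. apply (weighted_monomial _ _ K w0); try assumption; try lra. apply Cmod_ge_0.
  - unfold Rdiv. replace ((M + 1) * / Rpower w0 T * Rpower (Cmod w) T)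
      with (Rpower (Cmod w) T * / Rpower w0 T * (M + 1)) by ring.
    apply Rmult_le_compat_l; [exact Hk|lra].
Qed.

(** With u = |z| / |w|^(1/l1) <= 1, a monomial with i >= 1 gains u^i <= u over the weighted bound,
    and one with i = 0 has exponent at least T + 1 and gains |w|. *)
Lemma outer_bound_critical : (forall j, b 0%nat j <> 0%C -> T + 1 <= INR j) ->
  exists K eps, 0 < K /\ 0 < eps < 1 /\
  forall z w : C, w <> 0%C -> Cmod w < eps -> powR0 (Cmod z) l1 <= Cmod w ->
    Cmod (q z w) <= K * Rpower (Cmod w) T * (Cmod z / Rpower (Cmod w) (/ l1) + Cmod w).
Proof.
  intros H0. destruct (taylor_bound q b Hqb) as (rho & M & Hrho & HM & HT).
  destruct (small_radius 1 rho Rlt_0_1 ltac:(lra)) as (w0 & Hw0 & HKw).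
  assert (Pw : 0 < Rpower w0 T) by apply exp_pos.
  exists ((M + 1) * (/ (Rpower w0 T * w0))), w0.
  assert (HI : 0 < / (Rpower w0 T * w0)) by (apply Rinv_0_lt_compat, Rmult_lt_0_compat; lra).
  split; [apply Rmult_lt_0_compat; lra|]. split; [lra|].
  intros z w Hw Hws Hzw. assert (Hwp := proj1 (Cmod_gt_0 w) Hw).
  assert (Hz := root_bound 1 (Cmod z) (Cmod w) Rlt_0_1 (Cmod_ge_0 z) Hwp ltac:(lra)).
  rewrite Rinv_1 in Hz. unfold Rpower in Hz at 1. rewrite ln_1, Rmult_0_r, exp_0, Rmult_1_l in Hz.
  set (t := Rpower (Cmod w) (/ l1)) in *. assert (Ht : 0 < t) by apply exp_pos.
  assert (Hzp := Cmod_ge_0 z).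
  set (u := Cmod z / t). assert (Hu : 0 <= u) by (apply Rmult_le_pos; [lra|left; apply Rinv_0_lt_compat, Ht]).
  assert (Ezu : Cmod z = u * t) by (unfold u; field; lra).
  assert (Hu1 : u <= 1) by (apply (Rmult_le_reg_r t); lra).
  assert (Pyw : 0 < Rpower (Cmod w) T) by apply exp_pos.
  (* The second w0 in the denominator pays for the factor |w| gained by pure powers of w; since w0 <
     1 it only weakens the bound on the other monomials. *)
  set (kappa := Rpower (Cmod w) T * / (Rpower w0 T * w0) * (u + Cmod w)).
  assert (Hkp : 0 < Rpower (Cmod w) T * / (Rpower w0 T * w0)) by (apply Rmult_lt_0_compat; lra).
  assert (Hk : 0 <= kappa) by (apply Rmult_le_pos; lra).
  replace (q z w) with (q z w - b 0%nat 0%nat * Cpow z 0 * Cpow w 0)%C by (rewrite Hb00; ring).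
  eapply Rle_trans; [apply (HT z w 0%nat 0%nat _ Hk)|].
  - eapply Rle_trans; [exact Hz|]. rewrite Rmult_1_l in HKw. eapply Rle_trans; [|exact HKw].
    apply Rle_Rpower_l; [left; apply Rinv_0_lt_compat, Hl1|lra].
  - lra.
  - intros i j Hb _. rewrite pow_add.
    assert (Pij : 0 < rho ^ i * rho ^ j) by (apply Rmult_lt_0_compat; apply pow_lt; lra).
    assert (Hinv : / Rpower w0 T <= / (Rpower w0 T * w0)).
    { apply Rinv_le_contravar; [apply Rmult_lt_0_compat; lra|]. nra. }
    destruct i as [|i].
    + assert (Hj := H0 j Hb).
      apply Rle_trans with (Rpower (Cmod w) T * / (Rpower w0 T * w0) * Cmod w * (rho ^ 0 * rho ^ j)).
      * rewrite !pow_O, !Rmult_1_l.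
        assert (R1 : Rpower (Cmod w) (INR j - T - 1) <= Rpower w0 (INR j - T - 1)) by (apply Rle_Rpower_l; lra).
        assert (E : forall x, 0 < x -> x ^ j = Rpower x T * x * Rpower x (INR j - T - 1)).
        { intros x Hx. rewrite <- (Rpower_1 x Hx) at 3. rewrite <- !Rpower_plus, <- Rpower_pow by exact Hx.
          f_equal. ring. }
        rewrite (E (Cmod w) Hwp).
        apply Rle_trans with (Rpower (Cmod w) T * Cmod w * Rpower w0 (INR j - T - 1)).
        { apply Rmult_le_compat_l; [apply Rmult_le_pos; lra|exact R1]. }
        apply Rle_trans with (Rpower (Cmod w) T * / (Rpower w0 T * w0) * Cmod w * w0 ^ j).
        { rewrite (E w0) by lra. right. field. lra. }
        apply Rmult_le_compat_l; [apply Rmult_le_pos; lra|]. apply pow_incr; lra.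
      * apply Rmult_le_compat_r; [lra|]. unfold kappa. apply Rmult_le_compat_l; lra.
    + assert (Hm := weighted_monomial t (Cmod w) 1 w0 rho (S i) j (Rlt_le _ _ Ht) ltac:(lra)
        ltac:(lra) ltac:(lra) Rlt_0_1 HKw ltac:(unfold t; lra) Hb).
      rewrite pow_add in Hm.
      apply Rle_trans with (u * (t ^ S i * Cmod w ^ j)).
      * rewrite Ezu, Rpow_mult_distr.
        replace (u ^ S i * t ^ S i * Cmod w ^ j) with (u ^ S i * (t ^ S i * Cmod w ^ j)) by ring.
        apply Rmult_le_compat_r; [apply Rmult_le_pos; apply pow_le; lra|].
        rewrite <- (pow_1 u) at 2. apply pow_le_lt1; [lra|lia].
      * apply Rle_trans with (u * (Rpower (Cmod w) T / Rpower w0 T * (rho ^ S i * rho ^ j))).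
        { apply Rmult_le_compat_l; assumption. }
        rewrite <- Rmult_assoc. apply Rmult_le_compat_r; [lra|]. unfold kappa, Rdiv.
        apply Rle_trans with (Rpower (Cmod w) T * / (Rpower w0 T * w0) * u).
        { rewrite (Rmult_comm u). apply Rmult_le_compat_r; [exact Hu|]. apply Rmult_le_compat_l; lra. }
        apply Rmult_le_compat_l; lra.
  - unfold kappa. fold u.
    replace ((M + 1) * / (Rpower w0 T * w0) * Rpower (Cmod w) T * (u + Cmod w))
      with (Rpower (Cmod w) T * / (Rpower w0 T * w0) * (u + Cmod w) * (M + 1)) by ring.
    apply Rmult_le_compat_l; [exact Hk|lra].
Qed.
End Estimates.

(** * Real sequences *)

Lemma geometric_differences_converge v C k N : 0 <= k < 1 ->
  (forall n, (N <= n)%nat -> Rabs (v (S n) - v n) <= C * k ^ n) ->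
  exists L : R, is_lim_seq v L.
Proof.
  intros Hk H.
  assert (Hs : ex_series (fun n => v (S (n + N)) - v (n + N)%nat)).
  { apply (ex_series_le (K := R_AbsRing) (V := R_CompleteNormedModule) _ (fun n => C * k ^ N * k ^ n)).
    - intros n. eapply Rle_trans; [apply H; lia|]. rewrite pow_add. right. ring.
    - apply (ex_series_scal_l (V := R_NormedModule) (C * k ^ N) (fun n => k ^ n)).
      exists (/ (1 - k)). apply is_series_geom. rewrite Rabs_right; lra. }
  destruct Hs as [l Hl]. exists (l + v N).
  apply is_lim_seq_incr_n with N. apply is_lim_seq_incr_1.
  apply is_lim_seq_ext with (fun n => sum_n (fun n => v (S (n + N)) - v (n + N)%nat) n + v N).
  - induction n as [|n IH].
    + rewrite sum_O. simpl. ring.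
    + rewrite sum_Sn. change (plus ?a ?b) with (a + b). simpl Nat.add in *. lra.
  - apply (is_lim_seq_plus' _ (fun _ => v N)); [exact Hl|apply is_lim_seq_const].
Qed.

(** After division by lam^n the increments are geometric with ratio mu / lam < 1. *)
Lemma linear_recurrence_converges u lam mu C N : 1 < lam -> 0 <= mu < lam ->
  (forall n, (N <= n)%nat -> Rabs (u (S n) - lam * u n) <= C * mu ^ n) ->
  exists L : R, is_lim_seq (fun n => / lam ^ n * u n) L.
Proof.
  intros Hl Hmu H.
  apply (geometric_differences_converge _ (C / lam) (mu / lam) N).
  - split; [apply Rmult_le_pos; [lra|left; apply Rinv_0_lt_compat; lra]|].
    apply (Rmult_lt_reg_r lam); [lra|]. unfold Rdiv. rewrite Rmult_assoc, Rinv_l; lra.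
  - intros n Hn. specialize (H n Hn). assert (P : 0 < lam ^ n) by (apply pow_lt; lra).
    replace (/ lam ^ S n * u (S n) - / lam ^ n * u n)
      with (/ lam ^ S n * (u (S n) - lam * u n)) by (simpl; field; lra).
    assert (PS : 0 < / lam ^ S n) by (apply Rinv_0_lt_compat, pow_lt; lra).
    rewrite Rabs_mult, (Rabs_right (/ _)) by lra.
    apply (Rmult_le_compat_l (/ lam ^ S n)) in H; [|lra].
    eapply Rle_trans; [exact H|]. unfold Rdiv at 2. rewrite Rpow_mult_distr, pow_inv.
    right. simpl. field. lra.
Qed.

Lemma contraction_to_0 v e k N : 0 <= k < 1 -> (forall n, 0 <= v n) -> is_lim_seq e 0 ->
  (forall n, (N <= n)%nat -> v (S n) <= k * v n + e n) -> is_lim_seq v 0.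
Proof.
  intros Hk Hv He H. apply is_lim_seq_spec. intros eps.
  assert (Hep := cond_pos eps). set (eta := eps / 2).
  apply is_lim_seq_spec in He.
  (* This tolerance makes eta the fixed point of v -> k v + eta (1 - k). *)
  destruct (He (mkposreal (eta * (1 - k)) ltac:(unfold eta; apply Rmult_lt_0_compat; lra))) as [N1 HN1].
  simpl in HN1. set (N2 := Nat.max N N1).
  assert (Hdec : forall m, v (N2 + m)%nat - eta <= k ^ m * (v N2 + 1)).
  { induction m as [|m IH].
    - rewrite Nat.add_0_r. simpl. unfold eta. lra.
    - rewrite Nat.add_succ_r. assert (Hn := H (N2 + m)%nat ltac:(lia)).
      assert (Hen := HN1 (N2 + m)%nat ltac:(lia)). rewrite Rminus_0_r in Hen.
      apply Rabs_def2 in Hen. simpl.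
      apply (Rmult_le_compat_l k) in IH; [|lra]. lra. }
  assert (Hg : is_lim_seq (fun m => k ^ m * (v N2 + 1)) 0).
  { replace (Finite 0) with (Rbar_mult 0 (v N2 + 1)) by (simpl; f_equal; ring).
    apply is_lim_seq_scal_r, is_lim_seq_geom. rewrite Rabs_right; lra. }
  apply is_lim_seq_spec in Hg.
  destruct (Hg (mkposreal eta ltac:(unfold eta; lra))) as [N3 HN3]. simpl in HN3.
  exists (N2 + N3)%nat. intros n Hn. specialize (HN3 (n - N2)%nat ltac:(lia)).
  specialize (Hdec (n - N2)%nat). replace (N2 + (n - N2))%nat with n in Hdec by lia.
  rewrite Rminus_0_r in *. apply Rabs_def2 in HN3. rewrite Rabs_right by (apply Rle_ge, Hv).
  unfold eta in *. lra.
Qed.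

Lemma inv_pow_lim_0 lam C : 1 < lam -> is_lim_seq (fun n => C * / lam ^ n) 0.
Proof.
  intros Hl. replace (Finite 0) with (Rbar_mult C 0) by (simpl; f_equal; ring).
  apply is_lim_seq_scal_l. apply is_lim_seq_ext with (fun n => (/ lam) ^ n).
  - intros n. apply pow_inv.
  - apply is_lim_seq_geom. rewrite Rabs_right.
    + rewrite <- Rinv_1. apply Rinv_lt_contravar; lra.
    + left. apply Rinv_0_lt_compat. lra.
Qed.

Lemma slow_recurrence_negligible y k lam C N : 0 <= k < lam -> 1 < lam ->
  (forall n, (N <= n)%nat -> Rabs (y (S n)) <= k * Rabs (y n) + C) ->
  is_lim_seq (fun n => / lam ^ n * y n) 0.
Proof.
  intros Hk Hl H. apply is_lim_seq_abs_0.
  apply (contraction_to_0 _ (fun n => C / lam * / lam ^ n) (k / lam) N).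
  - split; [apply Rmult_le_pos; [lra|left; apply Rinv_0_lt_compat; lra]|].
    apply (Rmult_lt_reg_r lam); [lra|]. unfold Rdiv. rewrite Rmult_assoc, Rinv_l; lra.
  - intros n. apply Rabs_pos.
  - apply inv_pow_lim_0, Hl.
  - intros n Hn. specialize (H n Hn). assert (P : 0 < lam ^ n) by (apply pow_lt; lra).
    assert (PS : 0 < / lam ^ S n) by (apply Rinv_0_lt_compat, pow_lt; lra).
    assert (PN : 0 < / lam ^ n) by (apply Rinv_0_lt_compat; lra).
    rewrite !Rabs_mult, (Rabs_right (/ lam ^ n)), (Rabs_right (/ lam ^ S n)) by lra.
    apply (Rmult_le_compat_l (/ lam ^ S n)) in H; [|lra].
    eapply Rle_trans; [exact H|]. right. simpl. field. lra.
Qed.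

(** T >= 2 absorbs the constant: T u + 2 C <= T (u + C), so u + C is multiplied by at least T in
    size once it is negative. *)
Lemma fast_decrease u T C N m : 2 <= T -> 0 <= C ->
  (forall n, (N <= n)%nat -> u (S n) <= T * u n + C) -> (N <= m)%nat -> u m < - C ->
  exists c, 0 < c /\ forall n, (m <= n)%nat -> u n <= - c * T ^ n.
Proof.
  intros HT HC H Hm Hum.
  assert (P : forall n, 0 < T ^ n) by (intros; apply pow_lt; lra).
  exists (- (u m + C) / T ^ m). split; [apply Rdiv_lt_0_compat; [lra|apply P]|].
  intros n Hn. replace n with (m + (n - m))%nat by lia.
  assert (G : u (m + (n - m))%nat + C <= (u m + C) * T ^ (n - m)).
  { induction (n - m)%nat as [|j IH].
    - rewrite Nat.add_0_r. simpl. lra.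
    - rewrite Nat.add_succ_r. assert (X := H (m + j)%nat ltac:(lia)). simpl.
      apply (Rmult_le_compat_l T) in IH; [|lra].
      apply Rle_trans with (T * (u (m + j)%nat + C)); [|lra].
      assert (2 * C <= T * C) by (apply Rmult_le_compat_r; lra). lra. }
  rewrite pow_add. replace (- (- (u m + C) / T ^ m) * (T ^ m * T ^ (n - m)))
    with ((u m + C) * T ^ (n - m)) by (field; specialize (P m); lra). lra.
Qed.

Lemma superexponential_decrease u T del C N : 2 <= del -> del < T -> 0 <= C ->
  (forall n, (N <= n)%nat -> u (S n) <= T * u n + C) ->
  (exists m, (N <= m)%nat /\ u m < - C) ->
  is_lim_seq (fun n => / del ^ n * u n) m_infty.
Proof.
  intros Hd HT HC H (m & Hm & Hum).
  destruct (fast_decrease u T C N m ltac:(lra) HC H Hm Hum) as (c & Hc & Hu).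
  apply (is_lim_seq_le_m_loc (fun n => - c * (T / del) ^ n)).
  - exists m. intros n Hn. specialize (Hu n Hn). assert (P : 0 < del ^ n) by (apply pow_lt; lra).
    apply (Rmult_le_compat_l (/ del ^ n)) in Hu; [|left; apply Rinv_0_lt_compat, P].
    eapply Rle_trans; [exact Hu|]. unfold Rdiv. rewrite Rpow_mult_distr, pow_inv. right. ring.
  - replace m_infty with (Rbar_mult (- c) p_infty).
    + apply is_lim_seq_scal_l, is_lim_seq_geom_p.
      apply (Rmult_lt_reg_r del); [lra|]. unfold Rdiv. rewrite Rmult_assoc, Rinv_l; lra.
    + simpl. destruct (Rle_dec 0 (- c)); [exfalso; lra|reflexivity].
Qed.

Lemma linear_decrease v eta N : 0 < eta -> (forall n, (N <= n)%nat -> v (S n) <= v n - eta) ->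
  is_lim_seq v m_infty.
Proof.
  intros He H. apply is_lim_seq_incr_n with N.
  apply (is_lim_seq_le_m_loc (fun n => v N + - eta * INR n)).
  - exists O. intros n _. induction n as [|n IH].
    + simpl. lra.
    + assert (X := H (n + N)%nat ltac:(lia)). rewrite S_INR. simpl. lra.
  - apply (is_lim_seq_plus _ _ (v N) m_infty); [apply is_lim_seq_const| |reflexivity].
    replace m_infty with (Rbar_mult (- eta) p_infty).
    + apply is_lim_seq_scal_l, is_lim_seq_INR.
    + simpl. destruct (Rle_dec 0 (- eta)); [exfalso; lra|reflexivity].
Qed.

Lemma scaled_bounded (u : nat -> R) lam (L : R) : 1 < lam -> is_lim_seq (fun n => / lam ^ n * u n) L ->
  exists B N, 0 < B /\ forall n, (N <= n)%nat -> Rabs (u n) <= B * lam ^ n.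
Proof.
  intros Hl H. apply is_lim_seq_spec in H. destruct (H (mkposreal 1 Rlt_0_1)) as [N HN].
  simpl in HN. exists (Rabs L + 1), N. assert (P := Rabs_pos L). split; [lra|].
  intros n Hn. specialize (HN n Hn). assert (Pn : 0 < lam ^ n) by (apply pow_lt; lra).
  replace (u n) with ((/ lam ^ n * u n - L + L) * lam ^ n) by (field; lra).
  rewrite Rabs_mult, (Rabs_right (lam ^ n)) by lra.
  apply Rmult_le_compat_r; [lra|]. eapply Rle_trans; [apply Rabs_triang|]. lra.
Qed.

Lemma Rbar_seq_lim_of_lim (f : nat -> Rbar) (x : nat -> R) (l : Rbar) N :
  (forall n, (N <= n)%nat -> f n = Finite (x n)) -> is_lim_seq x l -> Rbar_seq_lim f l.
Proof.
  intros Hf Hx. apply is_lim_seq_spec in Hx. destruct l as [l| |]; simpl in *.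
  - intros eps He. destruct (Hx (mkposreal eps He)) as [N1 HN1].
    exists (Nat.max N N1). intros n Hn. exists (x n). split; [apply Hf; lia|apply HN1; lia].
  - intros M. destruct (Hx M) as [N1 HN1]. exists (Nat.max N N1). intros n Hn.
    rewrite Hf by lia. apply HN1. lia.
  - intros M. destruct (Hx M) as [N1 HN1]. exists (Nat.max N N1). intros n Hn.
    rewrite Hf by lia. apply HN1. lia.
Qed.

Lemma scaled_logb_lim (x : nat -> R) lam l N : (forall n, (N <= n)%nat -> 0 < x n) ->
  is_lim_seq (fun n => / lam ^ n * ln (x n)) l ->
  Rbar_seq_lim (fun n => scaleb (/ lam ^ n) (logb (x n))) l.
Proof.
  intros Hx H. apply (Rbar_seq_lim_of_lim _ (fun n => / lam ^ n * ln (x n)) _ N); [|exact H].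
  intros n Hn. unfold scaleb, logb. destruct (Rlt_dec 0 (x n)) as [_|h]; [reflexivity|].
  exfalso. apply h, Hx, Hn.
Qed.

Lemma scaled_logb_lim_zero (x : nat -> R) lam N : 0 < lam -> (forall n, (N <= n)%nat -> x n = 0) ->
  Rbar_seq_lim (fun n => scaleb (/ lam ^ n) (logb (x n))) m_infty.
Proof.
  intros Hl Hx M. exists N. intros n Hn. rewrite (Hx n Hn). unfold logb.
  destruct (Rlt_dec 0 0) as [h|_]; [lra|].
  assert (P : 0 < / lam ^ n) by (apply Rinv_0_lt_compat, pow_lt, Hl).
  unfold scaleb. simpl. destruct (Rle_dec 0 (/ lam ^ n)) as [r|r]; [|lra].
  destruct (Rle_lt_or_eq_dec 0 (/ lam ^ n) r) as [|e]; [exact I|lra].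
Qed.

Lemma Rbar_seq_lim_ext (f g : nat -> Rbar) l N : (forall n, (N <= n)%nat -> f n = g n) ->
  Rbar_seq_lim f l -> Rbar_seq_lim g l.
Proof.
  intros E H. destruct l as [l| |]; simpl in *.
  - intros eps He. destruct (H eps He) as [N1 HN]. exists (Nat.max N N1). intros n Hn.
    rewrite <- E by lia. apply HN. lia.
  - intros M. destruct (H M) as [N1 HN]. exists (Nat.max N N1). intros n Hn.
    rewrite <- E by lia. apply HN. lia.
  - intros M. destruct (H M) as [N1 HN]. exists (Nat.max N N1). intros n Hn.
    rewrite <- E by lia. apply HN. lia.
Qed.

(** * Logarithmic rates *)

Definition logmod (u : nat -> C) (n : nat) : R := ln (Cmod (u n)).

Definition eventually_zero (u : nat -> C) : Prop := exists N, forall n, (N <= n)%nat -> u n = 0%C.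

Lemma ln_Rpower x y : ln (Rpower x y) = y * ln x.
Proof. apply ln_exp. Qed.

Section Rates.
Variables (delta d g : nat) (z w : nat -> C) (L : R) (N : nat) (M : R).
Hypothesis Hdelta : 2 <= INR delta.
Hypothesis HL : is_lim_seq (fun n => / INR delta ^ n * logmod z n) L.
Hypothesis Hw : forall n, (N <= n)%nat ->
  Rabs (logmod w (S n) - INR d * logmod w n - INR g * logmod z n) <= M.

(** The forcing g X is of order delta^n, hence summable at scale d^n; the limit exists without being
    explicit. *)
Lemma rate_delta_lt_d : (delta < d)%nat ->
  exists l : R, is_lim_seq (fun n => / INR d ^ n * logmod w n) l.
Proof.
  intros Hd. apply lt_INR in Hd.
  destruct (scaled_bounded (logmod z) (INR delta) L ltac:(lra) HL) as (B & N1 & HB & Hb).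
  assert (Pg := pos_INR g).
  apply (linear_recurrence_converges _ (INR d) (INR delta) (M + INR g * B) (Nat.max N N1)); [lra|lra|].
  intros n Hn. specialize (Hw n ltac:(lia)). specialize (Hb n ltac:(lia)).
  replace (logmod w (S n) - INR d * logmod w n) with
    ((logmod w (S n) - INR d * logmod w n - INR g * logmod z n) + INR g * logmod z n) by ring.
  eapply Rle_trans; [apply Rabs_triang|]. rewrite (Rabs_mult (INR g)), (Rabs_right (INR g)) by lra.
  apply (Rmult_le_compat_l (INR g)) in Hb; [|exact Pg].
  assert (P1 : 1 <= INR delta ^ n) by (apply pow_R1_Rle; lra).
  assert (HM : 0 <= M) by (eapply Rle_trans; [apply Rabs_pos|exact Hw]).
  assert (M * 1 <= M * INR delta ^ n) by (apply Rmult_le_compat_l; assumption). lra.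
Qed.

(** Resonance: the forcing is at most - g c delta^n, the scale of the homogeneous solution, so each
    step lowers Y / delta^n by about g c / delta and the decrease accumulates linearly. *)
Lemma rate_delta_eq_d c m : delta = d -> (0 < g)%nat -> 0 < c ->
  (forall n, (m <= n)%nat -> logmod z n <= - c * INR delta ^ n) ->
  is_lim_seq (fun n => / INR delta ^ n * logmod w n) m_infty.
Proof.
  intros Hd Hg Hc Hz. apply lt_INR in Hg. simpl in Hg.
  assert (Hgc : 0 < INR g * c) by (apply Rmult_lt_0_compat; lra).
  set (eta := INR g * c / INR delta).
  assert (Heta : 0 < eta) by (apply Rdiv_lt_0_compat; lra).
  assert (Hl := inv_pow_lim_0 (INR delta) (M / INR delta) ltac:(lra)).
  apply is_lim_seq_spec in Hl. destruct (Hl (mkposreal (eta / 2) ltac:(lra))) as [N1 HN1]. simpl in HN1.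
  apply (linear_decrease _ (eta / 2) (Nat.max (Nat.max N m) N1)); [lra|].
  intros n Hn. specialize (Hw n ltac:(lia)). specialize (Hz n ltac:(lia)). specialize (HN1 n ltac:(lia)).
  rewrite Rminus_0_r in HN1. apply Rabs_def2 in HN1. apply Rabs_le_between in Hw.
  rewrite <- Hd in Hw.
  assert (P : 0 < INR delta ^ n) by (apply pow_lt; lra).
  assert (PS : 0 < / INR delta ^ S n) by (apply Rinv_0_lt_compat, pow_lt; lra).
  apply (Rmult_le_compat_l (INR g)) in Hz; [|lra].
  assert (Q : logmod w (S n) <= INR delta * logmod w n + (M - INR g * c * INR delta ^ n)) by lra.
  apply (Rmult_le_compat_l (/ INR delta ^ S n)) in Q; [|lra].
  replace (/ INR delta ^ S n * (INR delta * logmod w n + (M - INR g * c * INR delta ^ n)))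
    with (/ INR delta ^ n * logmod w n + M / INR delta * / INR delta ^ n - eta) in Q
    by (unfold eta; simpl; field; lra).
  lra.
Qed.

(** Since alpha delta = d alpha + g, alpha X is a particular solution up to bounded error. The
    difference Y - alpha X obeys a recurrence with multiplier d < delta and is negligible at scale
    delta^n. *)
Lemma rate_d_lt_delta M' : (d < delta)%nat ->
  (forall n, (N <= n)%nat -> Rabs (logmod z (S n) - INR delta * logmod z n) <= M') ->
  is_lim_seq (fun n => / INR delta ^ n * logmod w n) (INR g / (INR delta - INR d) * L).
Proof.
  intros Hd Hz. apply lt_INR in Hd. assert (Pd := pos_INR d). assert (Pg := pos_INR g).
  set (alpha := INR g / (INR delta - INR d)).
  assert (Hal : 0 <= alpha) by (apply Rmult_le_pos; [lra|left; apply Rinv_0_lt_compat; lra]).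
  assert (Eg : INR g = alpha * (INR delta - INR d)) by (unfold alpha; field; lra).
  assert (H0 := slow_recurrence_negligible (fun n => logmod w n - alpha * logmod z n) (INR d) (INR delta)
    (M + alpha * M') N ltac:(lra) ltac:(lra)).
  apply (is_lim_seq_ext (fun n => / INR delta ^ n * (logmod w n - alpha * logmod z n)
    + alpha * (/ INR delta ^ n * logmod z n))).
  - intros n. ring.
  - replace (Finite (alpha * L)) with (Finite (0 + alpha * L)) by (f_equal; ring).
    apply is_lim_seq_plus'; [|apply (is_lim_seq_scal_l _ alpha L HL)].
    apply H0. intros n Hn. specialize (Hw n Hn). specialize (Hz n Hn).
    replace (logmod w (S n) - alpha * logmod z (S n)) with
      (INR d * (logmod w n - alpha * logmod z n)
       + ((logmod w (S n) - INR d * logmod w n - INR g * logmod z n)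
       - alpha * (logmod z (S n) - INR delta * logmod z n))) by (rewrite Eg; ring).
    eapply Rle_trans; [apply Rabs_triang|]. rewrite Rabs_mult, (Rabs_right (INR d)) by lra.
    apply Rplus_le_compat_l. eapply Rle_trans; [apply Rabs_triang|]. rewrite Rabs_Ropp, Rabs_mult, (Rabs_right alpha) by lra.
    apply Rplus_le_compat; [exact Hw|]. apply Rmult_le_compat_l; assumption.
Qed.
End Rates.

Lemma is_lim_seq_Rmax (u v : nat -> R) (l : R) : is_lim_seq u l -> is_lim_seq v l ->
  is_lim_seq (fun n => Rmax (u n) (v n)) l.
Proof.
  intros Hu Hv. apply is_lim_seq_spec in Hu, Hv. apply is_lim_seq_spec. intros eps.
  destruct (Hu eps) as [N1 H1]. destruct (Hv eps) as [N2 H2].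
  exists (Nat.max N1 N2). intros n Hn. unfold Rmax. destruct (Rle_dec (u n) (v n)); [apply H2|apply H1]; lia.
Qed.

Lemma ln_Rmax x y : 0 < x -> 0 < y -> ln (Rmax x y) = Rmax (ln x) (ln y).
Proof.
  intros Hx Hy. destruct (Rle_dec x y) as [H|H].
  - rewrite !Rmax_right; [reflexivity|apply ln_le; assumption|exact H].
  - apply Rnot_le_lt in H. rewrite !Rmax_left; [reflexivity|left; apply ln_increasing; assumption|lra].
Qed.

Lemma powR0_0 x : powR0 0 x = 0.
Proof. unfold powR0. destruct (Req_EM_T 0 0); [reflexivity|lra]. Qed.

Lemma powR0_pos x y : 0 < x -> powR0 x y = Rpower x y.
Proof. intros H. unfold powR0. destruct (Req_EM_T x 0); [lra|reflexivity]. Qed.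

Lemma Rbar_mult_pos_m_infty x : 0 < x -> Rbar_mult (Finite x) m_infty = m_infty.
Proof.
  intros H. simpl. destruct (Rle_dec 0 x) as [r|r]; [|lra].
  destruct (Rle_lt_or_eq_dec 0 x r) as [|e]; [reflexivity|lra].
Qed.

Definition log_rate (lam : nat) (x : nat -> R) (l : Rbar) : Prop :=
  Rbar_seq_lim (fun n => scaleb (/ INR lam ^ n) (logb (x n))) l.

Lemma log_rate_ext lam (x y : nat -> R) l N : (forall n, (N <= n)%nat -> x n = y n) ->
  log_rate lam x l -> log_rate lam y l.
Proof.
  intros E. apply (Rbar_seq_lim_ext _ _ _ N). intros n Hn. rewrite (E n Hn). reflexivity.
Qed.

Lemma log_rate_nonzero lam (u : nat -> C) l N : (forall n, (N <= n)%nat -> u n <> 0%C) ->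
  is_lim_seq (fun n => / INR lam ^ n * logmod u n) l -> log_rate lam (fun n => Cmod (u n)) l.
Proof.
  intros Hu H. apply (scaled_logb_lim _ _ _ N); [|exact H]. intros n Hn. apply Cmod_gt_0, Hu, Hn.
Qed.

Lemma log_rate_zero lam (u : nat -> C) : 0 < INR lam -> eventually_zero u ->
  log_rate lam (fun n => Cmod (u n)) m_infty.
Proof.
  intros Hl [N Hu]. apply (scaled_logb_lim_zero _ _ N Hl). intros n Hn. rewrite (Hu n Hn). apply Cmod_0.
Qed.

(** Common outcome of all orbits when d < delta. An eventually zero w beside a nonzero z is allowed
    only for d >= 1, which is why no exceptional set appears for d = 0. *)
Definition escape_rates (delta d : nat) (alpha : R) (z w : nat -> C) : Prop :=
  (eventually_zero z /\ (eventually_zero w \/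
    ((exists N, forall n, (N <= n)%nat -> w n <> 0%C) /\
      is_lim_seq (fun n => / INR delta ^ n * logmod w n) m_infty))) \/
  exists (L : R), (exists N, forall n, (N <= n)%nat -> z n <> 0%C) /\
    is_lim_seq (fun n => / INR delta ^ n * logmod z n) L /\
    (((1 <= d)%nat /\ eventually_zero w) \/
     ((exists N, forall n, (N <= n)%nat -> w n <> 0%C) /\
      is_lim_seq (fun n => / INR delta ^ n * logmod w n) (alpha * L))).

(** The last clause serves all d at once: its premise is void for d = 0 and excludes the exceptional
    set for d >= 1. Positivity of alpha is what sends minus infinity to itself under scaling. *)
Lemma escape_rates_log_rate delta d alpha z w : 0 < INR delta -> 0 < alpha ->
  escape_rates delta d alpha z w ->
  exists l, log_rate delta (fun n => Cmod (z n)) l /\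
    log_rate delta (fun n => Rmax (powR0 (Cmod (z n)) alpha) (Cmod (w n))) (Rbar_mult (Finite alpha) l) /\
    (eventually_zero w -> log_rate delta (fun n => Cmod (w n)) m_infty) /\
    (((1 <= d)%nat -> ~ eventually_zero w) ->
      log_rate delta (fun n => Cmod (w n)) (Rbar_mult (Finite alpha) l)).
Proof.
  intros Hdel Hal [[[N Hz] Hw]|(L & [N Hz] & HL & Hw)].
  - exists m_infty. rewrite Rbar_mult_pos_m_infty by exact Hal.
    assert (Hwm : log_rate delta (fun n => Cmod (w n)) m_infty).
    { destruct Hw as [Hw|[[N' Hw] Hlim]]; [apply log_rate_zero; assumption|].
      apply (log_rate_nonzero _ _ _ N'); assumption. }
    split; [apply log_rate_zero; [exact Hdel|exists N; exact Hz]|].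
    split; [|split; intros _; exact Hwm].
    apply (log_rate_ext delta (fun n => Cmod (w n)) _ _ N); [|exact Hwm].
    intros n Hn. rewrite (Hz n Hn), Cmod_0, powR0_0, Rmax_right; [reflexivity|apply Cmod_ge_0].
  - exists (Finite L). split; [apply (log_rate_nonzero _ _ _ N); assumption|].
    assert (Hza : is_lim_seq (fun n => / INR delta ^ n * (alpha * logmod z n)) (alpha * L)).
    { apply (is_lim_seq_ext (fun n => alpha * (/ INR delta ^ n * logmod z n))); [intros; ring|].
      apply (is_lim_seq_scal_l _ alpha L HL). }
    split; [|split].
    + destruct Hw as [[_ [N' Hw]]|[[N' Hw] Hlim]].
      * apply (scaled_logb_lim _ _ _ N).
        { intros n Hn. eapply Rlt_le_trans; [|apply Rmax_l].
          rewrite powR0_pos by (apply Cmod_gt_0, Hz, Hn). apply exp_pos. }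
        apply (is_lim_seq_ext_loc (fun n => / INR delta ^ n * (alpha * logmod z n))); [|exact Hza].
        exists (Nat.max N N'). intros n Hn. rewrite (Hw n) by lia.
        rewrite Cmod_0, powR0_pos by (apply Cmod_gt_0, Hz; lia).
        rewrite Rmax_left by (left; apply exp_pos). rewrite ln_Rpower. reflexivity.
      * apply (scaled_logb_lim _ _ _ N).
        { intros n Hn. eapply Rlt_le_trans; [|apply Rmax_l].
          rewrite powR0_pos by (apply Cmod_gt_0, Hz, Hn). apply exp_pos. }
        apply (is_lim_seq_ext_loc (fun n => Rmax (/ INR delta ^ n * (alpha * logmod z n)) (/ INR delta ^ n * logmod w n)));
          [|apply is_lim_seq_Rmax; assumption].
        exists (Nat.max N N'). intros n Hn.
        rewrite powR0_pos by (apply Cmod_gt_0, Hz; lia).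
        rewrite ln_Rmax by (try apply exp_pos; apply Cmod_gt_0, Hw; lia).
        rewrite ln_Rpower, RmaxRmult by (left; apply Rinv_0_lt_compat, pow_lt, Hdel). reflexivity.
    + apply log_rate_zero, Hdel.
    + intros Hne. destruct Hw as [[H1 Hw]|[[N' Hw] Hlim]]; [exfalso; exact (Hne H1 Hw)|].
      apply (log_rate_nonzero _ _ _ N'); assumption.
Qed.

Lemma log_rate_max_dominated delta (z w : nat -> C) (L : R) N : 0 < INR delta ->
  (forall n, (N <= n)%nat -> z n <> 0%C) -> is_lim_seq (fun n => / INR delta ^ n * logmod z n) L ->
  (eventually_zero w \/ ((exists N, forall n, (N <= n)%nat -> w n <> 0%C) /\
    is_lim_seq (fun n => / INR delta ^ n * logmod w n) m_infty)) ->
  log_rate delta (fun n => Rmax (Cmod (z n)) (Cmod (w n))) L.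
Proof.
  intros Hdel Hz HL Hw.
  assert (Hdom : exists N', forall n, (N' <= n)%nat -> Cmod (w n) <= Cmod (z n)).
  { destruct Hw as [[N' Hw]|[[N' Hw] Hlim]].
    - exists N'. intros n Hn. rewrite (Hw n Hn), Cmod_0. apply Cmod_ge_0.
    - apply is_lim_seq_spec in Hlim. apply is_lim_seq_spec in HL.
      destruct (Hlim (L - 1)) as [N1 H1]. destruct (HL (mkposreal 1 Rlt_0_1)) as [N2 H2]. simpl in H2.
      exists (Nat.max (Nat.max N N') (Nat.max N1 N2)). intros n Hn.
      specialize (H1 n ltac:(lia)). specialize (H2 n ltac:(lia)). apply Rabs_def2 in H2.
      assert (Pn : 0 < / INR delta ^ n) by (apply Rinv_0_lt_compat, pow_lt, Hdel).
      left. apply ln_lt_inv; [apply Cmod_gt_0, Hw; lia|apply Cmod_gt_0, Hz; lia|].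
      apply (Rmult_lt_reg_l (/ INR delta ^ n)); [exact Pn|]. unfold logmod in *. lra. }
  destruct Hdom as [N' HN'].
  apply (log_rate_ext delta (fun n => Cmod (z n)) _ _ N').
  - intros n Hn. symmetry. apply Rmax_left, HN', Hn.
  - apply (log_rate_nonzero _ _ _ N); assumption.
Qed.

Lemma faster_scale_lim_0 delta d (z : nat -> C) (L : R) : 2 <= INR delta -> (delta < d)%nat ->
  is_lim_seq (fun n => / INR delta ^ n * logmod z n) L ->
  is_lim_seq (fun n => / INR d ^ n * logmod z n) 0.
Proof.
  intros Hdel Hd HL. apply lt_INR in Hd.
  apply (is_lim_seq_ext (fun n => (INR delta / INR d) ^ n * (/ INR delta ^ n * logmod z n))).
  - intros n. unfold Rdiv. rewrite Rpow_mult_distr, pow_inv. field. split; apply pow_nonzero; lra.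
  - replace (Finite 0) with (Finite (0 * L)) by (f_equal; ring).
    apply is_lim_seq_mult'; [|exact HL]. apply is_lim_seq_geom.
    rewrite Rabs_right by (apply Rle_ge, Rmult_le_pos; [lra|left; apply Rinv_0_lt_compat; lra]).
    apply (Rmult_lt_reg_r (INR d)); [lra|]. unfold Rdiv. rewrite Rmult_assoc, Rinv_l; lra.
Qed.

(** The rate of the maximum is squeezed between that of z, which is 0 at scale d^n, and log 1. *)
Lemma log_rate_max_trivial d (z w : nat -> C) N : 0 < INR d ->
  (forall n, (N <= n)%nat -> z n <> 0%C) ->
  (forall n, (N <= n)%nat -> Cmod (z n) <= 1 /\ Cmod (w n) <= 1) ->
  is_lim_seq (fun n => / INR d ^ n * logmod z n) 0 ->
  log_rate d (fun n => Rmax (Cmod (z n)) (Cmod (w n))) 0.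
Proof.
  intros Hd Hz H1 HL. apply (scaled_logb_lim _ _ _ N).
  - intros n Hn. eapply Rlt_le_trans; [apply Cmod_gt_0, Hz, Hn|apply Rmax_l].
  - apply (is_lim_seq_le_le_loc (fun n => / INR d ^ n * logmod z n) _ (fun _ => 0));
      [|exact HL|apply is_lim_seq_const].
    exists N. intros n Hn. destruct (H1 n Hn) as [Hz1 Hw1].
    assert (Pz : 0 < Cmod (z n)) by (apply Cmod_gt_0, Hz, Hn).
    assert (Pn : 0 < / INR d ^ n) by (apply Rinv_0_lt_compat, pow_lt, Hd).
    assert (Pm := Rmax_l (Cmod (z n)) (Cmod (w n))). split.
    + apply Rmult_le_compat_l; [lra|]. apply ln_le; assumption.
    + rewrite <- (Rmult_0_r (/ INR d ^ n)). apply Rmult_le_compat_l; [lra|].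
      rewrite <- ln_1. apply ln_le; [lra|]. apply Rmax_lub; assumption.
Qed.

Lemma log_rate_ratio d alpha (z w : nat -> C) (l : R) N : 0 < INR d ->
  (forall n, (N <= n)%nat -> z n <> 0%C) -> (forall n, (N <= n)%nat -> w n <> 0%C) ->
  is_lim_seq (fun n => / INR d ^ n * logmod z n) 0 ->
  is_lim_seq (fun n => / INR d ^ n * logmod w n) l ->
  log_rate d (fun n => Cmod (w n) / powR0 (Cmod (z n)) alpha) l.
Proof.
  intros Hd Hz Hw HL Hl.
  assert (Pz : forall n, (N <= n)%nat -> 0 < Cmod (z n)) by (intros; apply Cmod_gt_0, Hz; assumption).
  assert (Pw : forall n, (N <= n)%nat -> 0 < Cmod (w n)) by (intros; apply Cmod_gt_0, Hw; assumption).
  apply (scaled_logb_lim _ _ _ N).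
  - intros n Hn. rewrite powR0_pos by (apply Pz, Hn). apply Rdiv_lt_0_compat; [apply Pw, Hn|apply exp_pos].
  - apply (is_lim_seq_ext_loc (fun n => / INR d ^ n * logmod w n - alpha * (/ INR d ^ n * logmod z n))).
    + exists N. intros n Hn. rewrite powR0_pos by (apply Pz, Hn). unfold Rdiv.
      rewrite ln_mult, ln_Rinv, ln_Rpower by (try apply Rinv_0_lt_compat; try apply exp_pos; apply Pw, Hn).
      unfold logmod. ring.
    + replace (Finite l) with (Finite (l - alpha * 0)) by (f_equal; ring).
      apply is_lim_seq_minus'; [exact Hl|]. apply (is_lim_seq_scal_l _ alpha 0 HL).
Qed.

(** * Orbits near the origin *)

Lemma Rabs_ln_le x y c1 c2 : 0 < c1 -> 0 < c2 -> 0 < x -> c1 * x <= y -> y <= c2 * x ->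
  Rabs (ln y - ln x) <= Rabs (ln c1) + Rabs (ln c2).
Proof.
  intros H1 H2 Hx Hy1 Hy2.
  assert (Hc1x : 0 < c1 * x) by (apply Rmult_lt_0_compat; assumption).
  assert (L1 : ln (c1 * x) <= ln y) by (apply ln_le; lra).
  assert (L2 : ln y <= ln (c2 * x)) by (apply ln_le; lra).
  rewrite ln_mult in L1, L2 by assumption.
  assert (A1 := Rle_abs (- ln c1)). rewrite Rabs_Ropp in A1. assert (A2 := Rle_abs (ln c2)).
  assert (A3 := Rabs_pos (ln c1)). assert (A4 := Rabs_pos (ln c2)).
  apply Rabs_le. lra.
Qed.

Lemma exp_nondecreasing x y : x <= y -> exp x <= exp y.
Proof. intros [H| ->]; [left; apply exp_increasing, H|apply Rle_refl]. Qed.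

Lemma Cmod_lim_0_small (u : nat -> C) e : is_lim_seq (fun n => Cmod (u n)) 0 -> 0 < e ->
  exists N, forall n, (N <= n)%nat -> Cmod (u n) < e.
Proof.
  intros H He. apply is_lim_seq_spec in H. destruct (H (mkposreal e He)) as [N HN].
  exists N. intros n Hn. specialize (HN n Hn). simpl in HN.
  rewrite Rminus_0_r, Rabs_right in HN; [exact HN|apply Rle_ge, Cmod_ge_0].
Qed.

Section Orbits.
Variables (p : C -> C) (q : C -> C -> C) (a : C) (delta : nat) (b : nat -> nat -> C)
  (g d : nat) (l1 : R).
Hypothesis Ha : a <> 0%C.
Hypothesis Hdelta : (2 <= delta)%nat.
Hypothesis Hpexp : exists K eps, 0 < eps /\ forall z, Cmod z < eps ->
  Cmod (Cminus (p z) (Cmult a (Cpow z delta))) <= K * Cmod z ^ (delta + 1).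
Hypothesis Hqb : taylor2_at0 q b.
Hypothesis Hb00 : b 0%nat 0%nat = 0%C.
Hypothesis Hl1 : 0 < l1.
Hypothesis Hbgd : b g d <> 0%C.
Hypothesis Hd : forall i j, b i j <> 0%C -> (d <= j)%nat.
Hypothesis Hedge : forall i j, b i j <> 0%C -> INR g + l1 * INR d <= INR i + l1 * INR j.

Let T := INR g / l1 + INR d.
Let A := Cmod a.
Let B := Cmod (b g d).

Lemma A_pos : 0 < A.
Proof. apply Cmod_gt_0, Ha. Qed.

Lemma B_pos : 0 < B.
Proof. apply Cmod_gt_0, Hbgd. Qed.

Lemma delta_ge_2 : 2 <= INR delta.
Proof. apply le_INR in Hdelta. simpl in Hdelta. lra. Qed.

Lemma p_origin : p 0%C = 0%C.
Proof.
  destruct Hpexp as (K & eps & He & H). specialize (H 0%C). rewrite Cmod_0 in H.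
  specialize (H He). rewrite pow_add, pow_1, Rmult_0_r, Rmult_0_r in H.
  apply Cmod_eq_0, Rle_antisym; [|apply Cmod_ge_0].
  replace (p 0%C) with (p 0 - a * Cpow 0 delta)%C; [exact H|].
  destruct delta; [lia|]. rewrite Cpow_S. ring.
Qed.

Lemma p_bounds : exists eps, 0 < eps < 1 /\ forall z : C, Cmod z < eps ->
  A / 2 * Cmod z ^ delta <= Cmod (p z) <= 3 / 2 * A * Cmod z ^ delta /\ Cmod (p z) <= Cmod z.
Proof.
  destruct Hpexp as (K & eps & He & H). assert (HA := A_pos).
  set (K' := Rabs K + 1). assert (HK : 0 < K') by (assert (X := Rabs_pos K); unfold K'; lra).
  (* A / (2 K') makes the remainder at most half of the leading term; 2 / (3 A) yields |p z| <=
     |z|. *)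
  exists (Rmin (Rmin (1 / 2) eps) (Rmin (A / (2 * K')) (2 / (3 * A)))).
  assert (P1 : 0 < A / (2 * K')) by (apply Rdiv_lt_0_compat; lra).
  assert (P2 : 0 < 2 / (3 * A)) by (apply Rdiv_lt_0_compat; lra).
  split.
  { split; [repeat apply Rmin_glb_lt; lra|].
    eapply Rle_lt_trans; [apply Rmin_l|]. eapply Rle_lt_trans; [apply Rmin_l|]. lra. }
  intros z Hz.
  assert (Z1 := Rlt_le_trans _ _ _ Hz (Rmin_l _ _)).
  assert (Z2 := Rlt_le_trans _ _ _ Hz (Rmin_r _ _)).
  assert (Z3 := Rlt_le_trans _ _ _ Z1 (Rmin_l _ _)).
  assert (Z4 := Rlt_le_trans _ _ _ Z1 (Rmin_r _ _)).
  assert (Z5 := Rlt_le_trans _ _ _ Z2 (Rmin_l _ _)).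
  assert (Z6 := Rlt_le_trans _ _ _ Z2 (Rmin_r _ _)).
  assert (Zp := Cmod_ge_0 z). assert (Zd : 0 <= Cmod z ^ delta) by (apply pow_le; lra).
  specialize (H z Z4).
  assert (Hmain : Cmod (p z - a * Cpow z delta) <= A / 2 * Cmod z ^ delta).
  { eapply Rle_trans; [exact H|]. rewrite pow_add, pow_1.
    replace (K * (Cmod z ^ delta * Cmod z)) with ((K * Cmod z) * Cmod z ^ delta) by ring.
    apply Rmult_le_compat_r; [exact Zd|].
    apply Rle_trans with (K' * Cmod z).
    - apply Rmult_le_compat_r; [exact Zp|]. assert (X := Rle_abs K). unfold K'. lra.
    - apply Rlt_le in Z5. apply (Rmult_le_compat_l K') in Z5; [|lra].
      eapply Rle_trans; [exact Z5|]. right. field. lra. }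
  assert (Hm : Cmod (a * Cpow z delta) = A * Cmod z ^ delta) by (rewrite Cmod_mult, Cmod_pow; reflexivity).
  assert (U : Cmod (p z) <= 3 / 2 * A * Cmod z ^ delta).
  { replace (p z) with ((p z - a * Cpow z delta) + a * Cpow z delta)%C by ring.
    eapply Rle_trans; [apply Cmod_triangle|]. rewrite Hm. lra. }
  split; [split; [|exact U]|].
  - assert (X := Cmod_triangle_inv (a * Cpow z delta) (a * Cpow z delta - p z)).
    replace (a * Cpow z delta - (a * Cpow z delta - p z))%C with (p z) in X by ring.
    replace (a * Cpow z delta - p z)%C with (- (p z - a * Cpow z delta))%C in X by ring.
    rewrite Cmod_opp, Hm in X. lra.
  - eapply Rle_trans; [exact U|].
    apply Rle_trans with (3 / 2 * A * Cmod z ^ 2).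
    + apply Rmult_le_compat_l; [lra|]. apply pow_le_lt1; [lra|exact Hdelta].
    + apply Rlt_le in Z6. apply (Rmult_le_compat_l (3 / 2 * A)) in Z6; [|lra].
      replace (3 / 2 * A * (2 / (3 * A))) with 1 in Z6 by (field; lra). simpl. nra.
Qed.

Lemma p_log : exists (M : R) eps, 0 < eps < 1 /\ forall z : C, z <> 0%C -> Cmod z < eps ->
  p z <> 0%C /\ Rabs (ln (Cmod (p z)) - INR delta * ln (Cmod z)) <= M.
Proof.
  destruct p_bounds as (eps & He & H). assert (HA := A_pos).
  exists (Rabs (ln (A / 2)) + Rabs (ln (3 / 2 * A))), eps. split; [exact He|].
  intros z Hz0 Hz. destruct (H z Hz) as [[H1 H2] _].
  assert (Zp := proj1 (Cmod_gt_0 z) Hz0). assert (Zd : 0 < Cmod z ^ delta) by (apply pow_lt; lra).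
  split.
  - apply Cmod_gt_0. eapply Rlt_le_trans; [|exact H1]. apply Rmult_lt_0_compat; lra.
  - rewrite <- ln_pow by exact Zp. apply Rabs_ln_le; lra.
Qed.

(** Two radii, because for delta < T the bound s on z is shrunk while the slope r stays; s = r gives
    U. The condition z <> 0 is explicit since [Rpower] carries no meaning at 0. *)
Definition wedge (s r : R) (z w : C) : Prop :=
  z <> 0%C /\ Cmod z < s /\ Cmod w < r * Rpower (Cmod z) l1.

(** Invariance compares r^d |z|^(g + l1 d), the size of the leading term, with r |p z|^l1, of size r
    |z|^(l1 delta). The condition on x is this comparison, left open because it is met differently
    for delta < T and for delta = T. *)
Lemma wedge_step : exists K rho, 0 < K /\ 0 < rho < 1 /\ forall r s z w, 0 < s <= r -> r <= rho ->
  (forall x, 0 < x < s -> K * r ^ d * Rpower x (INR g + l1 * INR d - l1 * INR delta) < r) ->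
  wedge s r z w ->
  wedge s r (p z) (q z w) /\
  B / 2 * (Cmod z ^ g * Cmod w ^ d) <= Cmod (q z w) <= 3 / 2 * B * (Cmod z ^ g * Cmod w ^ d).
Proof.
  destruct p_bounds as (e1 & He1 & Hp).
  destruct (dominant_term q b g d l1 Hqb Hl1 Hd Hedge) as (K & rho & HK & Hrho & Hdom).
  assert (HA := A_pos). assert (HB := B_pos).
  set (KK := 3 / 2 * B / Rpower (A / 2) l1).
  assert (PA : 0 < Rpower (A / 2) l1) by apply exp_pos.
  assert (HKB : 0 < B / (2 * K)) by (apply Rdiv_lt_0_compat; lra).
  (* r <= B / (2 K) makes the error at most half of the leading term; [KK] collects the constants of
     the bounds on q and p. *)
  exists KK, (Rmin (Rmin rho e1) (B / (2 * K))).
  split; [apply Rdiv_lt_0_compat; lra|]. split.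
  { split; [repeat apply Rmin_glb_lt; lra|].
    eapply Rle_lt_trans; [apply Rmin_l|]. eapply Rle_lt_trans; [apply Rmin_l|]. lra. }
  intros r s z w Hs Hr Hcond (Hz0 & Hz & Hw).
  assert (R1 := Rle_trans _ _ _ Hr (Rmin_l _ _)).
  assert (R2 := Rle_trans _ _ _ Hr (Rmin_r _ _)).
  assert (R3 := Rle_trans _ _ _ R1 (Rmin_l _ _)).
  assert (R4 := Rle_trans _ _ _ R1 (Rmin_r _ _)).
  assert (Zp := proj1 (Cmod_gt_0 z) Hz0). assert (Wp := Cmod_ge_0 w).
  assert (PG : 0 < Cmod z ^ g) by (apply pow_lt; lra).
  assert (PW : 0 <= Cmod w ^ d) by (apply pow_le; lra).
  assert (PGW : 0 <= Cmod z ^ g * Cmod w ^ d) by (apply Rmult_le_pos; lra).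
  assert (PZ : 0 < Rpower (Cmod z) l1) by apply exp_pos.
  assert (Hq := Hdom r z w ltac:(lra) Hz0 ltac:(lra) ltac:(lra)).
  assert (HKr : K * r <= B / 2).
  { apply (Rmult_le_compat_l K) in R2; [|lra].
    replace (K * (B / (2 * K))) with (B / 2) in R2 by (field; lra). exact R2. }
  assert (Hq' : Cmod (q z w - b g d * Cpow z g * Cpow w d) <= B / 2 * (Cmod z ^ g * Cmod w ^ d)).
  { eapply Rle_trans; [exact Hq|]. apply Rmult_le_compat_r; lra. }
  set (m := (b g d * Cpow z g * Cpow w d)%C) in *.
  assert (Hm : Cmod m = B * (Cmod z ^ g * Cmod w ^ d)) by (unfold m; rewrite !Cmod_mult, !Cmod_pow; unfold B; ring).
  assert (U : Cmod (q z w) <= 3 / 2 * B * (Cmod z ^ g * Cmod w ^ d)).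
  { replace (q z w) with ((q z w - m) + m)%C by ring.
    eapply Rle_trans; [apply Cmod_triangle|]. rewrite Hm. lra. }
  assert (L : B / 2 * (Cmod z ^ g * Cmod w ^ d) <= Cmod (q z w)).
  { assert (X := Cmod_triangle_inv m (m - q z w)).
    replace (m - (m - q z w))%C with (q z w) in X by ring.
    replace (m - q z w)%C with (- (q z w - m))%C in X by ring.
    rewrite Cmod_opp, Hm in X. lra. }
  split; [|split; assumption].
  destruct (Hp z ltac:(lra)) as [[P1 P2] P3].
  assert (PZd : 0 < Cmod z ^ delta) by (apply pow_lt; lra).
  assert (Pl : 0 < A / 2 * Cmod z ^ delta) by (apply Rmult_lt_0_compat; lra).
  split; [apply Cmod_gt_0; lra|]. split; [lra|].
  apply Rle_lt_trans with (3 / 2 * B * (Cmod z ^ g * (r ^ d * Rpower (Cmod z) (l1 * INR d)))).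
  { eapply Rle_trans; [exact U|]. apply Rmult_le_compat_l; [lra|].
    apply Rmult_le_compat_l; [lra|]. rewrite <- Rpower_mult_pow, <- Rpow_mult_distr by exact Zp.
    apply pow_incr. lra. }
  apply Rlt_le_trans with (r * (Rpower (A / 2) l1 * Rpower (Cmod z) (INR delta * l1))).
  - assert (Hc := Hcond (Cmod z) ltac:(lra)).
    apply (Rmult_lt_compat_r (Rpower (A / 2) l1 * Rpower (Cmod z) (INR delta * l1))) in Hc;
      [|apply Rmult_lt_0_compat; [lra|apply exp_pos]].
    eapply Rle_lt_trans; [|exact Hc]. right. unfold KK.
    rewrite <- (Rpower_pow g) by exact Zp.
    transitivity (3 / 2 * B * r ^ d * (Rpower (Cmod z) (INR g + l1 * INR d - l1 * INR delta)
      * Rpower (Cmod z) (INR delta * l1))); [|field; lra].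
    rewrite <- Rpower_plus.
    replace (INR g + l1 * INR d - l1 * INR delta + INR delta * l1) with (INR g + l1 * INR d) by ring.
    rewrite Rpower_plus. ring.
  - apply Rmult_le_compat_l; [lra|].
    rewrite <- Rpower_mult, Rpower_pow, Rpower_mult_distr by lra.
    apply Rle_Rpower_l; lra.
Qed.

(** The exponent of x is l1 (T - delta) > 0, so a small s suffices for any given r. *)
Lemma wedge_radius_subcritical K r : 0 < K -> 0 < r -> INR delta < T -> exists s, 0 < s <= r /\
  forall x, 0 < x < s -> K * r ^ d * Rpower x (INR g + l1 * INR d - l1 * INR delta) < r.
Proof.
  intros HK Hr HT. set (th := INR g + l1 * INR d - l1 * INR delta).
  assert (Hth : 0 < th).
  { unfold th. replace (INR g + l1 * INR d) with (l1 * T) by (unfold T; field; lra).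
    assert (l1 * INR delta < l1 * T) by (apply Rmult_lt_compat_l; assumption). lra. }
  assert (Hrd : 0 < r ^ d) by (apply pow_lt; lra).
  assert (HKr : 0 < K * r ^ d) by (apply Rmult_lt_0_compat; lra).
  exists (Rmin r (Rpower (r / (K * r ^ d)) (/ th))).
  split; [split; [apply Rmin_glb_lt; [lra|apply exp_pos]|apply Rmin_l]|].
  intros x [Hx0 Hx]. assert (Hx' := Rlt_le_trans _ _ _ Hx (Rmin_r _ _)).
  apply (fun h => Rlt_Rpower_l x _ th Hth (conj Hx0 h)) in Hx'.
  rewrite Rpower_mult, Rinv_l, Rpower_1 in Hx' by (try lra; apply Rdiv_lt_0_compat; lra).
  apply (Rmult_lt_compat_l (K * r ^ d)) in Hx'; [|exact HKr].
  replace (K * r ^ d * (r / (K * r ^ d))) with r in Hx' by (field; lra). exact Hx'.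
Qed.

(** Here the exponent of x vanishes and smallness of z is of no help: invariance rests on r^d being
    small against r, whence d >= 2. *)
Lemma wedge_radius_critical K r : 0 < K -> 0 < r < Rmin 1 (/ K) -> INR delta = T -> (2 <= d)%nat ->
  forall x, 0 < x < r -> K * r ^ d * Rpower x (INR g + l1 * INR d - l1 * INR delta) < r.
Proof.
  intros HK Hr HT Hd2 x Hx.
  replace (INR g + l1 * INR d - l1 * INR delta) with 0 by (rewrite HT; unfold T; field; lra).
  rewrite Rpower_O, Rmult_1_r by lra.
  assert (R1 := Rmin_l 1 (/ K)). assert (R2 := Rmin_r 1 (/ K)).
  apply Rle_lt_trans with (K * r ^ 2).
  - apply Rmult_le_compat_l; [lra|]. apply pow_le_lt1; [lra|exact Hd2].
  - assert (K * r < 1).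
    { apply (Rmult_lt_reg_l (/ K)); [apply Rinv_0_lt_compat, HK|].
      rewrite <- Rmult_assoc, Rinv_l by lra. lra. }
    simpl. nra.
Qed.

Lemma z_growth : exists eps, 0 < eps /\ forall z : nat -> C, (forall n, z (S n) = p (z n)) ->
  forall N, (forall n, (N <= n)%nat -> z n <> 0%C) ->
  (forall n, (N <= n)%nat -> Cmod (z n) < eps) ->
  (exists M, forall n, (N <= n)%nat -> Rabs (logmod z (S n) - INR delta * logmod z n) <= M) /\
  exists L : R, is_lim_seq (fun n => / INR delta ^ n * logmod z n) L.
Proof.
  destruct p_log as (M & eps & He & H). exists eps. split; [lra|]. intros z Hz N Hz0 Hzs.
  assert (G : forall n, (N <= n)%nat -> Rabs (logmod z (S n) - INR delta * logmod z n) <= M).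
  { intros n Hn. unfold logmod. rewrite Hz. apply H; auto. }
  split; [exists M; exact G|].
  assert (D := delta_ge_2).
  apply (linear_recurrence_converges (logmod z) (INR delta) 1 M N); [lra|lra|].
  intros n Hn. rewrite pow1, Rmult_1_r. apply G, Hn.
Qed.

Lemma wedge_orbit : exists K rho, 0 < K /\ 0 < rho < 1 /\ forall (z w : nat -> C) r s n0,
  (forall n, z (S n) = p (z n)) -> (forall n, w (S n) = q (z n) (w n)) -> 0 < s <= r -> r <= rho ->
  (forall x, 0 < x < s -> K * r ^ d * Rpower x (INR g + l1 * INR d - l1 * INR delta) < r) ->
  wedge s r (z n0) (w n0) ->
  (forall n, (n0 <= n)%nat -> wedge s r (z n) (w n)) /\
  (((1 <= d)%nat /\ eventually_zero w) \/
   exists N C, forall n, (N <= n)%nat ->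
     w n <> 0%C /\ Rabs (logmod w (S n) - INR d * logmod w n - INR g * logmod z n) <= C).
Proof.
  destruct wedge_step as (K & rho & HK & Hrho & H). exists K, rho. split; [exact HK|].
  split; [exact Hrho|]. intros z w r s n0 Hz Hw Hs Hr Hcond H0. assert (HB := B_pos).
  assert (G : forall n, (n0 <= n)%nat -> wedge s r (z n) (w n)).
  { intros n Hn. induction Hn as [|n Hn IH]; [exact H0|]. rewrite Hz, Hw. apply H; assumption. }
  split; [exact G|].
  assert (Hlog : forall n, (n0 <= n)%nat -> (w n <> 0%C \/ d = 0%nat) ->
    w (S n) <> 0%C /\ Rabs (logmod w (S n) - INR d * logmod w n - INR g * logmod z n) <= Rabs (ln (B / 2)) + Rabs (ln (3 / 2 * B))).
  { intros n Hn Hne. destruct (H r s (z n) (w n) Hs Hr Hcond (G n Hn)) as [_ [L U]].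
    rewrite <- Hw in L, U.
    assert (Zp : 0 < Cmod (z n)) by (apply Cmod_gt_0, (G n Hn)).
    assert (PG : 0 < Cmod (z n) ^ g) by (apply pow_lt; lra).
    assert (PW : 0 < Cmod (w n) ^ d).
    { destruct Hne as [Hne|Hne]; [apply pow_lt, Cmod_gt_0, Hne|rewrite Hne; simpl; lra]. }
    assert (PGW : 0 < Cmod (z n) ^ g * Cmod (w n) ^ d) by (apply Rmult_lt_0_compat; lra).
    split.
    - apply Cmod_gt_0. eapply Rlt_le_trans; [|exact L]. apply Rmult_lt_0_compat; lra.
    - replace (logmod w (S n) - INR d * logmod w n - INR g * logmod z n)
        with (logmod w (S n) - ln (Cmod (z n) ^ g * Cmod (w n) ^ d)).
      + apply Rabs_ln_le; lra.
      + rewrite ln_mult, (ln_pow (Cmod (z n))) by assumption. unfold logmod.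
        destruct Hne as [Hne|Hne].
        * rewrite ln_pow by (apply Cmod_gt_0, Hne). ring.
        * rewrite Hne, pow_O, ln_1. simpl. ring. }
  destruct (Nat.eq_dec d 0) as [E|E].
  (* For d = 0 the lower bound makes w nonzero whatever its previous value, so nonvanishing holds
     from time n0 + 1. *)
  - right. exists (S n0). eexists. intros [|n] Hn; [lia|]. split.
    + apply Hlog; [lia|auto].
    + apply Hlog; [lia|auto].
  - destruct (classic (exists n, (n0 <= n)%nat /\ w n = 0%C)) as [(n & Hn & Hwn)|Hno].
    + left. split; [lia|]. exists n. intros m Hm. induction Hm as [|m Hm IH]; [exact Hwn|].
      destruct (H r s (z m) (w m) Hs Hr Hcond (G m ltac:(lia))) as [_ [_ U]].
      rewrite <- Hw, IH, Cmod_0, pow_i, !Rmult_0_r in U by lia.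
      apply Cmod_eq_0, Rle_antisym; [exact U|apply Cmod_ge_0].
    + right. exists n0. eexists. intros n Hn.
      assert (Hwn : w n <> 0%C) by (intros F; apply Hno; exists n; auto).
      split; [exact Hwn|]. apply Hlog; auto.
Qed.

Section Sequences.
Variables z w : nat -> C.
Hypothesis Hz : forall n, z (S n) = p (z n).
Hypothesis Hw : forall n, w (S n) = q (z n) (w n).

Let X := logmod z.
Let Y := logmod w.

Lemma z_zero_forever N : z N = 0%C -> forall n, (N <= n)%nat -> z n = 0%C.
Proof.
  intros H n Hn. induction Hn as [|n Hn IH]; [exact H|]. rewrite Hz, IH. apply p_origin.
Qed.

(** Convergence of X / delta^n alone would allow the limit 0. Since z tends to 0, X eventually falls
    below the threshold - C' of [fast_decrease], which gives a strictly negative rate. *)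
Lemma z_decay N : (forall n, (N <= n)%nat -> z n <> 0%C) -> is_lim_seq (fun n => Cmod (z n)) 0 ->
  exists c m, 0 < c /\ forall n, (m <= n)%nat -> X n <= - c * INR delta ^ n.
Proof.
  intros Hz0 Hlim. destruct p_log as (C & eps & He & H). assert (D := delta_ge_2).
  set (C' := Rabs C).
  destruct (Cmod_lim_0_small z (Rmin eps (exp (- C' - 1))) Hlim) as [N1 HN1].
  { apply Rmin_glb_lt; [lra|apply exp_pos]. }
  set (M := Nat.max N N1).
  assert (Hs : forall n, (M <= n)%nat -> Cmod (z n) < Rmin eps (exp (- C' - 1))) by (intros; apply HN1; lia).
  destruct (fast_decrease X (INR delta) C' M M D (Rabs_pos C)) as (c & Hc & Hu).
  - intros n Hn. assert (Hsn := Rlt_le_trans _ _ _ (Hs n Hn) (Rmin_l _ _)).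
    destruct (H (z n) (Hz0 n ltac:(lia)) Hsn) as [_ G]. unfold X, logmod. rewrite Hz.
    apply Rabs_le_between in G. assert (T1 := Rle_abs C). unfold C'. lra.
  - lia.
  - assert (Hsn := Rlt_le_trans _ _ _ (Hs M (Nat.le_refl M)) (Rmin_r _ _)).
    apply ln_increasing in Hsn; [|apply Cmod_gt_0, Hz0; lia]. rewrite ln_exp in Hsn. unfold X, logmod. lra.
  - exists c, M. split; assumption.
Qed.

Lemma w_nonzero_of_large r n : 0 < r -> z n <> 0%C -> r * powR0 (Cmod (z n)) l1 <= Cmod (w n) -> w n <> 0%C.
Proof.
  intros Hr Hz0 H. apply Cmod_gt_0. eapply Rlt_le_trans; [|exact H].
  apply Rmult_lt_0_compat; [exact Hr|]. unfold powR0.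
  destruct (Req_EM_T (Cmod (z n)) 0) as [E|_]; [|apply exp_pos].
  exfalso. apply Hz0, Cmod_eq_0, E.
Qed.

(* Outside the wedge |w'| <= K |w|^T with T > delta, whereas |z| only decays like a delta^n-th
   power: the orbit cannot stay outside. *)
Lemma wedge_entry s r N : INR delta < T -> 0 < s -> 0 < r ->
  (forall n, (N <= n)%nat -> z n <> 0%C) ->
  is_lim_seq (fun n => Cmod (z n)) 0 -> is_lim_seq (fun n => Cmod (w n)) 0 ->
  exists n0, (N <= n0)%nat /\ wedge s r (z n0) (w n0).
Proof.
  intros HT Hs Hr Hz0 Hzl Hwl. apply NNPP. intros Hno. assert (D := delta_ge_2).
  destruct (outer_bound q b g d l1 Hqb Hl1 Hedge Hb00 r Hr) as (K & eps & HK & He & Hq).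
  fold T in Hq. destruct z_growth as (e1 & He1 & Hgr).
  set (C := Rabs (ln K)).
  destruct (Cmod_lim_0_small z (Rmin s e1) Hzl) as [N1 HN1]; [apply Rmin_glb_lt; lra|].
  destruct (Cmod_lim_0_small w (Rmin eps (exp (- C - 1))) Hwl) as [N2 HN2];
    [apply Rmin_glb_lt; [lra|apply exp_pos]|].
  set (M := Nat.max N (Nat.max N1 N2)).
  assert (Hzs : forall n, (M <= n)%nat -> Cmod (z n) < Rmin s e1) by (intros; apply HN1; lia).
  assert (Hws : forall n, (M <= n)%nat -> Cmod (w n) < Rmin eps (exp (- C - 1))) by (intros; apply HN2; lia).
  assert (Hout : forall n, (M <= n)%nat -> r * Rpower (Cmod (z n)) l1 <= Cmod (w n)).
  { intros n Hn. apply Rnot_lt_le. intros Hlt. apply Hno. exists n. split; [lia|].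
    split; [apply Hz0; lia|]. split; [|exact Hlt].
    eapply Rlt_le_trans; [apply Hzs, Hn|apply Rmin_l]. }
  assert (Hpow : forall n, (M <= n)%nat -> powR0 (Cmod (z n)) l1 = Rpower (Cmod (z n)) l1).
  { intros n Hn. unfold powR0. destruct (Req_EM_T (Cmod (z n)) 0) as [E|_]; [|reflexivity].
    exfalso. apply (Hz0 n); [lia|]. apply Cmod_eq_0, E. }
  assert (Hw0 : forall n, (M <= n)%nat -> w n <> 0%C).
  { intros n Hn. apply (w_nonzero_of_large r); [exact Hr|apply Hz0; lia|].
    rewrite Hpow by exact Hn. apply Hout, Hn. }
  assert (Hlim : is_lim_seq (fun n => / INR delta ^ n * Y n) m_infty).
  { apply (superexponential_decrease Y T (INR delta) C M D HT (Rabs_pos _)).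
    - intros n Hn.
      assert (Q := Hq (z n) (w n) (Hw0 n Hn) (Rlt_le_trans _ _ _ (Hws n Hn) (Rmin_l _ _))).
      rewrite Hpow in Q by exact Hn. specialize (Q (Hout n Hn)). rewrite <- Hw in Q.
      apply ln_le in Q; [|apply Cmod_gt_0, Hw0; lia].
      rewrite ln_mult, ln_Rpower in Q by (try assumption; apply exp_pos).
      assert (T1 := Rle_abs (ln K)). unfold Y, logmod, C. lra.
    - exists M. split; [lia|].
      assert (Q := Rlt_le_trans _ _ _ (Hws M (Nat.le_refl M)) (Rmin_r _ _)).
      apply ln_increasing in Q; [|apply Cmod_gt_0, Hw0; lia]. rewrite ln_exp in Q. unfold Y, logmod, logmod. lra. }
  destruct (Hgr z Hz M) as [_ [L HL]].
  { intros n Hn. apply Hz0. lia. }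
  { intros n Hn. eapply Rlt_le_trans; [apply Hzs, Hn|apply Rmin_r]. }
  assert (Hlow : is_lim_seq (fun n => ln r * / INR delta ^ n + l1 * (/ INR delta ^ n * X n)) (0 + l1 * L)).
  { apply is_lim_seq_plus'; [apply inv_pow_lim_0; lra|].
    apply (is_lim_seq_scal_l _ l1 L HL). }
  assert (Hcmp : forall n, (M <= n)%nat ->
    ln r * / INR delta ^ n + l1 * (/ INR delta ^ n * X n) <= / INR delta ^ n * Y n).
  { intros n Hn. assert (Q := Hout n Hn). apply ln_le in Q; [|apply Rmult_lt_0_compat; [lra|apply exp_pos]].
    rewrite ln_mult, ln_Rpower in Q by (try assumption; apply exp_pos).
    apply (Rmult_le_compat_l (/ INR delta ^ n)) in Q; [|left; apply Rinv_0_lt_compat, pow_lt; lra].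
    unfold X, Y, logmod. lra. }
  (* A finite limit at most minus infinity: [Rbar_le] reduces to [False]. *)
  exact (is_lim_seq_le_loc _ _ _ _ (ex_intro _ M Hcmp) Hlow Hlim).
Qed.

(* With c = log (|w| / |z|^l1), staying outside the wedge bounds c below; the monomials on the
   last edge all carry a factor z, which makes the growth rate of c smaller than delta. *)
Lemma critical_outside_orbit s r N : INR delta = T ->
  (forall j, b 0%nat j <> 0%C -> T + 1 <= INR j) -> 0 < s -> 0 < r ->
  (forall n, (N <= n)%nat -> z n <> 0%C) ->
  is_lim_seq (fun n => Cmod (z n)) 0 -> is_lim_seq (fun n => Cmod (w n)) 0 ->
  (forall n, (N <= n)%nat -> ~ wedge s r (z n) (w n)) ->
  exists M (L : R), (forall n, (M <= n)%nat -> w n <> 0%C) /\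
    is_lim_seq (fun n => / INR delta ^ n * X n) L /\
    is_lim_seq (fun n => / INR delta ^ n * Y n) (l1 * L).
Proof.
  intros HT Hb0 Hs Hr Hz0 Hzl Hwl Hno. assert (D := delta_ge_2).
  destruct (outer_bound q b g d l1 Hqb Hl1 Hedge Hb00 r Hr) as (K1 & e1 & HK1 & He1 & Hq1).
  destruct (outer_bound_critical q b g d l1 Hqb Hl1 Hedge Hb00 Hb0) as (K2 & e2 & HK2 & He2 & Hq2).
  fold T in Hq1, Hq2. rewrite <- HT in Hq1, Hq2. destruct z_growth as (e3 & He3 & Hgr).
  set (C1 := Rabs (ln K1)). set (C2 := Rabs (ln K2)).
  destruct (Cmod_lim_0_small z (Rmin s e3) Hzl) as [N1 HN1]; [apply Rmin_glb_lt; lra|].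
  destruct (Cmod_lim_0_small w (Rmin (Rmin e1 e2) (exp (- C1 - 1))) Hwl) as [N2 HN2];
    [repeat apply Rmin_glb_lt; try lra; apply exp_pos|].
  set (M := Nat.max N (Nat.max N1 N2)).
  assert (Hzs : forall n, (M <= n)%nat -> Cmod (z n) < s /\ Cmod (z n) < e3).
  { intros n Hn. assert (Q := HN1 n ltac:(lia)).
    split; eapply Rlt_le_trans; [exact Q|apply Rmin_l|exact Q|apply Rmin_r]. }
  assert (Hws : forall n, (M <= n)%nat -> Cmod (w n) < e1 /\ Cmod (w n) < e2 /\ Cmod (w n) < exp (- C1 - 1)).
  { intros n Hn. assert (Q := HN2 n ltac:(lia)).
    assert (Q1 := Rlt_le_trans _ _ _ Q (Rmin_l _ _)). assert (Q2 := Rlt_le_trans _ _ _ Q (Rmin_r _ _)).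
    assert (Q3 := Rlt_le_trans _ _ _ Q1 (Rmin_l _ _)). assert (Q4 := Rlt_le_trans _ _ _ Q1 (Rmin_r _ _)).
    auto. }
  assert (Hpow : forall n, (M <= n)%nat -> powR0 (Cmod (z n)) l1 = Rpower (Cmod (z n)) l1).
  { intros n Hn. unfold powR0. destruct (Req_EM_T (Cmod (z n)) 0) as [E|_]; [|reflexivity].
    exfalso. apply (Hz0 n); [lia|]. apply Cmod_eq_0, E. }
  assert (Hout : forall n, (M <= n)%nat -> r * Rpower (Cmod (z n)) l1 <= Cmod (w n)).
  { intros n Hn. apply Rnot_lt_le. intros Hlt. apply (Hno n ltac:(lia)).
    split; [apply Hz0; lia|]. split; [apply Hzs, Hn|exact Hlt]. }
  assert (Hw0 : forall n, (M <= n)%nat -> w n <> 0%C).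
  { intros n Hn. apply (w_nonzero_of_large r); [exact Hr|apply Hz0; lia|].
    rewrite Hpow by exact Hn. apply Hout, Hn. }
  assert (Zp : forall n, (M <= n)%nat -> 0 < Cmod (z n)) by (intros; apply Cmod_gt_0, Hz0; lia).
  assert (Wp : forall n, (M <= n)%nat -> 0 < Cmod (w n)) by (intros; apply Cmod_gt_0, Hw0; lia).
  destruct (Hgr z Hz M) as [[CX HCX] [L HL]].
  { intros n Hn. apply Hz0. lia. }
  { intros n Hn. apply Hzs, Hn. }
  fold X in HCX, HL. exists M, L. split; [exact Hw0|]. split; [exact HL|].
  set (c := fun n => Y n - l1 * X n).
  assert (Hclow : forall n, (M <= n)%nat -> ln r <= c n).
  { intros n Hn. assert (Q := Hout n Hn). apply ln_le in Q; [|apply Rmult_lt_0_compat; [lra|apply exp_pos]].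
    rewrite ln_mult, ln_Rpower in Q by (try assumption; apply exp_pos). unfold c, X, Y, logmod. lra. }
  assert (HY1 : forall n, (M <= n)%nat -> Y (S n) <= INR delta * Y n + C1).
  { intros n Hn. destruct (Hws n Hn) as [W1 _].
    assert (Q := Hq1 (z n) (w n) (Hw0 n Hn) W1).
    rewrite Hpow in Q by exact Hn. specialize (Q (Hout n Hn)). rewrite <- Hw in Q.
    apply ln_le in Q; [|apply Wp; lia].
    rewrite ln_mult, ln_Rpower in Q by (try assumption; apply exp_pos).
    assert (T1 := Rle_abs (ln K1)). unfold Y, logmod, C1. lra. }
  destruct (fast_decrease Y (INR delta) C1 M M D (Rabs_pos _) HY1 (Nat.le_refl M)) as (cy & Hcy & HYd).
  { destruct (Hws M (Nat.le_refl M)) as (_ & _ & Q). apply ln_increasing in Q; [|apply Wp; lia].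
    rewrite ln_exp in Q. unfold Y, logmod, logmod. lra. }
  destruct (scaled_bounded X (INR delta) L ltac:(lra) HL) as (BX & N3 & HBX & HXb).
  (* The gain in the multiplier: 1 keeps delta - kap positive, / l1 handles the factor exp (- c /
     l1), and the last term handles |w|, because c <= l1 BX delta^n and Y <= - cy delta^n give Y <=
     - kap c. *)
  set (kap := Rmin 1 (Rmin (/ l1) (cy / (l1 * BX)))).
  assert (Hlb : 0 < l1 * BX) by (apply Rmult_lt_0_compat; lra).
  assert (Hil1 : 0 < / l1) by (apply Rinv_0_lt_compat, Hl1).
  assert (Hkap : 0 < kap).
  { repeat apply Rmin_glb_lt; try lra. apply Rdiv_lt_0_compat; lra. }
  assert (Hkap1 : kap <= 1) by apply Rmin_l.
  assert (Hkap2 : kap <= / l1) by (eapply Rle_trans; [apply Rmin_r|apply Rmin_l]).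
  assert (Hkap3 : kap <= cy / (l1 * BX)) by (eapply Rle_trans; [apply Rmin_r|apply Rmin_r]).
  set (M' := Nat.max M N3). set (CC := C1 + C2 + ln 2 + l1 * CX + Rabs (ln r)).
  assert (HCX0 : 0 <= CX) by (eapply Rle_trans; [apply Rabs_pos|apply (HCX M (Nat.le_refl M))]).
  assert (Hln2 : 0 < ln 2) by (rewrite <- ln_1; apply ln_increasing; lra).
  assert (HlCX : 0 <= l1 * CX) by (apply Rmult_le_pos; lra).
  assert (Hrec : forall n, (M' <= n)%nat -> Rabs (c (S n)) <= (INR delta - kap) * Rabs (c n) + CC).
  { intros n Hn. assert (Hn' : (M <= n)%nat) by lia.
    assert (P1 := Rabs_pos (ln K1)). assert (P2 := Rabs_pos (ln K2)). assert (P3 := Rabs_pos (ln r)).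
    fold C1 in P1. fold C2 in P2.
    assert (HX := HCX n Hn'). apply Rabs_le_between in HX.
    assert (HlX : l1 * (- CX) <= l1 * (X (S n) - INR delta * X n)) by (apply Rmult_le_compat_l; lra).
    assert (Hpos : 0 <= (INR delta - kap) * Rabs (c n)) by (apply Rmult_le_pos; [lra|apply Rabs_pos]).
    assert (Hlow := Hclow (S n) ltac:(lia)). assert (P4 := Rle_abs (- ln r)). rewrite Rabs_Ropp in P4.
    assert (Hup : c (S n) <= (INR delta - kap) * Rabs (c n) + (C1 + C2 + ln 2 + l1 * CX)).
    (* For c >= 0 one has |z|^l1 <= |w| and the sharper estimate applies. For c < 0 the plain one
       gives c' <= delta c + const <= const. *)
    { destruct (Rle_dec 0 (c n)) as [Hc|Hc].
      - rewrite (Rabs_right (c n)) by lra.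
        destruct (Hws n Hn') as (_ & W2 & _).
        assert (Hle : Rpower (Cmod (z n)) l1 <= Cmod (w n)).
        { rewrite <- (exp_ln (Cmod (w n))) by (apply Wp, Hn'). unfold Rpower.
          unfold c, X, Y, logmod in Hc. destruct (Req_dec (l1 * ln (Cmod (z n))) (ln (Cmod (w n)))) as [->|Hne]; [lra|].
          left. apply exp_increasing. lra. }
        assert (Q := Hq2 (z n) (w n) (Hw0 n Hn') W2). rewrite Hpow in Q by exact Hn'. specialize (Q Hle).
        rewrite <- Hw in Q. apply ln_le in Q; [|apply Wp; lia].
        assert (Pu : 0 < Cmod (z n) / Rpower (Cmod (w n)) (/ l1)).
        { apply Rdiv_lt_0_compat; [apply Zp, Hn'|apply exp_pos]. }
        assert (Pw := Wp n Hn').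
        assert (Lu : ln (Cmod (z n) / Rpower (Cmod (w n)) (/ l1)) = - / l1 * c n).
        { unfold Rdiv. rewrite ln_mult, ln_Rinv, ln_Rpower by (try apply Rinv_0_lt_compat; try apply exp_pos; apply Zp, Hn').
          unfold c, X, Y, logmod. field. lra. }
        assert (HYc : Y n <= - kap * c n).
        { assert (G1 := HYd n Hn'). assert (G2 := HXb n ltac:(lia)). apply Rabs_le_between in G2.
          assert (Pd : 0 < INR delta ^ n) by (apply pow_lt; lra).
          assert (G3 : c n <= l1 * BX * INR delta ^ n).
          { unfold c. assert (l1 * (- X n) <= l1 * (BX * INR delta ^ n)) by (apply Rmult_le_compat_l; lra).
            assert (0 < cy * INR delta ^ n) by (apply Rmult_lt_0_compat; lra). lra. }
          assert (G4 : kap * c n <= cy / (l1 * BX) * (l1 * BX * INR delta ^ n)) by (apply Rmult_le_compat; lra).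
          replace (cy / (l1 * BX) * (l1 * BX * INR delta ^ n)) with (cy * INR delta ^ n) in G4 by (field; lra).
          lra. }
        assert (Hsum : ln (Cmod (z n) / Rpower (Cmod (w n)) (/ l1) + Cmod (w n)) <= ln 2 + - kap * c n).
        { apply Rle_trans with (ln (2 * exp (- kap * c n))).
          - apply ln_le; [lra|].
            assert (E1 : Cmod (z n) / Rpower (Cmod (w n)) (/ l1) <= exp (- kap * c n)).
            { rewrite <- (exp_ln (Cmod (z n) / _)) by exact Pu. rewrite Lu. apply exp_nondecreasing.
              apply Rmult_le_compat_r; lra. }
            assert (E2 : Cmod (w n) <= exp (- kap * c n)).
            { rewrite <- (exp_ln (Cmod (w n))) by exact Pw. apply exp_nondecreasing, HYc. }
            lra.
          - rewrite ln_mult, ln_exp by (try lra; apply exp_pos). lra. }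
        rewrite !ln_mult, ln_Rpower in Q by (try lra; try apply exp_pos; (apply Rmult_lt_0_compat; [lra|apply exp_pos])).
        assert (T1 := Rle_abs (ln K2)). fold C2 in T1.
        replace (c (S n)) with (Y (S n) - l1 * (X (S n) - INR delta * X n) - INR delta * (l1 * X n)) by (unfold c; ring).
        replace ((INR delta - kap) * c n) with (INR delta * Y n - INR delta * (l1 * X n) + - kap * c n) by (unfold c; ring).
        unfold Y, logmod in *. lra.
      - assert (G := HY1 n Hn').
        assert (Hneg : INR delta * c n <= 0) by (apply Rnot_le_lt in Hc; nra).
        replace (c (S n)) with (Y (S n) - l1 * (X (S n) - INR delta * X n) - INR delta * (l1 * X n)) by (unfold c; ring).
        unfold c in Hneg. lra. }
    unfold CC. apply Rabs_le. lra. }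
  assert (Hc0 := slow_recurrence_negligible c (INR delta - kap) (INR delta) CC M' ltac:(lra) ltac:(lra) Hrec).
  apply (is_lim_seq_ext (fun n => / INR delta ^ n * c n + l1 * (/ INR delta ^ n * X n))).
  - intros n. unfold c. ring.
  - replace (Finite (l1 * L)) with (Finite (0 + l1 * L)) by (f_equal; ring).
    apply is_lim_seq_plus'; [exact Hc0|]. apply (is_lim_seq_scal_l _ l1 L HL).
Qed.

(** On the fibre z = 0 some exponent larger than delta is available: T itself if delta < T, and T +
    1 if delta = T, since the summand with |z| vanishes there. *)
Lemma axis_orbit N : INR delta < T \/ (INR delta = T /\ forall j, b 0%nat j <> 0%C -> T + 1 <= INR j) ->
  (forall n, (N <= n)%nat -> z n = 0%C) -> is_lim_seq (fun n => Cmod (w n)) 0 ->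
  eventually_zero w \/
  ((exists M, forall n, (M <= n)%nat -> w n <> 0%C) /\ is_lim_seq (fun n => / INR delta ^ n * Y n) m_infty).
Proof.
  intros HT Hz0 Hwl. assert (D := delta_ge_2).
  destruct (classic (exists n, (N <= n)%nat /\ w n = 0%C)) as [(n & Hn & Hwn)|Hno].
  { left. exists n. intros m Hm. induction Hm as [|m Hm IH]; [exact Hwn|].
    rewrite Hw, IH, (Hz0 m) by lia. apply (q_origin q b Hqb Hb00). }
  right. assert (Hw0 : forall n, (N <= n)%nat -> w n <> 0%C) by (intros n Hn F; apply Hno; exists n; auto).
  split; [exists N; exact Hw0|].
  assert (Pow0 : powR0 0 l1 = 0) by (unfold powR0; destruct (Req_EM_T 0 0); [reflexivity|lra]).
  assert (Main : exists T' K eps, INR delta < T' /\ 0 < K /\ 0 < eps /\ forall n, (N <= n)%nat ->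
    Cmod (w n) < eps -> Cmod (w (S n)) <= K * Rpower (Cmod (w n)) T').
  { destruct HT as [HT|[HT Hb0]].
    - destruct (outer_bound q b g d l1 Hqb Hl1 Hedge Hb00 1 Rlt_0_1) as (K & eps & HK & He & Hq).
      exists T, K, eps. split; [exact HT|]. split; [exact HK|]. split; [lra|].
      intros n Hn Hs. rewrite Hw. apply Hq; [apply Hw0, Hn|exact Hs|].
      rewrite (Hz0 n Hn), Cmod_0, Pow0, Rmult_0_r. apply Cmod_ge_0.
    - destruct (outer_bound_critical q b g d l1 Hqb Hl1 Hedge Hb00 Hb0) as (K & eps & HK & He & Hq).
      fold T in Hq. exists (T + 1), K, eps. split; [lra|]. split; [exact HK|]. split; [lra|].
      intros n Hn Hs. rewrite Hw. eapply Rle_trans; [apply Hq; [apply Hw0, Hn|exact Hs|]|].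
      + rewrite (Hz0 n Hn), Cmod_0, Pow0. apply Cmod_ge_0.
      + rewrite (Hz0 n Hn), Cmod_0, (Rpower_plus T 1), Rpower_1 by (apply Cmod_gt_0, Hw0, Hn).
        right. unfold Rdiv. ring. }
  destruct Main as (T' & K & eps & HT' & HK & He & Hq).
  set (C := Rabs (ln K)).
  destruct (Cmod_lim_0_small w (Rmin eps (exp (- C - 1))) Hwl) as [N2 HN2];
    [apply Rmin_glb_lt; [lra|apply exp_pos]|].
  set (M := Nat.max N N2).
  apply (superexponential_decrease Y T' (INR delta) C M D HT' (Rabs_pos _)).
  - intros n Hn.
    assert (Q := Hq n ltac:(lia) (Rlt_le_trans _ _ _ (HN2 n ltac:(lia)) (Rmin_l _ _))).
    apply ln_le in Q; [|apply Cmod_gt_0, Hw0; lia].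
    rewrite ln_mult, ln_Rpower in Q by (try assumption; apply exp_pos).
    assert (T1 := Rle_abs (ln K)). unfold Y, logmod, C. lra.
  - exists M. split; [lia|].
    assert (Q := Rlt_le_trans _ _ _ (HN2 M ltac:(lia)) (Rmin_r _ _)).
    apply ln_increasing in Q; [|apply Cmod_gt_0, Hw0; lia]. rewrite ln_exp in Q. unfold Y, logmod, logmod. lra.
Qed.
End Sequences.

(** The recurrences are kept with their errors instead of a limit of w, because the limit drawn from
    them depends on how delta compares with d. *)
Definition tail_asymptotics (z w : nat -> C) : Prop :=
  exists L : R, (exists N, forall n, (N <= n)%nat -> z n <> 0%C) /\
    is_lim_seq (fun n => / INR delta ^ n * logmod z n) L /\
    (((1 <= d)%nat /\ eventually_zero w) \/
     exists N M M', (forall n, (N <= n)%nat -> w n <> 0%C) /\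
       (forall n, (N <= n)%nat -> Rabs (logmod w (S n) - INR d * logmod w n - INR g * logmod z n) <= M) /\
       (forall n, (N <= n)%nat -> Rabs (logmod z (S n) - INR delta * logmod z n) <= M')).

Lemma wedge_asymptotics : exists K rho, 0 < K /\ 0 < rho < 1 /\ forall (z w : nat -> C) r s n0,
  (forall n, z (S n) = p (z n)) -> (forall n, w (S n) = q (z n) (w n)) -> 0 < s <= r -> r <= rho ->
  (forall x, 0 < x < s -> K * r ^ d * Rpower x (INR g + l1 * INR d - l1 * INR delta) < r) ->
  wedge s r (z n0) (w n0) ->
  (forall n, (n0 <= n)%nat -> wedge s r (z n) (w n)) /\ tail_asymptotics z w.
Proof.
  destruct wedge_orbit as (K & rho & HK & Hrho & H). destruct z_growth as (eps & He & Hgr).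
  exists K, (Rmin rho eps). split; [exact HK|]. split.
  { split; [apply Rmin_glb_lt; lra|]. eapply Rle_lt_trans; [apply Rmin_l|]. lra. }
  intros z w r s n0 Hz Hw Hs Hr Hcond H0.
  assert (R1 := Rle_trans _ _ _ Hr (Rmin_l _ _)). assert (R2 := Rle_trans _ _ _ Hr (Rmin_r _ _)).
  destruct (H z w r s n0 Hz Hw Hs R1 Hcond H0) as [G Hdich]. split; [exact G|].
  destruct (Hgr z Hz n0) as [[M' HM'] [L HL]].
  { intros n Hn. apply (G n Hn). }
  { intros n Hn. destruct (G n Hn) as (_ & Q & _). lra. }
  exists L. split; [exists n0; intros n Hn; apply (G n Hn)|]. split; [exact HL|].
  destruct Hdich as [Hzero|(N & M & HN)]; [left; exact Hzero|right].
  exists (Nat.max N n0), M, M'. split; [intros; apply HN; lia|].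
  split; [intros; apply HN; lia|]. intros; apply HM'; lia.
Qed.

Lemma subcritical_asymptotics (z w : nat -> C) N : INR delta < T ->
  (forall n, z (S n) = p (z n)) -> (forall n, w (S n) = q (z n) (w n)) ->
  (forall n, (N <= n)%nat -> z n <> 0%C) ->
  is_lim_seq (fun n => Cmod (z n)) 0 -> is_lim_seq (fun n => Cmod (w n)) 0 ->
  tail_asymptotics z w.
Proof.
  intros HT Hz Hw Hz0 Hzl Hwl.
  destruct wedge_asymptotics as (K & rho & HK & Hrho & H).
  destruct (wedge_radius_subcritical K rho HK ltac:(lra) HT) as (s & Hs & Hcond).
  destruct (wedge_entry z w Hz Hw s rho N HT ltac:(lra) ltac:(lra) Hz0 Hzl Hwl) as (n0 & _ & H0).
  apply (H z w rho s n0 Hz Hw Hs (Rle_refl _) Hcond H0).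
Qed.

Let alpha := INR g / (INR delta - INR d).

Lemma tail_asymptotics_escape_rates (z w : nat -> C) : (d < delta)%nat ->
  tail_asymptotics z w -> escape_rates delta d alpha z w.
Proof.
  intros Hdd (L & Hz & HL & Hw). right. exists L. split; [exact Hz|]. split; [exact HL|].
  destruct Hw as [Hw|(N & M & M' & H1 & H2 & H3)]; [left; exact Hw|right].
  split; [exists N; exact H1|].
  exact (rate_d_lt_delta delta d g z w L N M delta_ge_2 HL H2 M' Hdd H3).
Qed.

Hypothesis Hg : (0 < g)%nat.

Lemma basin_escape_rates (z w : nat -> C) : (d < delta)%nat ->
  INR delta < T \/ (INR delta = T /\ (2 <= d)%nat /\ forall j, b 0%nat j <> 0%C -> T + 1 <= INR j) ->
  (forall n, z (S n) = p (z n)) -> (forall n, w (S n) = q (z n) (w n)) ->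
  is_lim_seq (fun n => Cmod (z n)) 0 -> is_lim_seq (fun n => Cmod (w n)) 0 ->
  escape_rates delta d alpha z w.
Proof.
  intros Hdd HT Hz Hw Hzl Hwl.
  destruct (classic (exists n, z n = 0%C)) as [(N & HN)|Hno].
  - assert (Hz0 := z_zero_forever z Hz N HN). left. split; [exists N; exact Hz0|].
    apply (axis_orbit z w Hw N); try assumption. destruct HT as [HT|(HT & _ & Hb)]; [left|right]; auto.
  - assert (Hz0 : forall n, (0 <= n)%nat -> z n <> 0%C) by (intros n _ F; apply Hno; exists n; exact F).
    destruct HT as [HT|(HT & Hd2 & Hb)].
    + apply tail_asymptotics_escape_rates; [exact Hdd|].
      apply (subcritical_asymptotics z w 0); assumption.
    + destruct wedge_asymptotics as (K & rho & HK & Hrho & H).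
      set (r := Rmin rho (Rmin 1 (/ K)) / 2).
      assert (HiK : 0 < / K) by (apply Rinv_0_lt_compat, HK).
      assert (Hm : 0 < Rmin rho (Rmin 1 (/ K))) by (repeat apply Rmin_glb_lt; lra).
      assert (Hm1 := Rmin_l rho (Rmin 1 (/ K))). assert (Hm2 := Rmin_r rho (Rmin 1 (/ K))).
      assert (Hr : 0 < r < Rmin 1 (/ K)) by (unfold r; lra).
      assert (Hcond := wedge_radius_critical K r HK Hr HT Hd2).
      destruct (classic (exists n, wedge r r (z n) (w n))) as [(n0 & H0)|Hout].
      * apply tail_asymptotics_escape_rates; [exact Hdd|].
        apply (H z w r r n0 Hz Hw); try assumption; unfold r in *; lra.
      * destruct (critical_outside_orbit z w Hz Hw r r 0 HT Hb) as (M & L & Hw0 & HL & HLw);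
          try assumption; try lra.
        { intros n _ F. apply Hout. exists n. exact F. }
        right. exists L. split; [exists O; exact Hz0|]. split; [exact HL|]. right.
        split; [exists M; exact Hw0|].
        (* From delta = T follows delta - d = g / l1, hence alpha = l1. *)
        replace alpha with l1; [exact HLw|]. unfold alpha. rewrite HT. unfold T.
        apply lt_INR in Hg. simpl in Hg. field. lra.
Qed.
End Orbits.

(** * Domains, exceptional sets and assembly of the cases *)

Lemma iterf_fst p q n x : fst (iterf p q n x) = Nat.iter n p (fst x).
Proof.
  induction n as [|n IH]; [reflexivity|]. simpl. rewrite <- IH. reflexivity.
Qed.

Lemma Rbar_lt_down (Rad : Rbar) x y : x <= y -> Rbar_lt y Rad -> Rbar_lt x Rad.
Proof. intros H H'. exact (Rbar_le_lt_trans x y Rad H H'). Qed.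

Lemma Rbar_lt_open (Rad : Rbar) (x : R) : Rbar_lt x Rad -> exists y, x < y /\ Rbar_lt y Rad.
Proof.
  destruct Rad as [r| |]; simpl; intros H.
  - exists ((x + r) / 2). lra.
  - exists (x + 1). split; [lra|exact I].
  - contradiction.
Qed.

Lemma is_lim_seq_sum_0 (u v : nat -> R) : (forall n, 0 <= u n) -> (forall n, 0 <= v n) ->
  is_lim_seq (fun n => u n + v n) 0 -> is_lim_seq u 0 /\ is_lim_seq v 0.
Proof.
  intros Hu Hv H. split.
  - apply (is_lim_seq_le_le (fun _ => 0) _ (fun n => u n + v n)); [|apply is_lim_seq_const|exact H].
    intros n. specialize (Hu n). specialize (Hv n). lra.
  - apply (is_lim_seq_le_le (fun _ => 0) _ (fun n => u n + v n)); [|apply is_lim_seq_const|exact H].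
    intros n. specialize (Hu n). specialize (Hv n). lra.
Qed.

(** An equality of limits is a common value l, existence included. For delta < d the fibres that
    reach z = 0 are set apart: there the quotient by |z_n|^alpha is meaningless, and q(0, w)
    vanishes to order greater than d, so that G_f would be minus infinity instead of 0. *)
Theorem theorem2p5
  (Rad : Rbar) (p : C -> C) (q : C -> C -> C) (a : C) (delta : nat)
  (b : nat -> nat -> C) (s : nat) (nv mv : nat -> nat)
  (* domain: C^2 (Rad = +oo) or {|z| < R} x C with A_p relatively compact in {|z|<R} *)
  (HRad : Rad = p_infty \/
          exists R0, Rad = Finite R0 /\ 0 < R0 /\
            exists R1, R1 < R0 /\
              forall z, basin_p (fun z' => Rbar_lt (Finite (Cmod z')) Rad) p z -> Cmod z <= R1)
  (Hp : holo1 (fun z => Rbar_lt (Finite (Cmod z)) Rad) p)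
  (Hq : holo2 (fun z w => Rbar_lt (Finite (Cmod z)) Rad) q)
  (Ha : a <> 0%C)
  (Hdelta : (2 <= delta)%nat)
  (* p(z) = a z^delta + O(z^(delta+1)) *)
  (Hpexp : exists K eps, 0 < eps /\ forall z, Cmod z < eps ->
             Cmod (Cminus (p z) (Cmult a (Cpow z delta))) <= K * Cmod z ^ (delta + 1))
  (* q(z,w) = sum b_ij z^i w^j, b_00 = b_01 = 0 *)
  (Hqb : taylor2_at0 q b)
  (Hb00 : b 0%nat 0%nat = 0%C) (Hb01 : b 0%nat 1%nat = 0%C)
  (* vertices of the Newton polygon, s > 1 *)
  (HNP : NP_vertices b s nv mv)
  (* Case 2 : delta <= T_{s-1} *)
  (Hcase2 : INR delta <= y_intercept (INR (nv (s - 1)%nat)) (INR (mv (s - 1)%nat)) (INR (nv s)) (INR (mv s))) :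
  let Dz := fun z => Rbar_lt (Finite (Cmod z)) Rad in
  let D := fun x : C * C => Dz (fst x) in
  let T := y_intercept (INR (nv (s - 1)%nat)) (INR (mv (s - 1)%nat)) (INR (nv s)) (INR (mv s)) in
  let gamma := nv s in
  let d := mv s in
  let l1 := (INR (nv s) - INR (nv (s - 1)%nat)) / (INR (mv (s - 1)%nat) - INR (mv s)) in
  let alpha := INR gamma / (INR delta - INR d) in
  let lam := Nat.max delta d in
  let A0 := basin0 D p q in
  let Ew := fun x => exists n, preim D p q n (fun y => snd y = 0%C) x in
  let Zp := fun x : C * C => exists n, Nat.iter n p (fst x) = 0%C in
  let U := fun r (y : C * C) => Cmod (fst y) < r /\ Cmod (snd y) < r * powR0 (Cmod (fst y)) l1 in
  let Af := fun r x => exists n, preim D p q n (U r) x in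
  exists r0, 0 < r0 /\ forall r, 0 < r < r0 ->
  (INR delta < T ->
     ((delta < d)%nat -> forall x, A0 x -> ~ Zp x ->
        (exists l, Gz_is p q lam x l /\ Gza_is p q d alpha x l) /\ Gf_is p q lam x (Finite 0))
  /\ (delta = d -> forall x, A0 x ->
        Gz_is p q lam x m_infty /\ exists l, Gp_is p delta (fst x) l /\ Gf_is p q lam x l)
  /\ ((d < delta)%nat -> (1 <= d)%nat -> forall x, A0 x ->
        (~ Ew x -> exists l, Gp_is p delta (fst x) l /\ Gz_is p q lam x (Rbar_mult (Finite alpha) l))
        /\ (Ew x -> Gz_is p q lam x m_infty))
  /\ (d = 0%nat -> forall x, A0 x ->
        exists l, Gp_is p delta (fst x) l /\ Gz_is p q lam x (Rbar_mult (Finite alpha) l))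
  /\ ((d < delta)%nat -> forall x, A0 x ->
        exists l, Gp_is p delta (fst x) l /\ Gfa_is p q lam alpha x (Rbar_mult (Finite alpha) l)))
  /\
  (INR delta = T -> (2 <= d)%nat -> (d < delta)%nat ->
     (forall x, Af r x ->
        (~ Ew x -> exists l, Gp_is p delta (fst x) l /\ Gz_is p q lam x (Rbar_mult (Finite alpha) l))
        /\ (Ew x -> Gz_is p q lam x m_infty)
        /\ (exists l, Gp_is p delta (fst x) l /\ Gfa_is p q lam alpha x (Rbar_mult (Finite alpha) l)))
  /\ ((0 < nv (s - 1)%nat)%nat -> forall x, A0 x ->
        (~ Ew x -> exists l, Gp_is p delta (fst x) l /\ Gz_is p q lam x (Rbar_mult (Finite alpha) l))
        /\ (Ew x -> Gz_is p q lam x m_infty)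
        /\ (exists l, Gp_is p delta (fst x) l /\ Gfa_is p q lam alpha x (Rbar_mult (Finite alpha) l)))).
Proof.
  intros Dz D T gamma d l1 alpha lam A0 Ew Zp U Af.
  assert (Hs : (1 < s)%nat) by apply HNP.
  destruct (last_vertices_lt b s nv mv HNP) as [Hg' Hd'].
  destruct (last_vertex b s nv mv HNP) as [Hbgd Hmin].
  assert (Hl1 : 0 < l1) by exact (last_slope_pos b s nv mv HNP).
  assert (Hedge := last_edge b s nv mv HNP).
  assert (HlT : l1 * T = INR gamma + l1 * INR d) by exact (intercept_eq b s nv mv HNP).
  fold gamma in Hg', Hbgd, Hmin, Hedge. fold d in Hd', Hbgd, Hmin, Hedge. fold l1 in Hedge.
  assert (Hd : forall i j, b i j <> 0%C -> (d <= j)%nat) by (intros i j H; apply (Hmin i j H)).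
  assert (Hedge1 : forall i j, b i j <> 0%C -> INR gamma + l1 * INR d <= INR i + l1 * INR j)
    by (intros i j H; apply (Hedge i j H)).
  assert (Hg : (0 < gamma)%nat) by lia.
  assert (ET : T = INR gamma / l1 + INR d).
  { apply (Rmult_eq_reg_l l1); [|lra]. rewrite HlT. field. lra. }
  assert (D2 : 2 <= INR delta) by (apply le_INR in Hdelta; simpl in Hdelta; lra).
  assert (Hrad0 : Rbar_lt 0 Rad).
  { destruct HRad as [->|(R0 & -> & HR0 & _)]; [exact I|exact HR0]. }
  destruct (Rbar_lt_open Rad 0 Hrad0) as (e0 & He0 & HDe0).
  set (zf := fun x n => fst (iterf p q n x)). set (wf := fun x n => snd (iterf p q n x)).
  assert (Hz : forall x n, zf x (S n) = p (zf x n)) by reflexivity.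
  assert (Hw : forall x n, wf x (S n) = q (zf x n) (wf x n)) by reflexivity.
  assert (Hlim : forall x, A0 x -> is_lim_seq (fun n => Cmod (zf x n)) 0 /\ is_lim_seq (fun n => Cmod (wf x n)) 0).
  { intros x [_ Hx]. apply is_lim_seq_sum_0; [intros; apply Cmod_ge_0..|exact Hx]. }
  assert (HGp : forall x l, log_rate delta (fun n => Cmod (zf x n)) l -> Gp_is p delta (fst x) l).
  { intros x l. apply (log_rate_ext delta _ _ l 0). intros n _. unfold zf. rewrite iterf_fst. reflexivity. }
  assert (Hqaxis : (1 <= d)%nat -> forall z, Dz z -> q z 0%C = 0%C).
  { intros Hd1. destruct (q_axis_zero q b gamma d Hqb Hd Hd1) as (eps & He & H0).
    apply (identity_theorem (fun z => q z 0%C) (fun x => Rbar_lt x Rad) eps); try assumption.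
    - intros x y. apply Rbar_lt_down.
    - apply Rbar_lt_open.
    - intros z HDz. apply (Hq z 0%C HDz). }
  (* An orbit may meet w = 0 while z_n is still far from 0, hence the appeal to invariance on the
     whole domain. *)
  assert (HEw : forall x, (forall n, D (iterf p q n x)) -> (1 <= d)%nat -> (Ew x <-> eventually_zero (wf x))).
  { intros x HD Hd1. split.
    - intros (n & _ & Hn). exists n. intros m Hm. induction Hm as [|m Hm IH]; [exact Hn|].
      rewrite Hw, IH. apply Hqaxis; [exact Hd1|]. apply HD.
    - intros (n & Hn). exists n. split; [intros k _; apply HD|]. apply Hn. lia. }
  assert (Hconcl : (d < delta)%nat -> forall x, (forall n, D (iterf p q n x)) ->
    escape_rates delta d alpha (zf x) (wf x) ->
    exists l, Gp_is p delta (fst x) l /\ Gfa_is p q lam alpha x (Rbar_mult (Finite alpha) l) /\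
      (d = 0%nat -> Gz_is p q lam x (Rbar_mult (Finite alpha) l)) /\
      ((1 <= d)%nat -> (~ Ew x -> Gz_is p q lam x (Rbar_mult (Finite alpha) l)) /\
        (Ew x -> Gz_is p q lam x m_infty))).
  { intros Hdd x HD Hesc. assert (Elam : lam = delta) by (unfold lam; lia). rewrite Elam.
    assert (Hal : 0 < alpha).
    { apply lt_INR in Hdd, Hg. simpl in Hg. apply Rdiv_lt_0_compat; lra. }
    destruct (escape_rates_log_rate delta d alpha _ _ ltac:(lra) Hal Hesc) as (l & G1 & G2 & G3 & G4).
    exists l. split; [apply HGp, G1|]. split; [exact G2|]. split.
    - intros H0. apply G4. lia.
    - intros Hd1. split.
      + intros Hn. apply G4. intros _ F. apply Hn, HEw; assumption.
      + intros HE. apply G3, HEw; assumption. }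
  (* With n_(s-1) > 0 no exponent (0, j) lies on the last edge, so j > T. As T = delta is an
     integer, j >= T + 1. *)
  assert (Hstrict : INR delta = T -> (0 < nv (s - 1)%nat)%nat ->
    forall j, b 0%nat j <> 0%C -> T + 1 <= INR j).
  { intros HT Hn j Hb. destruct (Hedge 0%nat j Hb) as [E1 E2]. simpl in E1, E2.
    assert (Hlt : INR delta < INR j).
    { rewrite HT. apply (Rmult_lt_reg_l l1); [exact Hl1|]. rewrite HlT.
      destruct E1 as [E1|E1]; [rewrite Rplus_0_l in E1; exact E1|].
      exfalso. specialize (E2 (eq_sym E1)). lia. }
    apply INR_lt in Hlt. rewrite <- HT, <- S_INR. apply le_INR. lia. }
  destruct (wedge_asymptotics p q a delta b gamma d l1 Ha Hdelta Hpexp Hqb Hl1 Hbgd Hd Hedge1)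
    as (K & rho & HK & Hrho & Hwedge).
  assert (HiK : 0 < / K) by (apply Rinv_0_lt_compat, HK).
  (* rho and K come from the invariant wedge, e0 keeps the wedge inside the domain, and the bound by
     1 and / K gives invariance with s = r when delta = T. *)
  exists (Rmin (Rmin rho e0) (Rmin 1 (/ K))). split; [repeat apply Rmin_glb_lt; lra|].
  intros r Hr. split.
  - intros HT. assert (HT' := HT). rewrite ET in HT'.
    assert (Htail : forall x, A0 x -> (forall n : nat, zf x n <> RtoC 0) ->
      tail_asymptotics delta gamma d (zf x) (wf x)).
    { intros x Hx Hz0. destruct (Hlim x Hx) as [Lz Lw].
      apply (subcritical_asymptotics p q a delta b gamma d l1 Ha Hdelta Hpexp Hqb Hb00 Hl1 Hbgd Hd Hedge1
        _ _ 0 HT' (Hz x) (Hw x)); auto. }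
    assert (Hesc : (d < delta)%nat -> forall x, A0 x -> escape_rates delta d alpha (zf x) (wf x)).
    { intros Hdd x Hx. destruct (Hlim x Hx) as [Lz Lw].
      apply (basin_escape_rates p q a delta b gamma d l1 Ha Hdelta Hpexp Hqb Hb00 Hl1 Hbgd Hd Hedge1 Hg);
        auto. }
    split; [|split; [|split; [|split]]].
    + intros Hdd x Hx HZp. assert (Elam : lam = d) by (unfold lam; lia). rewrite Elam.
      assert (Pd : 0 < INR d) by (apply lt_INR in Hdd; lra).
      destruct (Hlim x Hx) as [Lz Lw].
      assert (Hz0 : forall n, zf x n <> 0%C).
      { intros n F. apply HZp. exists n. rewrite <- (iterf_fst p q). exact F. }
      destruct (Htail x Hx Hz0) as (L & _ & HL & Hw0).
      assert (HLd := faster_scale_lim_0 delta d (zf x) L D2 Hdd HL).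
      split.
      * destruct Hw0 as [[_ Hw0]|(N & M & _ & H1 & H2 & _)].
        -- exists m_infty. split; [apply (log_rate_zero d (wf x) Pd Hw0)|].
           destruct Hw0 as [N HN]. apply (scaled_logb_lim_zero _ _ N Pd).
           intros n Hn. unfold wf in HN. rewrite (HN n Hn), Cmod_0. apply Rmult_0_l.
        -- destruct (rate_delta_lt_d delta d gamma (zf x) (wf x) L N M D2 HL H2 Hdd) as [l Hl].
           exists l. split; [apply (log_rate_nonzero d (wf x) l N H1 Hl)|].
           apply (log_rate_ratio d alpha (zf x) (wf x) l N Pd); auto.
      * destruct (Cmod_lim_0_small (zf x) 1 Lz Rlt_0_1) as [N1 HN1].
        destruct (Cmod_lim_0_small (wf x) 1 Lw Rlt_0_1) as [N2 HN2].
        apply (log_rate_max_trivial d (zf x) (wf x) (Nat.max N1 N2) Pd); auto.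
        intros n Hn. split; left; [apply HN1|apply HN2]; lia.
    + intros Hdd x Hx. assert (Elam : lam = delta) by (unfold lam; lia). rewrite Elam.
      destruct (Hlim x Hx) as [Lz Lw].
      destruct (classic (exists n, zf x n = 0%C)) as [(N & HN)|Hno].
      * assert (Hz0 := z_zero_forever p a delta Hdelta Hpexp (zf x) (Hz x) N HN).
        assert (Gw : log_rate delta (fun n => Cmod (wf x n)) m_infty).
        { destruct (axis_orbit q delta b gamma d l1 Hdelta Hqb Hb00 Hl1 Hedge1 (zf x) (wf x) (Hw x) N
            (or_introl HT') Hz0 Lw) as [F|[[M F] Hl]].
          - apply log_rate_zero; [lra|exact F].
          - exact (log_rate_nonzero _ _ _ M F Hl). }
        (* Once z_n = 0 the maximum is |w_n|, so G_p and G_f are both minus infinity. *)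
        split; [exact Gw|]. exists m_infty.
        split; [apply HGp, log_rate_zero; [lra|exists N; exact Hz0]|].
        apply (log_rate_ext delta (fun n => Cmod (wf x n)) _ _ N); [|exact Gw].
        intros n Hn. unfold zf in Hz0. rewrite (Hz0 n Hn), Cmod_0, Rmax_right; [reflexivity|apply Cmod_ge_0].
      * assert (Hz0 : forall n, zf x n <> 0%C) by (intros n F; apply Hno; exists n; exact F).
        destruct (Htail x Hx Hz0) as (L & _ & HL & Hw0).
        destruct (z_decay p a delta Ha Hdelta Hpexp (zf x) (Hz x) 0 (fun n _ => Hz0 n) Lz) as (c & m & Hc & Hzd).
        assert (Hw1 : eventually_zero (wf x) \/ ((exists N, forall n, (N <= n)%nat -> wf x n <> 0%C) /\
          is_lim_seq (fun n => / INR delta ^ n * logmod (wf x) n) m_infty)).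
        { destruct Hw0 as [[_ Hw0]|(N & M & _ & H1 & H2 & _)]; [left; exact Hw0|right].
          split; [exists N; exact H1|].
          exact (rate_delta_eq_d delta d gamma (zf x) (wf x) N M D2 H2 c m Hdd Hg Hc Hzd). }
        split.
        -- destruct Hw1 as [F|[[M F] Hl]]; [apply (log_rate_zero delta (wf x)); [lra|exact F]|].
           exact (log_rate_nonzero _ _ _ M F Hl).
        -- exists L. split; [apply HGp, (log_rate_nonzero _ _ _ 0); auto|].
           apply (log_rate_max_dominated delta (zf x) (wf x) L 0); auto. lra.
    + intros Hdd Hd1 x Hx.
      destruct (Hconcl Hdd x (proj1 Hx) (Hesc Hdd x Hx)) as (l & G1 & _ & _ & G2).
      destruct (G2 Hd1) as [G3 G4]. split; [|exact G4]. intros HE. exists l. auto.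
    + intros Hd0 x Hx. assert (Hdd : (d < delta)%nat) by lia.
      destruct (Hconcl Hdd x (proj1 Hx) (Hesc Hdd x Hx)) as (l & G1 & _ & G2 & _). exists l. auto.
    + intros Hdd x Hx.
      destruct (Hconcl Hdd x (proj1 Hx) (Hesc Hdd x Hx)) as (l & G1 & G2 & _). exists l. auto.
  - intros HT Hd2 Hdd. assert (HT' := HT). rewrite ET in HT'.
    assert (Hfin : forall x, (forall n, D (iterf p q n x)) -> escape_rates delta d alpha (zf x) (wf x) ->
      (~ Ew x -> exists l, Gp_is p delta (fst x) l /\ Gz_is p q lam x (Rbar_mult (Finite alpha) l))
      /\ (Ew x -> Gz_is p q lam x m_infty)
      /\ (exists l, Gp_is p delta (fst x) l /\ Gfa_is p q lam alpha x (Rbar_mult (Finite alpha) l))).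
    { intros x HD He. destruct (Hconcl Hdd x HD He) as (l & G1 & G2 & _ & G3).
      destruct (G3 ltac:(lia)) as [G4 G5].
      split; [intros HE; exists l; auto|]. split; [exact G5|]. exists l; auto. }
    split.
    + intros x (n0 & HD & Hz1 & Hw1).
      assert (M1 := Rmin_l (Rmin rho e0) (Rmin 1 (/ K))). assert (M2 := Rmin_r (Rmin rho e0) (Rmin 1 (/ K))).
      assert (M3 := Rmin_l rho e0). assert (M4 := Rmin_r rho e0).
      assert (H0 : wedge l1 r r (zf x n0) (wf x n0)).
      (* At z = 0 the strict bound on |w| would be 0, so U r contains no such point. *)
      { assert (Hz0 : zf x n0 <> 0%C).
        { intros F. unfold zf in F. rewrite F, Cmod_0, powR0_0, Rmult_0_r in Hw1.
          assert (P := Cmod_ge_0 (snd (iterf p q n0 x))). lra. }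
        split; [exact Hz0|]. split; [exact Hz1|]. rewrite powR0_pos in Hw1 by (apply Cmod_gt_0, Hz0).
        exact Hw1. }
      destruct (Hwedge (zf x) (wf x) r r n0 (Hz x) (Hw x) ltac:(lra) ltac:(lra)
        (wedge_radius_critical delta gamma d l1 Hl1 K r HK ltac:(lra) HT' Hd2) H0) as [Hin Hta].
      apply Hfin; [|apply tail_asymptotics_escape_rates; assumption].
      (* Up to n0 the domain condition is part of [preim]; afterwards |z_n| < r < e0. *)
      intros n. destruct (Nat.le_gt_cases n n0) as [Hn|Hn]; [apply HD, Hn|].
      apply (Rbar_lt_down Rad _ e0); [|exact HDe0].
      destruct (Hin n ltac:(lia)) as (_ & Q & _). unfold zf in Q. lra.
    + intros Hn x Hx. destruct (Hlim x Hx) as [Lz Lw]. apply Hfin; [apply Hx|].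
      apply (basin_escape_rates p q a delta b gamma d l1 Ha Hdelta Hpexp Hqb Hb00 Hl1 Hbgd Hd Hedge1 Hg); auto.
      right. split; [exact HT'|]. split; [exact Hd2|]. rewrite <- ET. apply Hstrict; assumption.
Qed.
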